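(* Let $\Psi\subset L^2(\mathbb{R})^n$ be a semi-orthogonal wavelet and $V_0$ the core space of the associated GMRA. Then the multiplicity function $m_{V_0}$ and the dimension function $\dim_{V_0}$ of $V_0$ are equal and they are given by $$m_{V_0}(\xi)=\dim_{V_0}(\xi)=\sum_{\psi\in\Psi}\sum_{m\ge1}\sum_{i=1}^n\sum_{k\in\mathbb{Z}}|\hat\psi_{\sigma^m(i)}|^2\big(N^m(\xi-\theta_i+2k\pi)\big)$$ for almost all $\xi\in[-\pi,\pi)$.
   Context: Setting: fix integers $N\ge 2$, $n\ge 1$, a permutation $\sigma$ of $\{1,\dots,n\}$ and points $z_k=e^{-i\theta_k}$ with $\theta_k\in[-\pi,\pi)$ and $z_k^N=z_{\sigma(k)}$ for all $k\in\{1,\dots,n\}$. On $L^2(\mathbb{R})$ let $T_0f(x)=f(x-1)$ and $U_0f(x)=\frac1{\sqrt N}f(x/N)$. On $L^2(\mathbb{R})^n$ let $T(f_1,\dots,f_n)=(z_1T_0f_1,\dots,z_nT_0f_n)$ and $U(f_1,\dots,f_n)=(U_0f_{\sigma(1)},\dots,U_0f_{\sigma(n)})$. Fourier transform: $\hat f(\xi)=\int_{\mathbb{R}}f(x)e^{-i\xi x}\,dx$ (extended to $L^2(\mathbb{R})$ by density); $\hat\psi_i$ is the Fourier transform of the $i$-th component of $\psi\in L^2(\mathbb{R})^n$. Fibers: $\mathcal{T}_{per}\varphi(\xi)\in\ell^2(\mathbb{Z})^n$ is given by $\mathcal{T}_{per}\varphi(\xi)(k,i)=\hat\varphi_i(\xi-\theta_i+2k\pi)$.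 A closed subspace $V$ of $L^2(\mathbb{R})^n$ is shift invariant if $T^kV\subset V$ for all $k\in\mathbb{Z}$. Its range function $J_{per}$ is the (a.e. unique) weakly measurable map from $\mathbb{R}$ to closed subspaces of $\ell^2(\mathbb{Z})^n$ with $J_{per}(\xi+2k\pi)=\lambda(k)^*(J_{per}(\xi))$, where $(\lambda(s)\alpha)(k,i)=\alpha(k-s,i)$, such that $V=\{f: \mathcal{T}_{per}f(\xi)\in J_{per}(\xi)\text{ for a.e. }\xi\}$. The dimension function is $\dim_V(\xi)=\dim(J_{per}(\xi))\in\{0,1,\dots,\infty\}$. Multiplicity function of $V$: the (a.e. unique) measurable $m_V:[-\pi,\pi)\to\{0,1,\dots,\infty\}$ such that, with $S_j=\{\xi: m_V(\xi)\ge j\}$, there is a unitary $\mathcal{J}:V\to\bigoplus_{j=1}^\infty L^2(S_j)$ with $\mathcal{J}T^k=\rho_k\mathcal{J}$ for all $k\in\mathbb{Z}$, where $\rho_k$ is multiplication by $e^{-ik\xi}$ in each component. A finite set $\Psi\subset L^2(\mathbb{R})^n$ is a semi-orthogonal wavelet if the affine system $\{U^jT^k\psi: j,k\in\mathbb{Z},\psi\in\Psi\}$ is a normalized tight frame for $L^2(\mathbb{R})^n$ (i.e. $\sum_{j,k,\psi}|\langle f\,|\,U^jT^k\psi\rangle|^2=\|f\|^2$ for all $f$) and $W_i\perp W_j$ for $i\ne j$, where $W_j=\overline{\operatorname{span}}\{U^{-j}T^k\psi: k\in\mathbb{Z},\psi\in\Psi\}$. The associated GMRA is $V_j=\overline{\operatorname{span}}\{U^mT^k\psi: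 m>-j,k\in\mathbb{Z},\psi\in\Psi\}$, $j\in\mathbb{Z}$; $V_0$ is its core space. *)

(* Defs.v *)
From HB Require Import structures.
From mathcomp Require Import all_boot all_order all_algebra all_fingroup.
From mathcomp Require Import all_classical all_reals all_analysis.
From mathcomp Require Import measurable_realfun.
From mathcomp Require Export complex.

Set Implicit Arguments.
Unset Strict Implicit.
Unset Printing Implicit Defensive.

Import Order.TTheory GRing.Theory Num.Theory.
Import numFieldNormedType.Exports.

Local Open Scope classical_set_scope.
Local Open Scope ring_scope.
Local Open Scope complex_scope.

Section Complex_analysis.
Context (R : realType).
Implicit Types (D : set R) (f g : R -> R[i]).

Definition normsq (z : R[i]) : R := ComplexField.Normc.normc z ^+ 2.

Definition expi (t : R) : R[i] := cos t +i* sin t.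

Definition cmeasurable D f : Prop :=
  measurable_fun D (fun x => complex.Re (f x)) /\ measurable_fun D (fun x => complex.Im (f x)).

Definition cintegrable f : Prop :=
  lebesgue_measure.-integrable setT (fun x => (complex.Re (f x))%:E) /\
  lebesgue_measure.-integrable setT (fun x => (complex.Im (f x))%:E).

Definition cintegral f : R[i] :=
  (\int[lebesgue_measure]_x complex.Re (f x)) +i* (\int[lebesgue_measure]_x complex.Im (f x)).

Definition sqnorm D f : \bar R :=
  (\int[lebesgue_measure]_(x in D) (normsq (f x))%:E)%E.

(* Elements of L^2 are handled through their representatives, with equality
   almost everywhere. *)
Definition L2 f : Prop := cmeasurable setT f /\ (sqnorm setT f < +oo)%E.

Definition fourierL1 f : R -> R[i] :=
  fun xi => cintegral (fun x => f x * expi (- (xi * x))).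

(* g is an L^2 limit of the transforms of some u_k in L^1 `&` L^2 which tend to
   f in L^2, i.e. g is the extension by density of fourierL1 at f. *)
Definition is_fourier f g : Prop :=
  L2 g /\ exists u : nat -> R -> R[i],
    [/\ forall k, cintegrable (u k) /\ L2 (u k),
        sqnorm setT (fun x => u k x - f x) @[k --> \oo] --> 0%E &
        sqnorm setT (fun xi => fourierL1 (u k) xi - g xi) @[k --> \oo] --> 0%E].

Definition fourier f : R -> R[i] := xget (fun=> 0) [set g | is_fourier f g].

End Complex_analysis.

Section Vectors.
Context (R : realType) (n : nat).

Definition vec := 'I_n -> R -> R[i].

Implicit Types (f g : vec) (A : set vec).

Definition L2n f : Prop := forall i, L2 (f i).

Definition sqnormn f : \bar R := (\sum_(i < n) sqnorm setT (f i))%E.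

Definition dotn f g : R[i] :=
  \sum_(i < n) cintegral (fun x => f i x * conjc (g i x)).

Definition linspan A : set vec :=
  [set f | exists (d : nat) (c : 'I_d -> R[i]) (v : 'I_d -> vec),
     (forall l, A (v l)) /\ forall i x, f i x = \sum_(l < d) c l * v l i x].

Definition clspan A : set vec :=
  [set f | L2n f /\ forall e : R, 0 < e -> exists2 g, linspan A g &
     (sqnormn (fun i x => f i x - g i x)%R < e%:E)%E].

End Vectors.

Section Fibers.
Context (R : realType) (n : nat).

(* l^2(Z)^n consists of the a : zseq such that l2 a; a (k, i) is the k-th term
   of the i-th component. *)
Definition zseq := int * 'I_n -> R[i].

Implicit Types (a b : zseq) (M : set zseq).

Definition l2sqnorm a : \bar R := (\esum_(q in [set: int * 'I_n]) (normsq (a q))%:E)%E.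

Definition l2 a : Prop := (l2sqnorm a < +oo)%E.

(* Only meaningful for absolutely summable families h. *)
Definition rsum (h : int * 'I_n -> R) : R :=
  fine (\esum_(q in [set: int * 'I_n]) (EFin \o h)^\+ q -
        \esum_(q in [set: int * 'I_n]) (EFin \o h)^\- q)%E.

Definition l2dot a b : R[i] :=
  rsum (fun q => complex.Re (a q * conjc (b q))) +i* rsum (fun q => complex.Im (a q * conjc (b q))).

Definition closed_subspace M : Prop :=
  [/\ M `<=` l2,
      M (fun=> 0),
      forall (c : R[i]) a b, M a -> M b -> M (fun q => c * a q + b q) &
      forall a, l2 a ->
        (forall e : R, 0 < e -> exists2 b, M b &
           (l2sqnorm (fun q => a q - b q)%R < e%:E)%E) ->
        M a].

Definition lin_indep (d : nat) (v : 'I_d -> zseq) : Prop :=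
  forall c : 'I_d -> R[i],
    (forall q, \sum_(l < d) c l * v l q = 0) -> forall l, c l = 0.

Definition subspace_dim M : \bar R :=
  ereal_sup [set d%:R%:E | d in
    [set d : nat | exists v : 'I_d -> zseq, (forall l, M (v l)) /\ lin_indep v]].

Definition orth_proj M (P : zseq -> zseq) : Prop :=
  forall a, l2 a ->
    M (P a) /\ forall b, M b -> l2dot (fun q => a q - P a q) b = 0.

Definition weakly_measurable (J : R -> set zseq) : Prop :=
  exists P : R -> zseq -> zseq,
    (forall xi, orth_proj (J xi) (P xi)) /\
    (forall a b, l2 a -> l2 b -> cmeasurable setT (fun xi => l2dot (P xi a) b)).

Definition lambda (s : int) a : zseq := fun q => a (q.1 - s, q.2).

End Fibers.

(* F^k for k in Z, where G is the inverse of F. *)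
Definition iterz (T : Type) (F G : T -> T) (k : int) : T -> T :=
  match k with Posz m => iter m F | Negz m => iter m.+1 G end.

Section Wavelets.
Context (R : realType) (N n : nat) (sigma : {perm 'I_n}) (theta : 'I_n -> R).

Definition zpt (k : 'I_n) : R[i] := expi (- theta k).

Definition shift (f : vec R n) : vec R n := fun i x => zpt i * f i (x - 1).

Definition shift_inv (f : vec R n) : vec R n :=
  fun i x => (zpt i)^-1 * f i (x + 1).

Definition dilation (f : vec R n) : vec R n :=
  fun i x => ((Num.sqrt N%:R)^-1)%:C * f (sigma i) (x / N%:R).

Definition dilation_inv (f : vec R n) : vec R n :=
  fun i x => (Num.sqrt N%:R)%:C * f ((sigma^-1)%g i) (N%:R * x).

Lemma zpt_neq0 k : zpt k != 0.
Proof.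
apply/eqP => -[c0 s0]; have := cos2Dsin2 (- theta k).
by rewrite c0 s0 expr0n addr0 => /eqP; rewrite eq_sym oner_eq0.
Qed.

Lemma shiftK : cancel shift shift_inv.
Proof.
move=> f; apply/funext => i; apply/funext => x.
by rewrite /shift_inv /shift addrK mulrA mulVf ?zpt_neq0 ?mul1r.
Qed.

Lemma shift_invK : cancel shift_inv shift.
Proof.
move=> f; apply/funext => i; apply/funext => x.
by rewrite /shift_inv /shift subrK mulrA mulfV ?zpt_neq0 ?mul1r.
Qed.

Lemma dilationK : (0 < N)%N -> cancel dilation dilation_inv.
Proof.
move=> N0 f; apply/funext => i; apply/funext => x.
have NR : N%:R != 0 :> R by rewrite pnatr_eq0 -lt0n.
have sN : Num.sqrt N%:R != 0 :> R by rewrite sqrtr_eq0 -ltNge ltr0n.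
rewrite /dilation_inv /dilation mulrA -rmorphM /= mulfV// mul1r permKV.
by rewrite mulrAC mulfV ?mul1r.
Qed.

Lemma dilation_invK : (0 < N)%N -> cancel dilation_inv dilation.
Proof.
move=> N0 f; apply/funext => i; apply/funext => x.
have NR : N%:R != 0 :> R by rewrite pnatr_eq0 -lt0n.
have sN : Num.sqrt N%:R != 0 :> R by rewrite sqrtr_eq0 -ltNge ltr0n.
rewrite /dilation_inv /dilation mulrA -rmorphM /= mulVf// mul1r permK.
by rewrite mulrC divfK.
Qed.

Definition shiftz : int -> vec R n -> vec R n := iterz shift shift_inv.

Definition dilationz : int -> vec R n -> vec R n :=
  iterz dilation dilation_inv.

Definition Tper (f : vec R n) (xi : R) : zseq R n :=
  fun q => fourier (f q.2) (xi - theta q.2 + 2 * q.1%:~R * pi).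

(* lambda (- k) is the adjoint of the unitary lambda k. *)
Definition range_function (V : set (vec R n)) (J : R -> set (zseq R n)) : Prop :=
  [/\ forall xi, closed_subspace (J xi),
      weakly_measurable J,
      forall xi (k : int), J (xi + 2 * k%:~R * pi) = lambda (- k) @` J xi &
      V = [set f | L2n f /\
             {ae lebesgue_measure, forall xi, J xi (Tper f xi)}]].

Definition level (m : R -> \bar R) (j : nat) : set R :=
  [set xi | (xi \in `[- pi, pi[) /\ (j%:R%:E <= m xi)%E].

(* The direct sum of the L^2(S_j) with S_j = level m j for j >= 1; the component
   g j only matters on S_j, and g 0 is not used. *)
Definition dsum_sqnorm (m : R -> \bar R) (g : nat -> R -> R[i]) : \bar R :=
  (\sum_(1 <= j <oo) sqnorm (level m j) (g j))%E.

Definition dsum (m : R -> \bar R) (g : nat -> R -> R[i]) : Prop :=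
  (forall j, (1 <= j)%N -> cmeasurable (level m j) (g j)) /\
  (dsum_sqnorm m g < +oo)%E.

Definition dsum_eq (m : R -> \bar R) (g h : nat -> R -> R[i]) : Prop :=
  forall j, (1 <= j)%N ->
    {ae lebesgue_measure, forall xi, level m j xi -> g j xi = h j xi}.

Definition multiplicity_function (V : set (vec R n)) (m : R -> \bar R) : Prop :=
  [/\ measurable_fun `[- pi, pi[%classic m,
      forall xi, xi \in `[- pi, pi[ ->
        m xi = +oo%E \/ exists d : nat, m xi = d%:R%:E &
      exists JJ : vec R n -> nat -> R -> R[i],
        [/\ forall f, V f -> dsum m (JJ f),
            forall (c : R[i]) f g, V f -> V g ->
              dsum_eq m (JJ (fun i x => c * f i x + g i x))
                        (fun j xi => c * JJ f j xi + JJ g j xi),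
            forall f, V f -> dsum_sqnorm m (JJ f) = sqnormn f,
            forall h, dsum m h -> exists2 f, V f & dsum_eq m (JJ f) h &
            forall (k : int) f, V f ->
              dsum_eq m (JJ (shiftz k f))
                        (fun j xi => expi (- (k%:~R * xi)) * JJ f j xi)]].

Context (p : nat) (psi : 'I_p -> vec R n).

Definition normalized_tight_frame : Prop :=
  forall f, L2n f ->
    (\sum_(a < p) \esum_(q in [set: int * int])
       (normsq (dotn f (dilationz q.1 (shiftz q.2 (psi a)))))%:E = sqnormn f)%E.

Definition wavelet_space (j : int) : set (vec R n) :=
  clspan [set g | exists (k : int) (a : 'I_p),
                    g = dilationz (- j) (shiftz k (psi a))].

(* The finite set is { psi a | a < p }, enumerated without repetition. *)
Definition semiorthogonal_wavelet : Prop :=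
  [/\ forall a, L2n (psi a),
      forall a b,
        (forall i, {ae lebesgue_measure, forall x, psi a i x = psi b i x}) ->
        a = b,
      normalized_tight_frame &
      forall i j : int, i != j ->
        forall f g, wavelet_space i f -> wavelet_space j g -> dotn f g = 0].

Definition gmra (j : int) : set (vec R n) :=
  clspan [set g | exists (m k : int) (a : 'I_p),
                    - j < m /\ g = dilationz m (shiftz k (psi a))].

Definition core_space : set (vec R n) := gmra 0.

End Wavelets.

(* Main.v *)
(* Write P(xi) for the projection onto the fiber space J(xi) and, for an index
   q = (k, i) of l^2(Z)^n, A_q(xi) = <P(xi) delta_q, delta_q>. The dimension of
   J(xi) is the trace, the sum of the A_q(xi), so it suffices to compute A_q from
   the wavelet and from the multiplicity function.

   For E inside [-pi, pi) let F be the function whose Fourier transform is the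
   indicator of a translate of E, placed so that the fibers of F are 1_E delta_q.
   The projection of F onto V_0 has fibers 1_E P(xi) delta_q, hence its squared
   norm is a multiple of the integral of A_q over E (Plancherel and
   periodization).

   The same norm is computed from the wavelet: by semi-orthogonality only the
   dilations of index m >= 1 of the tight frame see the projection, and they see F
   itself. When E has length at most 2 pi N^-M, Parseval's identity on an interval
   of length 2 pi turns the sum over the translations into the integral over E of
   the density |psi^_{sigma^m(i)}|^2 (N^m (xi - theta_i + 2 k pi)) for m <= M. A
   level m > M is overestimated by a factor at most N^(m - M); when xi - theta_i +
   2 k pi stays in an annulus c <= |y| < c N its dilates are disjoint, so these
   levels add up to at most N^-M times the integral of the |psi^|^2. Hence A_q is
   the density summed over m >= 1.

   The norm is also computed from the unitary of the multiplicity function: the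
   generator of the j-th summand has fibers e_j(xi), and the Fourier coefficients of
   its q-th component are inner products with shifts of F. This gives the sum over
   q of A_q as the sum over j of 1_{S_j}, that is m_{V_0}.

   Plancherel's theorem is itself obtained from the autocorrelation of a function
   and the Poisson kernel; Parseval's identity on an interval follows from
   Plancherel's, as Bessel's inequality integrated over all translates becomes an
   equality. *)
Require Import Defs.
From HB Require Import structures.
From mathcomp Require Import all_boot all_order all_algebra all_fingroup.
From mathcomp Require Import all_classical all_reals all_analysis.
From mathcomp Require Import measurable_realfun.
From mathcomp Require Import ring lra.

Set Implicit Arguments.
Unset Strict Implicit.
Unset Printing Implicit Defensive.

Import Order.TTheory GRing.Theory Num.Theory.
Import numFieldNormedType.Exports.

Local Open Scope classical_set_scope.
Local Open Scope ring_scope.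
Local Open Scope complex_scope.

Local Notation Re := complex.Re.
Local Notation Im := complex.Im.

(** * Complex numbers and inner products *)

Section Complex_numbers.
Context (R : realType).
Implicit Types (z w : R[i]) (t : R).

(** Parseval's identity evaluates level m of the frame exactly only while N^m E fits in an interval
    of length 2 pi, and no E of positive measure does so for all m. Cutting E finely makes any
    finite number of levels exact, which bounds the trace from below; the upper bound has to control
    infinitely many levels at once. There the Bessel loss N^(m - M) is N^-M times the Jacobian N^m
    of the dilation, so the tail is N^-M times a sum of integrals over the dilates of E. If these
    are disjoint, one integrable function bounds the sum; this is what the annuli are for. The
    projection of F onto V_0 is constructed, not deduced from completeness of V_0: its fibers are
    prescribed, unfolded to functions on the line, and transformed back, since the Fourier transform
    is onto. Measurability of these fibers is the weak measurability of the range function.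
    Functions stand for their classes and [fourier] is a chosen representative, so identities
    between transforms hold almost everywhere, and only countably many may be combined: hence annuli
    with rational radii and fibers tested one entry q at a time. *)

Lemma eqcP z w : Re z = Re w -> Im z = Im w -> z = w.
Proof. by case: z w => [a b] [c d] /= -> ->. Qed.

Lemma cReD z w : Re (z + w) = Re z + Re w. Proof. by case: z w => [a b] [c d]. Qed.
Lemma cImD z w : Im (z + w) = Im z + Im w. Proof. by case: z w => [a b] [c d]. Qed.
Lemma cReN z : Re (- z) = - Re z. Proof. by case: z. Qed.
Lemma cImN z : Im (- z) = - Im z. Proof. by case: z. Qed.
Lemma cReM z w : Re (z * w) = Re z * Re w - Im z * Im w.
Proof. by case: z w => [a b] [c d]. Qed.
Lemma cImM z w : Im (z * w) = Re z * Im w + Im z * Re w.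
Proof. by case: z w => [a b] [c d]. Qed.
Lemma cReJ z : Re (conjc z) = Re z. Proof. by case: z. Qed.
Lemma cImJ z : Im (conjc z) = - Im z. Proof. by case: z. Qed.

Definition cE := (cReD, cImD, cReN, cImN, cReM, cImM, cReJ, cImJ).

Lemma cRe_sum I (s : seq I) (P : pred I) (F : I -> R[i]) :
  Re (\sum_(i <- s | P i) F i) = \sum_(i <- s | P i) Re (F i).
Proof. by rewrite (big_morph (@complex.Re R) cReD (erefl : Re (0 : R[i]) = 0)). Qed.

Lemma normsqE z : normsq z = Re z ^+ 2 + Im z ^+ 2.
Proof. by case: z => a b; rewrite /normsq /= sqr_sqrtr // addr_ge0 ?sqr_ge0. Qed.

Lemma normsq_ge0 z : 0 <= normsq z.
Proof. by rewrite normsqE addr_ge0 ?sqr_ge0. Qed.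

Lemma normsq0 : normsq (0 : R[i]) = 0.
Proof. by rewrite normsqE /= expr0n addr0. Qed.

Lemma normsq1 : normsq (1 : R[i]) = 1.
Proof. by rewrite normsqE /= expr1n expr0n addr0. Qed.

Lemma normsq_eq0 z : normsq z = 0 -> z = 0.
Proof.
rewrite normsqE => /eqP; rewrite paddr_eq0 ?sqr_ge0// !sqrf_eq0.
by case/andP => /eqP h1 /eqP h2; exact: eqcP.
Qed.

Lemma normsqM z w : normsq (z * w) = normsq z * normsq w.
Proof. by rewrite !normsqE !cE; ring. Qed.

Lemma normsqN z : normsq (- z) = normsq z.
Proof. by rewrite !normsqE !cE; ring. Qed.

Lemma normsqJ z : normsq (conjc z) = normsq z.
Proof. by rewrite !normsqE !cE; ring. Qed.

Lemma normsqR (a : R) : normsq a%:C = a ^+ 2.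
Proof. by rewrite !normsqE /=; ring. Qed.

Lemma mulJ z : z * conjc z = (normsq z)%:C.
Proof. by apply: eqcP; rewrite normsqE !cE /=; ring. Qed.

(** The weight d is kept free: d tending to 0 keeps the constant of z close to 1 in [parseval], and
    d = 1 / L drives the induction of [normsq_sum_le]. *)
Lemma normsqD_le (d : R) z w : 0 < d ->
  normsq (z + w) <= (1 + d) * normsq z + (1 + d^-1) * normsq w.
Proof.
move=> d0; rewrite !normsqE !cE -subr_ge0.
set a := Re z; set b := Im z; set c := Re w; set e := Im w.
have -> : (1 + d) * (a ^+ 2 + b ^+ 2) + (1 + d^-1) * (c ^+ 2 + e ^+ 2) -
    ((a + c) ^+ 2 + (b + e) ^+ 2) = d^-1 * ((d * a - c) ^+ 2 + (d * b - e) ^+ 2).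
  by field; rewrite gt_eqF.
by apply: mulr_ge0; [rewrite invr_ge0 ltW|rewrite addr_ge0 ?sqr_ge0].
Qed.

Lemma normsqD_le2 z w : normsq (z + w) <= 2 * normsq z + 2 * normsq w.
Proof. by have := normsqD_le z w ltr01; rewrite invr1; congr (_ <= _); ring. Qed.

Lemma Re_sqr_le z : Re z ^+ 2 <= normsq z.
Proof. by rewrite normsqE lerDl sqr_ge0. Qed.

Lemma Im_sqr_le z : Im z ^+ 2 <= normsq z.
Proof. by rewrite normsqE lerDr sqr_ge0. Qed.

Lemma expiD s t : expi (s + t) = expi s * expi t :> R[i].
Proof. by apply: eqcP; rewrite !cE /= (cosD, sinD); ring. Qed.

Lemma expi0 : expi 0 = 1 :> R[i].
Proof. by rewrite /expi cos0 sin0. Qed.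

Lemma expiN t : expi (- t) = conjc (expi t) :> R[i].
Proof. by rewrite /expi cosN sinN. Qed.

Lemma normsq_expi t : normsq (expi t) = 1.
Proof. by rewrite normsqE /= cos2Dsin2. Qed.

Lemma expiNK t : expi (- t) * expi t = 1 :> R[i].
Proof. by rewrite -expiD addNr expi0. Qed.

Lemma expi_neq0 t : expi t != 0 :> R[i].
Proof.
apply/eqP => h; have := normsq_expi t; rewrite h normsq0 => /esym/eqP.
by rewrite oner_eq0.
Qed.

Lemma expiV t : (expi t)^-1 = expi (- t) :> R[i].
Proof. by apply: (mulIf (expi_neq0 t)); rewrite expiNK mulVf ?expi_neq0. Qed.

Lemma expi_2pi (k : int) : expi (2 * k%:~R * pi) = 1 :> R[i].
Proof.
have nat2pi (n : nat) : expi (2 * n%:R * pi) = 1 :> R[i].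
  elim: n => [|n IH]; first by rewrite mulr0 mul0r expi0.
  have -> : 2 * n.+1%:R * pi = 2 * n%:R * pi + pi *+ 2 :> R by rewrite -[n.+1%:R]natr1; ring.
  by rewrite expiD IH mul1r /expi cos2pi sin2pi.
case: k => n; first exact: nat2pi.
by rewrite NegzE mulrNz mulrN mulNr expiN nat2pi conjc1.
Qed.

End Complex_numbers.

Section Inner_product.
Context (R : realType) (X : Type) (H : (X -> R[i]) -> Prop)
  (dot : (X -> R[i]) -> (X -> R[i]) -> R[i]).

(** Semidefinite only, and on functions satisfying a predicate: the same facts then serve
    representatives in [L2], sequences in [l2] and, after uncurrying, vectors in [L2n]. *)
Definition inner_product : Prop :=
  [/\ H (fun=> 0),
      forall c f g, H f -> H g -> H (fun x => c * f x + g x),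
      forall c f g h, H f -> H g -> H h ->
        dot (fun x => c * f x + g x) h = c * dot f h + dot g h,
      forall f g, H f -> H g -> dot g f = conjc (dot f g) &
      forall f, H f -> 0 <= Re (dot f f)].

Context (ip : inner_product).

Let nn f := Re (dot f f).

Lemma ip_lin c f g : H f -> H g -> H (fun x => c * f x + g x).
Proof. by case: ip => _ + _ _ _; apply. Qed.

Lemma ip_dotl c f g h : H f -> H g -> H h ->
  dot (fun x => c * f x + g x) h = c * dot f h + dot g h.
Proof. by case: ip => _ _ + _ _; apply. Qed.

Lemma ip_dotC f g : H f -> H g -> dot g f = conjc (dot f g).
Proof. by case: ip => _ _ _ + _; apply. Qed.

Lemma ip_ge0 f : H f -> 0 <= nn f.
Proof. by case: ip => _ _ _ _; apply. Qed.

Lemma ip_H0 : H (fun=> 0). Proof. by case: ip. Qed.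

Lemma ip_scale c f : H f -> H (fun x => c * f x).
Proof.
move=> Hf; have := ip_lin c Hf ip_H0; congr H.
by apply/funext => x; rewrite addr0.
Qed.

Lemma ip_sub f g : H f -> H g -> H (fun x => f x - g x).
Proof.
move=> Hf Hg; have := ip_lin (-1) Hg Hf; congr H.
by apply/funext => x; rewrite mulN1r addrC.
Qed.

Lemma ip_sum I (s : seq I) (c : I -> R[i]) (e : I -> X -> R[i]) :
  (forall i, H (e i)) -> H (fun x => \sum_(i <- s) c i * e i x).
Proof.
move=> He; elim: s => [|i s IH].
  by have := ip_H0; congr H; apply/funext => x; rewrite big_nil.
have := ip_lin (c i) (He i) IH; congr H.
by apply/funext => x; rewrite big_cons.
Qed.

Lemma ip_dotr c f g h : H f -> H g -> H h ->
  dot h (fun x => c * f x + g x) = conjc c * dot h f + dot h g.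
Proof.
move=> Hf Hg Hh; rewrite (ip_dotC (ip_lin c Hf Hg) Hh) ip_dotl//.
by rewrite rmorphD rmorphM/= -!ip_dotC.
Qed.

Lemma ip_dot0l f : H f -> dot (fun=> 0) f = 0.
Proof.
move=> Hf; have := ip_dotl (-1) Hf Hf Hf.
have -> : (fun x => -1 * f x + f x) = fun=> 0.
  by apply/funext => x; rewrite mulN1r addNr.
by move=> ->; rewrite mulN1r addNr.
Qed.

Lemma ip_dotZl c f g : H f -> H g -> dot (fun x => c * f x) g = c * dot f g.
Proof.
move=> Hf Hg; have := ip_dotl c Hf ip_H0 Hg; rewrite ip_dot0l// addr0 => <-.
by congr dot; apply/funext => x; rewrite addr0.
Qed.

Lemma ip_dotZr c f g : H f -> H g -> dot f (fun x => c * g x) = conjc c * dot f g.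
Proof.
move=> Hf Hg; rewrite (ip_dotC (ip_scale c Hg) Hf) ip_dotZl//.
by rewrite rmorphM/= -ip_dotC.
Qed.

Lemma ip_dotBl f g h : H f -> H g -> H h ->
  dot (fun x => f x - g x) h = dot f h - dot g h.
Proof.
move=> Hf Hg Hh; have := ip_dotl (-1) Hg Hf Hh; rewrite mulN1r addrC => <-.
by congr dot; apply/funext => x; rewrite mulN1r addrC.
Qed.

Lemma ip_dotBr f g h : H f -> H g -> H h ->
  dot h (fun x => f x - g x) = dot h f - dot h g.
Proof.
move=> Hf Hg Hh; rewrite (ip_dotC (ip_sub Hf Hg) Hh) ip_dotBl//.
by rewrite rmorphB/= -!ip_dotC.
Qed.

Lemma ip_dotsuml I (s : seq I) (c : I -> R[i]) (e : I -> X -> R[i]) h :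
  (forall i, H (e i)) -> H h ->
  dot (fun x => \sum_(i <- s) c i * e i x) h = \sum_(i <- s) c i * dot (e i) h.
Proof.
move=> He Hh; elim: s => [|i s IH].
  by rewrite big_nil -[RHS](ip_dot0l Hh); congr dot; apply/funext => x; rewrite big_nil.
rewrite big_cons -IH -ip_dotl//; last exact: ip_sum.
by congr dot; apply/funext => x; rewrite big_cons.
Qed.

Lemma ip_nnE f : H f -> dot f f = (nn f)%:C.
Proof.
move=> Hf; apply: eqcP => //=.
have := congr1 (@complex.Im R) (ip_dotC Hf Hf); rewrite cImJ => /eqP.
by rewrite -subr_eq0 opprK -mulr2n mulrn_eq0 /= => /eqP.
Qed.

Lemma ip_nnD c f g : H f -> H g ->
  nn (fun x => c * f x + g x) =
  normsq c * nn f + 2 * Re (c * dot f g) + nn g.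
Proof.
move=> Hf Hg; rewrite /nn.
have Hfg := ip_lin c Hf Hg.
rewrite ip_dotl// !ip_dotr// (ip_dotC Hf Hg) (ip_nnE Hf) (ip_nnE Hg).
rewrite normsqE !cE /=; ring.
Qed.

Lemma ip_CS f g : H f -> H g -> normsq (dot f g) <= nn f * nn g.
Proof.
move=> Hf Hg.
(* The squared norm of - t conj<f, g> f + g, a real quadratic polynomial in t. *)
have key (t : R) : 0 <= normsq (dot f g) * t ^+ 2 * nn f -
    2 * t * normsq (dot f g) + nn g.
  have := ip_ge0 (ip_lin (- t%:C * conjc (dot f g)) Hf Hg).
  rewrite ip_nnD// normsqM normsqN normsqJ normsqR.
  have -> : Re (- t%:C * conjc (dot f g) * dot f g) = - (t * normsq (dot f g)).
    by rewrite -mulrA [conjc _ * _]mulrC mulJ !cE /=; ring.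
  by congr (_ <= _); ring.
have f0 := ip_ge0 Hf; have g0 := ip_ge0 Hg.
have [f1|f1] := eqVneq (nn f) 0.
  have [d0|d0] := eqVneq (normsq (dot f g)) 0; first by rewrite d0 mulr_ge0.
  (* With [nn f = 0] the polynomial is affine in t, and at this t it equals -1. *)
  have := key ((nn g + 1) / (2 * normsq (dot f g))); rewrite f1 mulr0 sub0r.
  have -> : 2 * ((nn g + 1) / (2 * normsq (dot f g))) * normsq (dot f g) = nn g + 1.
    by field.
  by lra.
have := key (nn f)^-1.
have -> : normsq (dot f g) * (nn f)^-1 ^+ 2 * nn f - 2 * (nn f)^-1 * normsq (dot f g) + nn g
   = (nn f)^-1 * (nn f * nn g - normsq (dot f g)) by field.
by rewrite pmulr_rge0 ?invr_gt0 ?lt_neqAle ?f0 1?eq_sym ?f1// subr_ge0.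
Qed.

(** Polarization: c = 1 gives the real part and c = - i the imaginary part. Every transfer of a norm
    identity to inner products goes through this lemma. *)
Lemma ip_dot_of_nn (f g : X -> R[i]) z : H f -> H g ->
  (forall c, nn (fun x => c * f x + g x) - nn g - normsq c * nn f = 2 * Re (c * z)) ->
  dot f g = z.
Proof.
move=> Hf Hg h.
have h1 c : Re (c * dot f g) = Re (c * z).
  have := h c; rewrite ip_nnD//; lra.
apply: eqcP; first by have := h1 1; rewrite !mul1r.
by have := h1 (- 'i); rewrite !cE /=; lra.
Qed.

Context (I : eqType) (e : I -> X -> R[i]) (K : R).
Context (K0 : 0 < K) (He : forall i, H (e i)).
Context (orth : forall i j, dot (e i) (e j) = if i == j then K%:C else 0).

(** K is the common squared norm of the orthogonal family: 2 pi for exponentials on a period, 1 for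
    orthonormal families of sequences. *)
Lemma ip_bessel_eq (s : seq I) f : uniq s -> H f ->
  nn (fun x => f x - \sum_(i <- s) (dot f (e i) / K%:C) * e i x) =
  nn f - K^-1 * \sum_(i <- s) normsq (dot f (e i)).
Proof.
move=> us Hf; set c := fun i => dot f (e i) / K%:C.
pose g := fun x => \sum_(i <- s) c i * e i x.
have Hg : H g by exact: ip_sum.
have Kn : K%:C != 0 :> R[i] by rewrite -(rmorph0 (real_complex R)) (inj_eq (@complexI R)) gt_eqF.
have cd i : c i * conjc (dot f (e i)) = (K^-1 * normsq (dot f (e i)))%:C.
  by rewrite /c mulrAC mulJ -fmorphV -rmorphM/= mulrC.
have dge i : i \in s -> dot g (e i) = dot f (e i).
  move=> si; rewrite ip_dotsuml// (bigD1_seq i)//= orth eqxx big1.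
    by rewrite addr0 /c divfK.
  by move=> j ji; rewrite orth (negbTE ji) mulr0.
have dgf : dot g f = (K^-1 * \sum_(i <- s) normsq (dot f (e i)))%:C.
  rewrite ip_dotsuml// mulr_sumr rmorph_sum/=; apply: eq_bigr => i _.
  by rewrite (ip_dotC Hf (He i)) cd.
have dgg : nn g = K^-1 * \sum_(i <- s) normsq (dot f (e i)).
  have -> : nn g = Re (dot g f); last by rewrite dgf.
  rewrite /nn {1}/g ip_dotsuml// [in RHS]/g ip_dotsuml//; congr (Re _).
  rewrite big_seq [RHS]big_seq; apply: eq_bigr => i si.
  by rewrite (ip_dotC Hg (He i)) dge// -ip_dotC.
have -> : (fun x => f x - \sum_(i <- s) c i * e i x) = fun x => -1 * g x + f x.
  by apply/funext => x; rewrite mulN1r addrC.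
rewrite ip_nnD// dgg dgf normsqN normsq1 !cE /=; ring.
Qed.

Lemma ip_bessel (s : seq I) f : uniq s -> H f ->
  \sum_(i <- s) normsq (dot f (e i)) <= K * nn f.
Proof.
move=> us Hf; have Hg := ip_sum s (fun i => dot f (e i) / K%:C) He.
have := ip_ge0 (ip_sub Hf Hg); rewrite ip_bessel_eq// subr_ge0.
by rewrite ler_pdivrMl.
Qed.

End Inner_product.

(** * Affine changes of variables and countable sums *)

Section Change_of_variables.
Context (R : realType).
Local Notation mu := (@lebesgue_measure R).
Local Open Scope ereal_scope.

Lemma measurable_affine (a b : R) : measurable_fun setT (fun x : R => a * x + b)%R.
Proof. by apply: measurable_funD => //; exact: mulrl_measurable. Qed.

(** The pushforward under the affine map, scaled by a, agrees with Lebesgue measure on half-open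
    intervals; uniqueness of the latter concludes. *)
Lemma lebesgue_measure_affine (a b : R) (A : set R) : (0 < a)%R -> measurable A ->
  mu A = a%:E * mu ((fun x => a * x + b)%R @^-1` A).
Proof.
move=> a0 mA.
pose phi : measurableTypeR R -> measurableTypeR R := fun x => (a * x + b)%R.
have mphi : measurable_fun setT phi by exact: measurable_affine.
pose nu : {measure set (measurableTypeR R) -> \bar R} :=
  mscale (NngNum (ltW a0))
    (measure_function_pushforward__canonical__measure_function_Measure mu mphi).
apply: (@lebesgue_measure_unique _ nu) => // _ [[x y]] _ <-.
change (mu `]x, y] = a%:E * mu (phi @^-1` `]x, y])).
have -> : phi @^-1` [set` `]x, y]] = [set` `]((x - b) / a)%R, ((y - b) / a)%R]].
  apply/seteqP; split => z; rewrite /phi /= !in_itv/= => /andP[h1 h2]; apply/andP; split.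
  - by rewrite ltr_pdivrMr// ltrBlDr mulrC.
  - by rewrite ler_pdivlMr// lerBrDr mulrC.
  - by move: h1; rewrite ltr_pdivrMr// ltrBlDr mulrC.
  - by move: h2; rewrite ler_pdivlMr// lerBrDr mulrC.
rewrite !lebesgue_measure_itv/= !lte_fin ltr_pM2r ?invr_gt0// ltrD2r.
case: ifPn => _; last by rewrite mule0.
by rewrite -!EFinD -EFinM; congr EFin; field; rewrite gt_eqF.
Qed.

Lemma ge0_integral_affine (a b : R) (f : R -> \bar R) : (0 < a)%R ->
  measurable_fun setT f -> (forall x, 0 <= f x) ->
  \int[mu]_x f (a * x + b)%R = (a^-1)%:E * \int[mu]_x f x.
Proof.
move=> a0 mf f0.
pose phi : measurableTypeR R -> measurableTypeR R := fun x => (a * x + b)%R.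
have mphi : measurable_fun setT phi by exact: measurable_affine.
pose nu : {measure set (measurableTypeR R) -> \bar R} :=
  mscale (NngNum (ltW a0))
    (measure_function_pushforward__canonical__measure_function_Measure mu mphi).
have -> : \int[mu]_x f x = \int[nu]_x f x.
  by apply: eq_measure_integral => A mA _; exact: lebesgue_measure_affine.
rewrite ge0_integral_mscale// muleA -EFinM mulVf ?gt_eqF// mul1e.
rewrite (@ge0_integral_pushforward _ _ _ _ _ phi mphi mu setT f)//.
Qed.

Lemma ge0_integral_shift (b : R) (f : R -> \bar R) :
  measurable_fun setT f -> (forall x, 0 <= f x) ->
  \int[mu]_x f (x + b)%R = \int[mu]_x f x.
Proof.
move=> mf f0; have := ge0_integral_affine b ltr01 mf f0.
by rewrite invr1 mul1e => <-; apply: eq_integral => x _; rewrite mul1r.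
Qed.

Lemma ge0_integral_reflect (f : R -> \bar R) :
  measurable_fun setT f -> (forall x, 0 <= f x) ->
  \int[mu]_x f (- x)%R = \int[mu]_x f x.
Proof.
move=> mf f0.
have -> : \int[mu]_x f x = \int[pushforward mu (-%R : measurableTypeR R -> measurableTypeR R)]_x f x.
  by apply: eq_measure_integral => A mA _; exact/esym/lebesgue_measureN.
by rewrite ge0_integral_pushforward//; exact: oppr_measurable.
Qed.

(** A positive factor commutes with the subtraction of extended reals whatever the values, infinite
    ones included. *)
Lemma integral_affine (a b : R) (f : R -> \bar R) : (0 < a)%R ->
  measurable_fun setT f ->
  \int[mu]_x f (a * x + b)%R = (a^-1)%:E * \int[mu]_x f x.
Proof.
move=> a0 mf; rewrite [in RHS]integralE [in LHS]integralE.
transitivity ((a^-1)%:E * \int[mu]_x f^\+ x - (a^-1)%:E * \int[mu]_x f^\- x).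
  congr (_ - _).
    rewrite -(ge0_integral_affine b a0 (measurable_funepos mf))//.
    by apply: eq_integral => x _; rewrite !funeposE.
  rewrite -(ge0_integral_affine b a0 (measurable_funeneg mf))//.
  by apply: eq_integral => x _; rewrite !funenegE.
have ai : (0 < a^-1)%R by rewrite invr_gt0.
case: (\int[mu]_x f^\+ x) => [r| |]; case: (\int[mu]_x f^\- x) => [s| |] //=;
  rewrite ?gt0_muley ?gt0_muleNy ?lte_fin//= -?EFinM -?EFinN -?EFinD -?EFinM ?mulrBr//=
    ?gt0_muley ?gt0_muleNy ?lte_fin//=.
Qed.

Lemma integrable_affine (a b : R) (f : R -> \bar R) : (0 < a)%R ->
  mu.-integrable setT f -> mu.-integrable setT (fun x => f (a * x + b)%R).
Proof.
move=> a0 /integrableP[mf fi]; apply/integrableP; split.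
  by apply: (measurableT_comp mf); exact: measurable_affine.
rewrite (ge0_integral_affine b a0 (measurableT_comp (@abse_measurable R setT) mf))//.
  by rewrite lte_mul_pinfty// lee_fin invr_ge0 ltW.
by move=> x /=.
Qed.

End Change_of_variables.

Section Sums.
Context (R : realType).
Local Open Scope ereal_scope.

(** Coding by [pickle] turns a sum over a countable type into a series, the form in which
    measurability of limits and exchange with the integral are available. Numbers that code nothing
    contribute 0. *)
Lemma esum_pickle (I : countType) (f : I -> \bar R) : (forall i, 0 <= f i) ->
  \esum_(i in [set: I]) f i = \sum_(k <oo) oapp f 0 (@pickle_inv I k).
Proof.
move=> f0.
have g0 k : 0 <= oapp f 0 (@pickle_inv I k) by case: pickle_inv => /=.
rewrite nneseries_esumT//.
rewrite [RHS](esumID (range (@pickle I)))//; 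
rewrite [X in _ + X]esum1 ?adde0; last first.
  move=> k [_ /= hk]; case E : pickle_inv => [i|//] /=.
  by exfalso; apply: hk; exists i => //; have := @pickle_invK I k; rewrite /ocancel E.
rewrite setTI [RHS]esum_image; last first.
  by move=> i j _ _; exact: (pcan_inj (@pickleK_inv I)).
by apply: eq_esum => i _; rewrite pickleK_inv.
Qed.

Lemma emeasurable_esum (I : countType) d (T : measurableType d) (D : set T)
    (f : I -> T -> \bar R) : measurable D ->
  (forall i, measurable_fun D (f i)) -> (forall i x, 0 <= f i x) ->
  measurable_fun D (fun x => \esum_(i in [set: I]) f i x).
Proof.
move=> mD mf f0.
have -> : (fun x => \esum_(i in [set: I]) f i x) =
    fun x => \sum_(k <oo) (if pickle_inv k is Some i then f i else fun=> 0) x.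
  apply/funext => x; rewrite esum_pickle//; apply: eq_eseriesr => k _.
  by case: pickle_inv.
apply: ge0_emeasurable_sum => [k x _ _|k _]; first by case: pickle_inv.
by case: pickle_inv => // i; exact: measurable_cst.
Qed.

Lemma integral_esum (I : countType) d (T : measurableType d)
    (mu : {measure set T -> \bar R}) (D : set T) (f : I -> T -> \bar R) : measurable D ->
  (forall i, measurable_fun D (f i)) -> (forall i x, 0 <= f i x) ->
  \int[mu]_(x in D) (\esum_(i in [set: I]) f i x) =
  \esum_(i in [set: I]) \int[mu]_(x in D) f i x.
Proof.
move=> mD mf f0.
transitivity (\int[mu]_(x in D) \sum_(k <oo) (if pickle_inv k is Some i then f i else fun=> 0) x).
  apply: eq_integral => x _; rewrite esum_pickle//; apply: eq_eseriesr => k _.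
  by case: pickle_inv.
rewrite integral_nneseries//; last 2 first.
- by move=> k; case: pickle_inv => // i; exact: measurable_cst.
- by move=> k x _; case: pickle_inv.
rewrite esum_pickle; last by move=> i; apply: integral_ge0.
by apply: eq_eseriesr => k _; case: pickle_inv => //=; rewrite integral0.
Qed.

Lemma esumZl (I : choiceType) (A : set I) (c : R) (f : I -> \bar R) : (0 <= c)%R ->
  (forall i, 0 <= f i) ->
  \esum_(i in A) (c%:E * f i) = c%:E * \esum_(i in A) f i.
Proof.
move=> c0 f0; rewrite /esum -ereal_supZl//; last first.
  by apply/set0P; exists 0; exists set0; [exact: fsets_set0|rewrite fsbig_set0].
congr ereal_sup; rewrite image_comp; apply: eq_imagel => F [finF _].
by rewrite /= ge0_mule_fsumr.
Qed.

Lemma esum_finprod (n : nat) (I : choiceType) (f : I * 'I_n -> \bar R) :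
  (forall q, 0 <= f q) ->
  \esum_(q in [set: I * 'I_n]) f q = \sum_(i < n) \esum_(k in [set: I]) f (k, i).
Proof.
move=> f0.
transitivity (\esum_(k in [set: I]) \esum_(i in [set: 'I_n]) f (k, i)).
  rewrite esum_esum//; congr esum; first by apply/seteqP; split => // -[].
  by apply/funext => -[].
rewrite -esum_sum//; apply: eq_esum => k _.
rewrite esum_fset//; last exact: finite_finset.
have -> : [set: 'I_n] = [set` index_enum 'I_n].
  by apply/seteqP; split => // i _ /=; rewrite mem_index_enum.
by rewrite -fsbig_seq// index_enum_uniq.
Qed.

End Sums.

(** * Square-integrable complex functions *)

Section Complex_integrals.
Context (R : realType).
Local Notation mu := (@lebesgue_measure R).
Implicit Types (D : set R) (f g h : R -> R[i]).

Lemma cmeasurable_cst D (c : R[i]) : cmeasurable D (fun=> c).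
Proof. by split; exact: measurable_cst. Qed.

Lemma cmeasurableD D f g : cmeasurable D f -> cmeasurable D g ->
  cmeasurable D (fun x => f x + g x).
Proof.
move=> [f1 f2] [g1 g2]; split.
  by under eq_fun do rewrite cReD; exact: measurable_funD.
by under eq_fun do rewrite cImD; exact: measurable_funD.
Qed.

Lemma cmeasurableM D f g : cmeasurable D f -> cmeasurable D g ->
  cmeasurable D (fun x => f x * g x).
Proof.
move=> [f1 f2] [g1 g2]; split.
  under eq_fun do rewrite cReM; apply: measurable_funB; exact: measurable_funM.
under eq_fun do rewrite cImM; apply: measurable_funD; exact: measurable_funM.
Qed.

Lemma cmeasurableZ D (c : R[i]) f : cmeasurable D f -> cmeasurable D (fun x => c * f x).
Proof. by move=> mf; apply: cmeasurableM => //; exact: cmeasurable_cst. Qed.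

Lemma cmeasurableN D f : cmeasurable D f -> cmeasurable D (fun x => - f x).
Proof.
move=> [f1 f2]; split.
  by under eq_fun do rewrite cReN; exact: measurable_funN.
by under eq_fun do rewrite cImN; exact: measurable_funN.
Qed.

Lemma cmeasurableB D f g : cmeasurable D f -> cmeasurable D g ->
  cmeasurable D (fun x => f x - g x).
Proof. by move=> mf mg; apply: cmeasurableD => //; exact: cmeasurableN. Qed.

Lemma cmeasurableJ D f : cmeasurable D f -> cmeasurable D (fun x => conjc (f x)).
Proof.
move=> [f1 f2]; split.
  by under eq_fun do rewrite cReJ.
by under eq_fun do rewrite cImJ; exact: measurable_funN.
Qed.

Lemma cmeasurableR D (a : R -> R) : measurable_fun D a ->
  cmeasurable D (fun x => (a x)%:C).
Proof. by move=> ma; split => //=; exact: measurable_cst. Qed.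

Lemma cmeasurable_indic D (A : set R) : measurable A ->
  cmeasurable D (fun x => (\1_A x)%:C).
Proof. by move=> mA; apply: cmeasurableR; exact: measurable_indic. Qed.

Lemma measurable_cos D : measurable_fun D (@cos R).
Proof.
apply: measurable_funTS; apply: continuous_measurable_fun; exact: continuous_cos.
Qed.

Lemma measurable_sin D : measurable_fun D (@sin R).
Proof.
apply: measurable_funTS; apply: continuous_measurable_fun; exact: continuous_sin.
Qed.

Lemma cmeasurable_expi D (a : R -> R) : measurable_fun D a ->
  cmeasurable D (fun x => expi (a x)).
Proof.
move=> ma; split => /=.
  by apply: measurableT_comp => //; exact: measurable_cos.
by apply: measurableT_comp => //; exact: measurable_sin.
Qed.

Lemma measurable_normsq D f : cmeasurable D f -> measurable_fun D (fun x => normsq (f x)).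
Proof.
move=> [f1 f2]; under eq_fun do rewrite normsqE.
by apply: measurable_funD; exact: measurable_funX.
Qed.

Lemma emeasurable_normsq D f : cmeasurable D f ->
  measurable_fun D (fun x => (normsq (f x))%:E).
Proof. by move=> mf; apply/measurable_EFinP; exact: measurable_normsq. Qed.

Lemma cmeasurable_affine f (a b : R) : cmeasurable setT f ->
  cmeasurable setT (fun x => f (a * x + b)).
Proof.
by move=> [f1 f2]; split; [apply: (measurableT_comp f1)|apply: (measurableT_comp f2)];
  exact: measurable_affine.
Qed.

Lemma cmeasurableS D (E : set R) f : measurable E -> D `<=` E ->
  cmeasurable E f -> cmeasurable D f.
Proof. by move=> mE DE [f1 f2]; split; apply: measurable_funS DE _. Qed.

Lemma cmeasurable_mkcond D f : measurable D -> cmeasurable D f <->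
  cmeasurable setT (fun x => (\1_D x)%:C * f x).
Proof.
move=> mD.
have e1 : (fun x => Re ((\1_D x)%:C * f x)) = (fun x => Re (f x)) \_ D.
  by apply/funext => x; rewrite patchE indicE cReM /=; case: (x \in D);
    rewrite ?(mul1r, mul0r) subr0.
have e2 : (fun x => Im ((\1_D x)%:C * f x)) = (fun x => Im (f x)) \_ D.
  by apply/funext => x; rewrite patchE indicE cImM /=; case: (x \in D);
    rewrite ?(mul1r, mul0r) addr0.
rewrite /cmeasurable e1 e2; split=> -[f1 f2]; split.
- exact: (measurable_restrictT _ mD).1.
- exact: (measurable_restrictT _ mD).1.
- exact: (measurable_restrictT _ mD).2.
- exact: (measurable_restrictT _ mD).2.
Qed.

Lemma sqnorm_ge0 D f : (0 <= sqnorm D f)%E.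
Proof. by apply: integral_ge0 => x _; rewrite lee_fin normsq_ge0. Qed.

Lemma sqnorm_mkcond D f : sqnorm D f = sqnorm setT (fun x => (\1_D x)%:C * f x).
Proof.
rewrite /sqnorm integral_mkcond; apply: eq_integral => x _.
rewrite patchE normsqM normsqR indicE.
by case: (x \in D); rewrite ?expr1n ?mul1r// expr0n mul0r.
Qed.

Lemma sqnormJ D f : sqnorm D (fun x => conjc (f x)) = sqnorm D f.
Proof. by apply: eq_integral => x _; rewrite normsqJ. Qed.

Lemma sqnormN D f : sqnorm D (fun x => - f x) = sqnorm D f.
Proof. by apply: eq_integral => x _; rewrite normsqN. Qed.

Lemma sqnormZ D (c : R[i]) f : measurable D -> cmeasurable D f ->
  sqnorm D (fun x => c * f x) = ((normsq c)%:E * sqnorm D f)%E.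
Proof.
move=> mD mf; rewrite /sqnorm -ge0_integralZl_EFin//.
- by apply: eq_integral => x _; rewrite normsqM.
- by move=> x _; rewrite lee_fin normsq_ge0.
- exact: emeasurable_normsq.
- exact: normsq_ge0.
Qed.

Lemma sqnormD_le D (d : R) f g : 0 < d -> measurable D -> cmeasurable D f ->
  cmeasurable D g ->
  (sqnorm D (fun x => f x + g x)%R <=
    (1 + d)%:E * sqnorm D f + (1 + d^-1)%:E * sqnorm D g)%E.
Proof.
move=> d0 mD mf mg; rewrite /sqnorm.
have d1 : 0 <= 1 + d by rewrite addr_ge0// ltW.
have d2 : 0 <= 1 + d^-1 by rewrite addr_ge0// invr_ge0 ltW.
rewrite -!ge0_integralZl_EFin//; try (by move=> x _; rewrite lee_fin normsq_ge0);
  try exact: emeasurable_normsq.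
rewrite -ge0_integralD//; last 4 first.
- by move=> x _; rewrite mule_ge0 ?lee_fin// normsq_ge0.
- by apply: measurable_funeM; exact: emeasurable_normsq.
- by move=> x _; rewrite mule_ge0 ?lee_fin// normsq_ge0.
- by apply: measurable_funeM; exact: emeasurable_normsq.
apply: ge0_le_integral => //.
- by move=> x _; rewrite lee_fin normsq_ge0.
- by apply: emeasurable_normsq; exact: cmeasurableD.
- by apply: emeasurable_funD; apply: measurable_funeM; exact: emeasurable_normsq.
- by move=> x _; rewrite -!EFinM -EFinD lee_fin normsqD_le.
Qed.

Lemma L2_measurable f : L2 f -> cmeasurable setT f. Proof. by case. Qed.

Lemma L2_0 : L2 (fun _ : R => 0 : R[i]).
Proof.
split; first exact: cmeasurable_cst.
by rewrite /sqnorm normsq0 integral0.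
Qed.

Lemma L2_lin (c : R[i]) f g : L2 f -> L2 g -> L2 (fun x => c * f x + g x).
Proof.
move=> [mf f2] [mg g2]; split; first by apply: cmeasurableD => //; exact: cmeasurableZ.
apply: le_lt_trans (sqnormD_le ltr01 measurableT (cmeasurableZ c mf) mg) _.
rewrite sqnormZ// lte_add_pinfty// ?muleA -?EFinM lte_mul_pinfty// ?lee_fin//.
by rewrite mulr_ge0 ?normsq_ge0// addr_ge0.
Qed.

Lemma L2J f : L2 f -> L2 (fun x => conjc (f x)).
Proof. by move=> [mf f2]; split; [exact: cmeasurableJ|rewrite sqnormJ]. Qed.

Lemma L2_le f g : cmeasurable setT f -> L2 g ->
  (forall x, normsq (f x) <= normsq (g x)) -> L2 f.
Proof.
move=> mf [mg g2] fg; split => //; apply: le_lt_trans g2.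
by apply: ge0_le_integral => //; first [exact: emeasurable_normsq|
  move=> x _; rewrite lee_fin ?normsq_ge0].
Qed.

Lemma L2_indic (A : set R) f : measurable A -> L2 f -> L2 (fun x => (\1_A x)%:C * f x).
Proof.
move=> mA Lf; apply: (L2_le _ Lf).
  by apply: cmeasurableM; [exact: cmeasurable_indic|case: Lf].
move=> x; rewrite normsqM normsqR indicE.
by case: (x \in A); rewrite ?expr1n ?mul1r// expr0n mul0r normsq_ge0.
Qed.

Lemma L2_expi (a : R -> R) f : measurable_fun setT a -> L2 f ->
  L2 (fun x => expi (a x) * f x).
Proof.
move=> ma Lf; apply: (L2_le _ Lf).
  by apply: cmeasurableM; [exact: cmeasurable_expi|case: Lf].
by move=> x; rewrite normsqM normsq_expi mul1r.
Qed.

Lemma cintegrable_measurable f : cintegrable f -> cmeasurable setT f.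
Proof.
by move=> [/integrableP[f1 _] /integrableP[f2 _]]; split; exact/measurable_EFinP.
Qed.

Lemma L2_mulJ f g : L2 f -> L2 g -> cintegrable (fun x => f x * conjc (g x)).
Proof.
move=> [mf f2] [mg g2].
have mfg : cmeasurable setT (fun x => f x * conjc (g x)).
  by apply: cmeasurableM => //; exact: cmeasurableJ.
have ifg : mu.-integrable setT (fun x => (normsq (f x))%:E + (normsq (g x))%:E)%E.
  apply: integrableD => //; apply/integrableP; split; try exact: emeasurable_normsq.
    by under eq_integral do rewrite gee0_abs ?lee_fin ?normsq_ge0//.
  by under eq_integral do rewrite gee0_abs ?lee_fin ?normsq_ge0//.
(* The dominating function is |f|^2 + |g|^2; the comparison is made between squares because moduli
   enter only through [normsq]. *)
have lefg x (a : R) : a ^+ 2 <= normsq (f x * conjc (g x)) ->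
    (`|a%:E| <= `|(normsq (f x))%:E + (normsq (g x))%:E|)%E.
  rewrite -EFinD !abse_EFin lee_fin normsqM normsqJ => h.
  rewrite [leRHS]ger0_norm ?addr_ge0 ?normsq_ge0//.
  rewrite -(@ler_pXn2r _ 2)// ?nnegrE ?addr_ge0 ?normsq_ge0// real_normK ?num_real//.
  apply: le_trans h _.
  have := normsq_ge0 (f x); have := normsq_ge0 (g x); nra.
split.
  apply: le_integrable ifg => //; first by apply/measurable_EFinP; case: mfg.
  by move=> x _; apply: lefg; exact: Re_sqr_le.
apply: le_integrable ifg => //; first by apply/measurable_EFinP; case: mfg.
by move=> x _; apply: lefg; exact: Im_sqr_le.
Qed.

Lemma L2_mul f g : L2 f -> L2 g -> cintegrable (fun x => f x * g x).
Proof.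
move=> Lf Lg; have := L2_mulJ Lf (L2J Lg); congr cintegrable.
by apply/funext => x; rewrite conjcK.
Qed.

Lemma cintegrableD f g : cintegrable f -> cintegrable g ->
  cintegrable (fun x => f x + g x).
Proof.
move=> [f1 f2] [g1 g2]; split.
  under eq_fun do rewrite cReD EFinD; exact: integrableD.
under eq_fun do rewrite cImD EFinD; exact: integrableD.
Qed.

Lemma cintegrableZ (c : R[i]) f : cintegrable f -> cintegrable (fun x => c * f x).
Proof.
move=> [f1 f2]; split.
  under eq_fun do rewrite cReM EFinB !EFinM.
  by apply: integrableB => //; exact: integrableZl.
under eq_fun do rewrite cImM EFinD !EFinM.
by apply: integrableD => //; exact: integrableZl.
Qed.

Lemma cintegral_lin (c : R[i]) f g : cintegrable f -> cintegrable g ->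
  cintegral (fun x => c * f x + g x) = c * cintegral f + cintegral g.
Proof.
move=> [f1 f2] [g1 g2].
have iZ (a : R) (u : R -> R) : mu.-integrable setT (EFin \o u) ->
    mu.-integrable setT (EFin \o (fun x => a * u x)).
  move=> iu; have -> : EFin \o (fun x => a * u x) = (fun x => a%:E * (u x)%:E)%E by [].
  exact: integrableZl.
have iD (u v : R -> R) : mu.-integrable setT (EFin \o u) ->
    mu.-integrable setT (EFin \o v) -> mu.-integrable setT (EFin \o (fun x => u x + v x)).
  move=> iu iv; have -> : EFin \o (fun x => u x + v x) = (fun x => (u x)%:E + (v x)%:E)%E by [].
  exact: integrableD.
have iB (u v : R -> R) : mu.-integrable setT (EFin \o u) ->
    mu.-integrable setT (EFin \o v) -> mu.-integrable setT (EFin \o (fun x => u x - v x)).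
  move=> iu iv; have -> : EFin \o (fun x => u x - v x) = (fun x => (u x)%:E - (v x)%:E)%E by [].
  exact: integrableB.
apply: eqcP; rewrite !cE /=.
  under eq_Rintegral do rewrite cReD cReM.
  rewrite RintegralD//; last by apply: (iB _ _ (iZ _ _ f1)); exact: iZ.
  by rewrite RintegralB ?RintegralZl//; exact: iZ.
under eq_Rintegral do rewrite cImD cImM.
rewrite RintegralD//; last by apply: (iD _ _ (iZ _ _ f2)); exact: iZ.
by rewrite RintegralD ?RintegralZl//; exact: iZ.
Qed.

Lemma cintegralZ (c : R[i]) (f : R -> R[i]) : cintegrable f ->
  cintegral (fun x => c * f x) = c * cintegral f.
Proof.
move=> cf; have c0 : cintegrable (fun _ : R => 0 : R[i]) by split; exact: integrable0.
have := cintegral_lin c cf c0.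
have -> : cintegral (fun _ : R => 0 : R[i]) = 0.
  by apply: eqcP => /=; rewrite /Rintegral integral0.
by rewrite addr0 => <-; congr cintegral; apply/funext => x; rewrite addr0.
Qed.

Lemma cintegralJ f : cintegral (fun x => conjc (f x)) = conjc (cintegral f).
Proof.
apply: eqcP; rewrite /= /cintegral/=; first by under eq_Rintegral do rewrite cReJ.
under eq_Rintegral do rewrite cImJ.
rewrite /Rintegral; under eq_integral do rewrite EFinN.
rewrite [in LHS]integralE [in RHS]integralE funeposN funenegN.
(* [fine] maps both infinities to 0, so the signs also agree where an integral is infinite. *)
by case: integral => [r| |]; case: integral => [t| |] //=; rewrite ?oppr0// opprB.
Qed.

End Complex_integrals.

Section Almost_everywhere.
Context (R : realType).
Local Notation mu := (@lebesgue_measure R).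
Implicit Types (P Q S : R -> Prop).

Lemma aeS P Q : (forall x, P x -> Q x) -> {ae mu, forall x, P x} ->
  {ae mu, forall x, Q x}.
Proof.
move=> PQ h; have F : Filter (nbhs (almost_everywhere mu)) by exact: _.
by apply: filterS h => x; exact: PQ.
Qed.

Lemma aeS2 P Q S : (forall x, P x -> Q x -> S x) -> {ae mu, forall x, P x} ->
  {ae mu, forall x, Q x} -> {ae mu, forall x, S x}.
Proof.
move=> PQ h k; have F : Filter (nbhs (almost_everywhere mu)) by exact: _.
by apply: filterS2 h k => x; exact: PQ.
Qed.

Lemma aeT P : (forall x, P x) -> {ae mu, forall x, P x}.
Proof.
move=> PQ; have F : Filter (nbhs (almost_everywhere mu)) by exact: _.
by apply: nearW.
Qed.

(** The exceptional sets are indexed by their codes in nat, the empty set standing at the numbers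
    that code nothing. *)
Lemma ae_forall_count (I : countType) (P : I -> R -> Prop) :
  (forall i, {ae mu, forall x, P i x}) -> {ae mu, forall x, forall i, P i x}.
Proof.
move=> h; have := negligible_bigcup (fun k => _ : mu.-negligible
  (if @pickle_inv I k is Some i then ~` [set x | P i x] else set0)).
move=> /(_ (fun k => ltac:(case: pickle_inv => [i|]; [exact: h|exact: negligible_set0]))).
apply: negligibleS => x /= /existsNP[i nP]; exists (pickle i) => //=.
by rewrite pickleK_inv.
Qed.

End Almost_everywhere.

(** * Inner product and completeness of L^2 *)

Section L2_space.
Context (R : realType).
Local Notation mu := (@lebesgue_measure R).
Implicit Types (D : set R) (f g h : R -> R[i]) (u v : nat -> R -> R[i]).

Definition cdot f g : R[i] := cintegral (fun x => f x * conjc (g x)).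

Lemma cdot_sqnorm f : L2 f -> (Re (cdot f f))%:E = sqnorm setT f.
Proof.
move=> [mf f2]; rewrite /cdot /cintegral/= /sqnorm.
have e : (fun x => Re (f x * conjc (f x))) = fun x => normsq (f x).
  by apply/funext => x; rewrite mulJ.
rewrite e fineK// ge0_fin_numE//.
by apply: integral_ge0 => x _; rewrite lee_fin normsq_ge0.
Qed.

Lemma inner_product_L2 : inner_product (@L2 R) cdot.
Proof.
split; [exact: L2_0|exact: L2_lin| | |].
- move=> c f g h Lf Lg Lh; rewrite /cdot -cintegral_lin; try exact: L2_mulJ.
  by congr cintegral; apply/funext => x; rewrite mulrDl mulrA.
- move=> f g Lf Lg; rewrite /cdot -cintegralJ; congr cintegral; apply/funext => x.
  by rewrite rmorphM/= conjcK mulrC.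
- by move=> f Lf; rewrite -lee_fin cdot_sqnorm// sqnorm_ge0.
Qed.

Lemma L2B f g : L2 f -> L2 g -> L2 (fun x => f x - g x).
Proof. exact: (ip_sub inner_product_L2). Qed.

Lemma L2Z (c : R[i]) f : L2 f -> L2 (fun x => c * f x).
Proof. exact: (ip_scale inner_product_L2). Qed.

Lemma L2_sum I (s : seq I) (c : I -> R[i]) (e : I -> R -> R[i]) :
  (forall i, L2 (e i)) -> L2 (fun x => \sum_(i <- s) c i * e i x).
Proof. exact: (ip_sum inner_product_L2). Qed.

Lemma sqnorm_fin_num f : L2 f -> sqnorm setT f \is a fin_num.
Proof. by move=> Lf; rewrite -cdot_sqnorm. Qed.

Lemma sqnorm_eq0 D f : measurable D -> cmeasurable D f -> sqnorm D f = 0%E ->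
  {ae mu, forall x, D x -> f x = 0}.
Proof.
move=> mD mf h.
have : (\int[mu]_(x in D) `|(normsq (f x))%:E| = 0)%E.
  by under eq_integral do rewrite gee0_abs ?lee_fin ?normsq_ge0//.
case: (ae_eq_integral_abs mu mD (emeasurable_normsq mf)) => + _ h0 => /(_ h0).
by apply: aeS => x /= h1 Dx; apply: normsq_eq0; have := h1 Dx => -[].
Qed.

Lemma eq_sqnorm_ae D f g : measurable D -> cmeasurable D f -> cmeasurable D g ->
  {ae mu, forall x, D x -> f x = g x} -> sqnorm D f = sqnorm D g.
Proof.
move=> mD mf mg fg; apply: ae_eq_integral => //; try exact: emeasurable_normsq.
by apply: aeS fg => x h Dx; rewrite h.
Qed.

Lemma eq_cintegral_ae f g : cmeasurable setT f -> cmeasurable setT g ->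
  {ae mu, forall x, f x = g x} -> cintegral f = cintegral g.
Proof.
move=> [f1 f2] [g1 g2] fg; apply: eqcP => /=; congr fine.
  apply: ae_eq_integral => //; try exact/measurable_EFinP.
  by apply: aeS fg => x ->.
apply: ae_eq_integral => //; try exact/measurable_EFinP.
by apply: aeS fg => x ->.
Qed.

Lemma cdot_ae f g f' g' : cmeasurable setT f -> cmeasurable setT g ->
  cmeasurable setT f' -> cmeasurable setT g' ->
  {ae mu, forall x, f x = f' x} -> {ae mu, forall x, g x = g' x} ->
  cdot f g = cdot f' g'.
Proof.
move=> mf mg mf' mg' ff' gg'; apply: eq_cintegral_ae.
- by apply: cmeasurableM => //; exact: cmeasurableJ.
- by apply: cmeasurableM => //; exact: cmeasurableJ.
- by apply: aeS2 ff' gg' => x -> ->.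
Qed.

Lemma cintegral_affine (a b : R) f : 0 < a -> cmeasurable setT f ->
  cintegral (fun x => f (a * x + b)) = (a^-1)%:C * cintegral f.
Proof.
move=> a0 [f1 f2]; apply: eqcP; rewrite !cE /= mul0r ?subr0 ?addr0 /Rintegral.
  rewrite (@integral_affine R a b (fun x => (Re (f x))%:E))//; last exact/measurable_EFinP.
  by case: integral => [r| |] //=; rewrite ?mulr0// ?gt0_muley ?gt0_muleNy// lte_fin invr_gt0.
rewrite (@integral_affine R a b (fun x => (Im (f x))%:E))//; last exact/measurable_EFinP.
by case: integral => [r| |] //=; rewrite ?mulr0// ?gt0_muley ?gt0_muleNy// lte_fin invr_gt0.
Qed.

Lemma sqnorm_affine (a b : R) f : 0 < a -> cmeasurable setT f ->
  sqnorm setT (fun x => f (a * x + b)) = ((a^-1)%:E * sqnorm setT f)%E.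
Proof.
move=> a0 mf.
apply: (@ge0_integral_affine R a b (fun x => (normsq (f x))%:E)) => //.
  exact: emeasurable_normsq.
by move=> x; rewrite lee_fin normsq_ge0.
Qed.

Lemma L2_affine (a b : R) f : 0 < a -> L2 f -> L2 (fun x => f (a * x + b)).
Proof.
move=> a0 [mf f2]; split; first exact: cmeasurable_affine.
by rewrite sqnorm_affine// lte_mul_pinfty// lee_fin invr_ge0 ltW.
Qed.

Lemma negligible_affine (a b : R) (A : set R) : 0 < a -> mu.-negligible A ->
  mu.-negligible ((fun x => a * x + b) @^-1` A).
Proof.
move=> a0 [B [mB B0 AB]]; exists ((fun x => a * x + b) @^-1` B); split.
- by rewrite -[_ @^-1` _]setTI; exact: measurable_affine.
- have := lebesgue_measure_affine b a0 mB; rewrite B0 => /esym/eqP.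
  by rewrite mule_eq0 eqe gt_eqF//= => /eqP.
- by move=> x /AB.
Qed.

Lemma ae_affine (a b : R) (P : R -> Prop) : 0 < a -> {ae mu, forall x, P x} ->
  {ae mu, forall x, P (a * x + b)}.
Proof. by move=> a0 /(negligible_affine b a0). Qed.

Lemma sqnorm_cvg_fine u : (forall k, L2 (u k)) ->
  sqnorm setT (u k) @[k --> \oo] --> 0%E ->
  Re (cdot (u k) (u k)) @[k --> \oo] --> 0.
Proof.
move=> Lu h; apply: (@cvg_trans _ (fine (sqnorm setT (u k)) @[k --> \oo])).
  by apply: near_eq_cvg; near=> k; rewrite -cdot_sqnorm.
exact: fine_cvg.
Unshelve. all: by end_near. Qed.

(** The difference is <u - f, v - g> + <u - f, g> + <f, v - g>, and Cauchy-Schwarz bounds each term.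
    Convergence is stated through [normsq] of the difference. *)
Lemma cdot_cvg u v f g : (forall k, L2 (u k)) -> (forall k, L2 (v k)) ->
  L2 f -> L2 g ->
  sqnorm setT (fun x => u k x - f x) @[k --> \oo] --> 0%E ->
  sqnorm setT (fun x => v k x - g x) @[k --> \oo] --> 0%E ->
  normsq (cdot (u k) (v k) - cdot f g) @[k --> \oo] --> 0.
Proof.
move=> Lu Lv Lf Lg uf vg.
have Luf k : L2 (fun x => u k x - f x) by exact: L2B.
have Lvg k : L2 (fun x => v k x - g x) by exact: L2B.
have := sqnorm_cvg_fine Lvg vg; have := sqnorm_cvg_fine Luf uf.
set a := fun k => Re (cdot _ _); set b := fun k => Re (cdot (fun x => v k x - g x) _).
move=> a0 b0.
set F := Re (cdot f f); set G := Re (cdot g g).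
have up : (2 * (a k * b k) + 4 * (a k * G) + 4 * (F * b k)) @[k --> \oo] --> 0.
  have -> : 0 = 2 * (0 * 0) + 4 * (0 * G) + 4 * (F * 0) :> R by ring.
  by apply: cvgD; [apply: cvgD|]; apply: cvgMr; [exact: cvgM|exact: cvgMl|exact: cvgMr].
apply: (@squeeze_cvgr _ _ _ _ (fun=> 0) _ _ _ _ _ up); last exact: cvg_cst.
near=> k; rewrite normsq_ge0/=.
have -> : cdot (u k) (v k) - cdot f g = cdot (fun x => u k x - f x) (fun x => v k x - g x) +
    (cdot (fun x => u k x - f x) g + cdot f (fun x => v k x - g x)).
  rewrite (ip_dotBr inner_product_L2)// !(ip_dotBl inner_product_L2)//.
  rewrite (ip_dotBr inner_product_L2)//; ring.
apply: le_trans (normsqD_le2 _ _) _.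
have h1 := ip_CS inner_product_L2 (Luf k) (Lvg k).
have h2 := normsqD_le2 (cdot (fun x => u k x - f x) g) (cdot f (fun x => v k x - g x)).
have h3 := ip_CS inner_product_L2 (Luf k) Lg.
have h4 := ip_CS inner_product_L2 Lf (Lvg k).
rewrite -/(a k) -/(b k) -/F -/G in h1 h3 h4; lra.
Unshelve. all: by end_near. Qed.

Lemma normsq_cvg_unique (z : nat -> R[i]) (s t : R[i]) :
  normsq (z k - s) @[k --> \oo] --> 0 -> normsq (z k - t) @[k --> \oo] --> 0 -> s = t.
Proof.
move=> hs ht; apply/eqP; rewrite -subr_eq0; apply/eqP/normsq_eq0.
apply/eqP; rewrite eq_le normsq_ge0 andbT.
have h : (2 * normsq (z k - s) + 2 * normsq (z k - t)) @[k --> \oo] --> 0.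
  have -> : 0 = 2 * 0 + 2 * 0 :> R by ring.
  by apply: cvgD; exact: cvgMr.
rewrite -(cvg_lim _ h)//; apply: limr_ge; first by apply/cvg_ex; exists 0.
near=> k; have -> : s - t = (z k - t) - (z k - s) by ring.
by apply: le_trans (normsqD_le2 _ _) _; rewrite normsqN addrC.
Unshelve. all: by end_near. Qed.

(** Riesz-Fischer: a subsequence with rapidly decreasing steps converges almost everywhere, and
    Fatou's lemma along it, with the other index fixed, turns the Cauchy condition into convergence
    of the whole sequence. *)
Lemma L2_complete u : (forall k, L2 (u k)) ->
  (forall e : R, 0 < e -> exists K, forall k l, (K <= k)%N -> (K <= l)%N ->
     (sqnorm setT (fun x => u k x - u l x)%R <= e%:E)%E) ->
  exists2 g, L2 g & sqnorm setT (fun x => u k x - g x) @[k --> \oo] --> 0%E.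
Proof.
move=> Lu cau.
have pos j : 0 < (4^-1 : R) ^+ j by rewrite exprn_gt0// invr_gt0.
have [phi phiP] := choice (fun j => cau _ (pos j)).
(* Summing successors makes [psi] increase while staying above both [phi j] and j. *)
pose psi j := (\sum_(i < j.+1) (phi i).+1)%N.
have psi_phi j : (phi j <= psi j)%N.
  by rewrite /psi big_ord_recr/= (leq_trans (leqnSn _))// leq_addl.
have psi_S j : (psi j <= psi j.+1)%N by rewrite /psi [X in (_ <= X)%N]big_ord_recr leq_addr.
have psi_ge j : (j <= psi j)%N.
  elim: j => // j IH; rewrite /psi big_ord_recr/= -/(psi j).
  by rewrite -addn1 leq_add.
pose Dl j x := u (psi j.+1) x - u (psi j) x.
have LD j : L2 (Dl j) by exact: L2B.
have nD j : (sqnorm setT (Dl j) <= ((4^-1) ^+ j)%:E)%E.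
  by apply: phiP => //; apply: leq_trans (psi_S j).
(* The weight 2^j is a compromise with the bound 4^-j: the integral of G stays below the sum of the
   2^-j, and finiteness of G x forces |Dl j x| <= sqrt (G x) 2^(- j / 2), which is summable. *)
pose G x := (\sum_(j <oo) (2 ^+ j * normsq (Dl j x))%:E)%E.
have p2 j : 0 <= (2 : R) ^+ j by rewrite exprn_ge0.
have G0 j x : (0 <= (2 ^+ j * normsq (Dl j x))%:E)%E by rewrite lee_fin mulr_ge0 ?normsq_ge0.
have mGj j : measurable_fun setT (fun x => (2 ^+ j * normsq (Dl j x))%:E).
  by apply/measurable_EFinP/measurable_funM => //; apply: measurable_normsq; case: (LD j).
have mG : measurable_fun setT G by apply: ge0_emeasurable_sum => *.
have iG : (\int[mu]_x G x < +oo)%E.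
  rewrite integral_nneseries//.
  apply: (@le_lt_trans _ _ (\sum_(j <oo) ((2^-1) ^+ j)%:E)%E).
    apply: lee_nneseries => [j _ _|j _]; first by apply: integral_ge0 => x _.
    under eq_integral do rewrite EFinM.
    rewrite ge0_integralZl_EFin//; last 2 first.
    - by move=> x _; rewrite lee_fin normsq_ge0.
    - by apply: emeasurable_normsq; case: (LD j).
    apply: le_trans (lee_wpmul2l _ (nD j)) _; first by rewrite lee_fin.
    by rewrite -EFinM lee_fin -exprMn (_ : 2 * 4^-1 = 2^-1)//; lra.
  have -> : (\sum_(j <oo) ((2^-1) ^+ j)%:E)%E = (2%:E : \bar R).
    have h : series (geometric 1 (2^-1 : R)) k @[k --> \oo] --> (2 : R).
      have := @cvg_geometric_series R 1 (2^-1).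
      rewrite ger0_norm ?invr_ge0// => /(_ ltac:(lra)).
      by rewrite (_ : 1 / (1 - 2^-1) = 2)//; field.
    apply/cvg_lim => //; apply: cvg_EFin; first by near=> k; rewrite sumEFin.
    apply: cvg_trans h; apply: near_eq_cvg; near=> k; rewrite /= sumEFin/=.
    by rewrite /series/=; apply: eq_bigr => i _; rewrite mul1r.
  by rewrite ltry.
pose A := [set x | (G x < +oo)%E].
have mA : measurable A by rewrite -[A]setTI; apply: emeasurable_fun_infty_o.
have aeA : {ae mu, forall x, A x}.
  have : mu.-integrable setT G.
    apply/integrableP; split => //; under eq_integral do rewrite gee0_abs ?nneseries_ge0//.
    exact: iG.
  move/(integrable_ae measurableT); apply: aeS => x /(_ I).
  by rewrite ge0_fin_numE// nneseries_ge0.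
(* Set to 0 off A, so that the limit exists at every point and is measurable as a pointwise
   limit. *)
pose w j x := (\1_A x)%:C * u (psi j) x.
have key x (c : R[i] -> R) : (forall z z', c (z - z') = c z - c z') ->
    (forall z, c z ^+ 2 <= normsq z) -> (forall z (a : R), c (a%:C * z) = a * c z) ->
    cvgn (fun j => c (w j x)).
  move=> cB cle cZ; rewrite /w; under eq_fun do rewrite cZ.
  rewrite indicE; have [xA|xA] := boolP (x \in A); last first.
    by under eq_fun do rewrite mul0r; exact: is_cvg_cst.
  under eq_fun do rewrite mul1r.
  have {}xA : (G x < +oo)%E by rewrite inE in xA.
  have Gx : G x \is a fin_num by rewrite ge0_fin_numE// nneseries_ge0.
  have leG j : `|c (Dl j x)| <= Num.sqrt (fine (G x)) * (Num.sqrt 2^-1) ^+ j.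
    have -> : Num.sqrt 2^-1 ^+ j = Num.sqrt ((2^-1) ^+ j) :> R.
      elim: j => [|j IH]; first by rewrite !expr0 sqrtr1.
      by rewrite !exprS sqrtrM ?invr_ge0// IH.
    rewrite -sqrtrM; last by rewrite fine_ge0// nneseries_ge0.
    rewrite -sqrtr_sqr ler_wsqrtr//; apply: le_trans (cle _) _.
    rewrite exprVn -ler_pdivrMr ?invr_gt0 ?exprn_gt0// invrK mulrC.
    rewrite -lee_fin fineK//.
    have h (k : nat) : true -> (0 <= (2 ^+ k * normsq (Dl k x))%:E)%E by move=> _; exact: G0.
    apply: le_trans (nneseries_lim_ge j.+1 (fun k _ => h k)).
    by rewrite big_nat_recr//= leeDr// sume_ge0.
  have : cvgn (series (fun j => c (Dl j x))).
    apply: normed_cvg; apply: (series_le_cvg _ _ leG) => [k|k|].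
    - exact: normr_ge0.
    - by rewrite mulr_ge0// ?exprn_ge0// sqrtr_ge0.
    - apply: is_cvg_geometric_series; rewrite ger0_norm ?sqrtr_ge0//.
      by rewrite -[ltRHS]sqrtr1 ltr_sqrt//; lra.
  move=> /cvg_ex[/= l hl]; apply/cvg_ex; exists (l + c (u (psi 0%N) x)).
  apply: cvg_trans (cvgD hl (cvg_cst (c (u (psi 0%N) x)))).
  apply: near_eq_cvg; near=> k; rewrite /= /series/=.
  rewrite /GRing.add/= /GRing.add/=.
  have -> : \sum_(0 <= i < k) c (Dl i x) = c (u (psi k) x) - c (u (psi 0%N) x).
    by under eq_bigr do rewrite /Dl cB; rewrite telescope_sumr.
  exact: subrK.
have cRe x : cvgn (fun j => Re (w j x)).
  by apply: key => [z z'|z|z a]; rewrite ?cE ?Re_sqr_le//= mul0r subr0.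
have cIm x : cvgn (fun j => Im (w j x)).
  by apply: key => [z z'|z|z a]; rewrite ?cE ?Im_sqr_le//= mul0r addr0.
have mw j : cmeasurable setT (w j).
  by apply: cmeasurableM; [exact: cmeasurable_indic|case: (Lu (psi j))].
pose g x := limn (fun j => Re (w j x)) +i* limn (fun j => Im (w j x)).
have mg : cmeasurable setT g.
  split => /=.
    by apply: (@measurable_fun_cvg _ _ _ _ (fun j x => Re (w j x))) => [j|x _]; [case: (mw j)|exact: cRe].
  by apply: (@measurable_fun_cvg _ _ _ _ (fun j x => Im (w j x))) => [j|x _]; [case: (mw j)|exact: cIm].
have bound (e : R) : 0 < e -> exists K, forall k, (K <= k)%N ->
    (sqnorm setT (fun x => u k x - g x)%R <= e%:E)%E.
  move=> e0; have [K hK] := cau _ e0; exists K => k Kk.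
  have muk : cmeasurable setT (u k) by case: (Lu k).
  pose F j x := (normsq (u k x - w j x))%:E.
  have mF j : measurable_fun setT (F j).
    by apply: emeasurable_normsq; exact: cmeasurableB.
  have Fl x : limn_einf (F^~ x) = (normsq (u k x - g x))%:E.
    have Fc : F j x @[j --> \oo] --> (normsq (u k x - g x))%:E.
      apply: cvg_EFin; first by near=> j.
      have E (z z' : R[i]) : normsq (z - z') =
          (Re z - Re z') * (Re z - Re z') + (Im z - Im z') * (Im z - Im z').
        by rewrite normsqE !cE !expr2.
      rewrite /F /= E; under eq_fun do rewrite E.
      have c1 : Re (u k x) - Re (w j x) @[j --> \oo] --> Re (u k x) - Re (g x).
        by apply: cvgB; [exact: cvg_cst|exact: cRe].
      have c2 : Im (u k x) - Im (w j x) @[j --> \oo] --> Im (u k x) - Im (g x).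
        by apply: cvgB; [exact: cvg_cst|exact: cIm].
      by apply: cvgD; apply: cvgM.
    by rewrite (is_cvg_limn_einfE _)//; [exact: cvg_lim|apply/cvg_ex; eexists; exact: Fc].
  have := fatou mu measurableT mF.
  move=> /(_ (fun j x _ => normsq_ge0 _)).
  under eq_integral do rewrite Fl.
  move/le_trans; apply.
  rewrite limn_einf_lim; apply: lime_le; first exact: is_cvg_einfs.
  near=> j; apply: (@le_trans _ _ (\int[mu]_x F j x)%E).
    by apply: ereal_inf_lbound; exists j => /=.
  rewrite (_ : (\int[mu]_x F j x)%E = sqnorm setT (fun x => u k x - u (psi j) x)).
    by apply: hK => //; apply: leq_trans (psi_ge j); near: j; exact: nbhs_infty_ge.
  apply: eq_sqnorm_ae => //.
  - exact: cmeasurableB.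
  - by apply: cmeasurableB => //; case: (Lu (psi j)).
  - by apply: aeS aeA => x Ax _; rewrite /w indicE mem_set// mul1r.
have Lg : L2 g.
  have [K hK] := bound _ ltr01.
  have Lug : L2 (fun x => u K x - g x).
    split; first by apply: cmeasurableB => //; case: (Lu K).
    by apply: le_lt_trans (hK _ (leqnn K)) _; rewrite ltry.
  have := L2B (Lu K) Lug; congr L2; apply/funext => x; ring.
exists g => //.
apply/fine_cvgP; split.
  by near=> k; apply: sqnorm_fin_num; exact: L2B.
apply/cvgrPdist_le => e e0; have [K hK] := bound _ e0.
near=> k; rewrite sub0r normrN ger0_norm; last by rewrite fine_ge0// sqnorm_ge0.
rewrite -lee_fin fineK; last by apply: sqnorm_fin_num; exact: L2B.
by apply: hK; near: k; exact: nbhs_infty_ge.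
Unshelve. all: by end_near. Qed.

End L2_space.

(** * Plancherel's theorem *)

Section Poisson_kernel.
Context (R : realType).
Local Notation mu := (@lebesgue_measure R).

Lemma cvgy_expRN (e : R) : 0 < e -> expR (- (e * x)) @[x --> +oo] --> 0.
Proof.
move=> e0; have h : e * x @[x --> +oo] --> +oo by exact: gt0_cvgMry.
exact: (cvg_comp _ _ h (@cvgr_expR R)).
Qed.

Lemma addr1cos_ge0 (t : R) : 0 <= 1 + cos t.
Proof. by have := cos_geN1 t; lra. Qed.

Lemma continuous_cosZ (s : R) : continuous (fun x : R => cos (s * x)).
Proof.
move=> x; apply: continuous_comp; last exact: continuous_cos.
by apply: continuousM; [exact: cst_continuous|exact: id].
Qed.

Lemma continuous_sinZ (s : R) : continuous (fun x : R => sin (s * x)).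
Proof.
move=> x; apply: continuous_comp; last exact: continuous_sin.
by apply: continuousM; [exact: cst_continuous|exact: id].
Qed.

(** An antiderivative of exp (- e x) (1 + cos (s x)). The summand 1 makes the integrand nonnegative,
    as the fundamental theorem on a half-line is used for nonnegative functions; [integral_poisson]
    subtracts it again. *)
Let prim (e s x : R) : R :=
  - (e^-1 * expR (- (e * x))) +
  expR (- (e * x)) * (s * sin (s * x) - e * cos (s * x)) * (e ^+ 2 + s ^+ 2)^-1.

Let is_derive_prim (e s x : R) : 0 < e ->
  is_derive x 1 (prim e s) (expR (- (e * x)) * (1 + cos (s * x))).
Proof.
move=> e0; rewrite /prim; apply: is_derive_eq.
have h : e ^+ 2 + s ^+ 2 != 0 by rewrite gt_eqF// ltr_pwDl ?exprn_gt0// sqr_ge0.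
rewrite /GRing.scale/=; field; rewrite h gt_eqF//.
Qed.

Lemma integral0y_poisson (e s : R) : 0 < e ->
  (\int[mu]_(x in `[0%R, +oo[) (expR (- (e * x)) * (1 + cos (s * x)))%:E =
   (e^-1 + e / (e ^+ 2 + s ^+ 2))%:E)%E.
Proof.
move=> e0.
have dF x := is_derive_prim s x e0.
have cf : continuous (fun x : R => expR (- (e * x)) * (1 + cos (s * x))).
  move=> x; apply: cvgM.
    apply: continuous_comp; last exact: continuous_expR.
    by apply: continuousN; apply: continuousM; [exact: cst_continuous|exact: id].
  by apply: cvgD; [exact: cvg_cst|exact: continuous_cosZ].
rewrite (@ge0_continuous_FTC2y R _ (prim e s) 0 0).
- rewrite sub0e -EFinN /prim !mulr0 oppr0 expR0 sin0 cos0; congr EFin; ring.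
- by move=> x _; rewrite mulr_ge0 ?expR_ge0// addr1cos_ge0.
- exact: continuous_subspaceT.
(* |prim x| <= M exp (- e x), since |s sin - e cos| <= |s| + e. *)
- set M := e^-1 + (`|s| + e) / (e ^+ 2 + s ^+ 2).
  have h0 : 0 < e ^+ 2 + s ^+ 2 by rewrite ltr_pwDl ?exprn_gt0// sqr_ge0.
  apply/cvgr0Pnorm_le => t t0.
  have M0 : 0 < M by rewrite ltr_pwDl ?invr_gt0// divr_ge0 1?ltW// ltr_wpDl.
  have := cvgy_expRN e0 => /cvgr0Pnorm_le/(_ (t / M)).
  rewrite divr_gt0// => /(_ isT); apply: filterS => x.
  rewrite ger0_norm ?expR_ge0// ler_pdivlMr// => h; apply: le_trans h.
  rewrite /prim; apply: le_trans (ler_normD _ _) _.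
  rewrite normrN !normrM (ger0_norm (expR_ge0 _)) mulrDr lerD//.
    by rewrite gtr0_norm ?invr_gt0// mulrC.
  rewrite -mulrA ler_wpM2l ?expR_ge0//.
  rewrite [`|_^-1|]gtr0_norm ?invr_gt0// ler_wpM2r ?invr_ge0 ?(ltW h0)//.
  apply: le_trans (ler_normB _ _) _; rewrite !normrM lerD//.
    by rewrite ler_piMr// ler_norml sin_geN1 sin_le1.
  by rewrite (gtr0_norm e0) ler_piMr ?(ltW e0)// ler_norml cos_geN1 cos_le1.
- by move=> x _; exact: (@ex_derive _ _ _ _ _ _ _ (dF x)).
- apply: cvg_at_right_filter; apply: differentiable_continuous.
  by apply/derivable1_diffP; exact: (@ex_derive _ _ _ _ _ _ _ (dF 0)).
- by move=> x _; rewrite derive1E; exact: (@derive_val _ _ _ _ _ _ _ (dF x)).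
Qed.

Lemma integral_poisson1 (e s : R) : 0 < e ->
  (\int[mu]_x (expR (- (e * `|x|)) * (1 + cos (s * x)))%:E =
   (2 / e + 2 * e / (e ^+ 2 + s ^+ 2))%:E)%E.
Proof.
move=> e0.
have cf : continuous (fun x : R => expR (- (e * `|x|)) * (1 + cos (s * x))).
  move=> x; apply: cvgM.
    apply: continuous_comp; last exact: continuous_expR.
    apply: continuousN; apply: continuousM; first exact: cst_continuous.
    exact: norm_continuous.
  by apply: cvgD; [exact: cvg_cst|exact: continuous_cosZ].
rewrite ge0_symfun_integralT.
- rewrite -set_itvcy (_ : 2 / e + 2 * e / (e ^+ 2 + s ^+ 2) =
      2 * (e^-1 + e / (e ^+ 2 + s ^+ 2))); last by rewrite mulrDr !mulrA.
  rewrite EFinM -(integral0y_poisson s e0); congr (_ * _)%E.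
  by apply: eq_integral => x; rewrite inE/= in_itv/= andbT => x0; rewrite ger0_norm.
- by move=> x; rewrite mulr_ge0 ?expR_ge0// addr1cos_ge0.
- exact: cf.
- by move=> x /=; rewrite normrN mulrN cosN.
Qed.

Lemma measurable_expRN_norm (e : R) (D : set R) :
  measurable_fun D (fun x : R => expR (- (e * `|x|))).
Proof.
apply: measurable_funTS; apply: measurableT_comp; first exact: measurable_expR.
by apply: measurable_funN; apply: measurable_funM.
Qed.

(** The case s = 0 of [integral_poisson1], where 1 + cos is the constant 2. *)
Lemma integral_expRN_norm (e : R) : 0 < e ->
  (\int[mu]_x (expR (- (e * `|x|)))%:E = (2 / e)%:E)%E.
Proof.
move=> e0; have := integral_poisson1 0 e0.
have -> : (fun x => (expR (- (e * `|x|)) * (1 + cos (0 * x)))%:E) =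
    (fun x => 2%:E * (expR (- (e * `|x|)))%:E)%E.
  by apply/funext => x; rewrite mul0r cos0 -EFinM mulrC.
rewrite ge0_integralZl_EFin//; last first.
  by apply/measurable_EFinP; exact: measurable_expRN_norm.
have -> : 2 / e + 2 * e / (e ^+ 2 + 0 ^+ 2) = 2 * (2 / e).
  by field; rewrite gt_eqF.
case: integral => [r| |] //; last by rewrite gt0_muleNy ?lte_fin.
  by rewrite -EFinM => -[] /mulfI-> //.
by rewrite gt0_muley ?lte_fin.
Qed.

Lemma integrable_expRN_norm (e : R) : 0 < e ->
  mu.-integrable setT (fun x => (expR (- (e * `|x|)))%:E).
Proof.
move=> e0; apply/integrableP; split.
  by apply/measurable_EFinP; exact: measurable_expRN_norm.
under eq_integral do rewrite gee0_abs ?lee_fin ?expR_ge0//.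
by rewrite integral_expRN_norm// ltry.
Qed.

Lemma integral_poisson (e s : R) : 0 < e ->
  (\int[mu]_x (expR (- (e * `|x|)) * cos (s * x))%:E =
   (2 * e / (e ^+ 2 + s ^+ 2))%:E)%E.
Proof.
move=> e0.
have i1 := integrable_expRN_norm e0.
have i2 : mu.-integrable setT (fun x => (expR (- (e * `|x|)) * (1 + cos (s * x)))%:E).
  apply/integrableP; split.
    apply/measurable_EFinP; apply: measurable_funM; first exact: measurable_expRN_norm.
    apply: measurable_funD => //; apply: continuous_measurable_fun.
    exact: continuous_cosZ.
  under eq_integral do rewrite gee0_abs ?lee_fin ?mulr_ge0 ?expR_ge0 ?addr1cos_ge0//.
  by rewrite integral_poisson1// ltry.
transitivity (\int[mu]_x ((expR (- (e * `|x|)) * (1 + cos (s * x)))%:E -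
    (expR (- (e * `|x|)))%:E))%E.
  by apply: eq_integral => x _; rewrite -EFinB; congr EFin; ring.
rewrite integralB// integral_poisson1// integral_expRN_norm// -EFinB.
by congr EFin; ring.
Qed.

Lemma integral_cauchy : (\int[mu]_x ((1 + x ^+ 2)^-1)%:E = pi%:E)%E.
Proof.
rewrite ge0_symfun_integralT.
- by rewrite -set_itvcy (integral0y_oneDsqr R) -EFinM; congr EFin; field.
- by move=> x; rewrite invr_ge0 addr_ge0// sqr_ge0.
- exact: continuous_oneDsqrV.
- by move=> x /=; rewrite sqrrN.
Qed.

End Poisson_kernel.

Lemma cvg_EFin_seq (R : realType) (a : nat -> R) (l : R) :
  a k @[k --> \oo] --> l -> (a k)%:E @[k --> \oo] --> l%:E.
Proof. by move=> al; apply: cvg_EFin => //; near=> k. Unshelve. all: by end_near. Qed.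

Lemma cvg_tail (V : topologicalType) (u : nat -> V) (l : V) (K : nat) :
  u (k + K)%N @[k --> \oo] --> l -> u k @[k --> \oo] --> l.
Proof.
move=> h A Al; have [M _ hM] := h A Al; exists (M + K)%N => // k /= Mk.
rewrite -(subnK (leq_trans (leq_addl M K) Mk)); apply: hM => /=.
by rewrite leq_subRL ?(leq_trans (leq_addl M K) Mk)// addnC.
Qed.

(** * Continuity of translations in L^2 *)

Section Clipping.
Context (R : realType).
Implicit Types (c v y : R).

(** For c >= 0, the point of [- c, c] nearest to y, written with absolute values so that continuity
    is evident. *)
Definition clip c y := (`|y + c| - `|y - c|) / 2.

Lemma clip_norm c y : 0 <= c -> `|clip c y| <= c.
Proof.
move=> c0; rewrite ler_norml /clip.
by case: (ler0P (y + c)) => ?; case: (ler0P (y - c)) => ?; apply/andP; lra.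
Qed.

Lemma clip_dist c v y : `|v| <= c -> `|v - clip c y| <= `|v - y|.
Proof.
rewrite ler_norml => /andP[h1 h2]; rewrite /clip ler_norml.
by case: (ler0P (v - y)) => ?; case: (ler0P (y + c)) => ?;
  case: (ler0P (y - c)) => ?; apply/andP; lra.
Qed.

Lemma continuous_clip c (g : R -> R) : continuous g -> continuous (fun x => clip c (g x)).
Proof.
move=> cg x; apply: cvgMl; apply: cvgB; apply: cvg_norm.
  by apply: cvgD; [exact: cg|exact: cvg_cst].
by apply: cvgB; [exact: cg|exact: cvg_cst].
Qed.

End Clipping.

Section Translation_continuity.
Context (R : realType).
Local Notation mu := (@lebesgue_measure R).
Implicit Types (u v : R -> R).

Local Notation toC u := (fun x => (u x)%:C : R[i]).

Let window (u : R -> R) (A x : R) : R := \1_`[- A, A] x * u x.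

Lemma sqnorm_toC u : sqnorm setT (toC u) = (\int[mu]_x (u x ^+ 2)%:E)%E.
Proof. by rewrite /sqnorm; under eq_integral do rewrite normsqR. Qed.

(** Dominated convergence with majorant u^2: at a given x, cutting the domain and the values at n
    changes nothing once n is large. *)
Let truncate u : L2 (toC u) -> forall e : R, 0 < e -> exists n : nat,
  (sqnorm setT (toC (fun x => u x - \1_`[- n%:R, n%:R] x *
     (if `|u x| <= n%:R then u x else 0)))%R < e%:E)%E.
Proof.
move=> Lu e e0; have mu_ : measurable_fun setT u by case: (L2_measurable Lu).
pose w (n : nat) x := u x - \1_`[- n%:R, n%:R] x * (if `|u x| <= n%:R then u x else 0).
have mw n : measurable_fun setT (w n).
  apply: measurable_funB => //; apply: measurable_funM.
    exact: measurable_indic.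
  apply: measurable_fun_if => //.
    by apply: measurable_fun_ler => //; apply: measurableT_comp => //.
  exact: measurable_funS mu_.
have w0 x : w n x ^+ 2 @[n --> \oo] --> 0.
  apply: cvg_near_cst; near=> n; rewrite /w.
  have h1 : `|u x| <= n%:R by near: n; exact: nbhs_infty_ger.
  have h2 : `|x| <= n%:R by near: n; exact: nbhs_infty_ger.
  rewrite h1 indicE mem_set ?mul1r ?subrr ?expr0n//=.
  by rewrite in_itv/= -ler_norml.
have wu n x : w n x ^+ 2 <= u x ^+ 2.
  rewrite /w indicE; case: (_ \in _); rewrite ?mul1r ?mul0r ?subr0//.
  by case: ifP => _; rewrite ?subr0// subrr expr0n/= sqr_ge0.
have iu : mu.-integrable setT (fun x => (u x ^+ 2)%:E).
  apply/integrableP; split; first by apply/measurable_EFinP; exact: measurable_funX.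
  under eq_integral do rewrite gee0_abs ?lee_fin ?sqr_ge0//.
  by rewrite -sqnorm_toC; case: Lu.
have := @dominated_convergence _ _ _ mu setT measurableT (fun n x => (w n x ^+ 2)%:E)
  (fun=> 0%E) (fun x => (u x ^+ 2)%:E).
case => //.
- by move=> n; apply/measurable_EFinP; exact: (measurable_funX 2 (mw n)).
- by apply: aeT => x _; exact: (cvg_EFin_seq (w0 x)).
- apply: aeT => x n _; rewrite gee0_abs ?lee_fin ?sqr_ge0//.
move=> _ _; rewrite integral0 => /fine_cvgP[fn].
move=> /cvgrPdist_lt/(_ _ e0) h.
near (\oo : set_system nat) => n.
exists n; rewrite sqnorm_toC.
have : (\int[mu]_x (w n x ^+ 2)%:E)%E \is a fin_num by near: n.
move=> fin; rewrite -(fineK fin) lte_fin.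
have : `|0 - fine (\int[mu]_x (w n x ^+ 2)%:E)%E| < e by near: n.
by rewrite sub0r normrN; apply: le_lt_trans; rewrite ler_norm.
Unshelve. all: by end_near. Qed.

(** Continuous functions are dense in L^1 of a bounded interval. Clipping the approximant at the
    bound n of the truncation brings it no farther from it and gives |v - h|^2 <= 2 n |v - g|, so
    that an L^1 bound yields an L^2 bound. *)
Let L2_approx u : L2 (toC u) -> forall e : R, 0 < e -> exists (n : nat) (h : R -> R),
  [/\ continuous h, forall x, `|h x| <= n%:R &
    (sqnorm setT (toC (fun x => u x - window h n%:R x)%R) < e%:E)%E].
Proof.
move=> Lu e e0; have mu_ : measurable_fun setT u by case: (L2_measurable Lu).
(* Two errors, each doubled by [sqnormD_le] with d = 1: 2 (e / 8) + 2 (e / 8) < e. *)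
have e8 : 0 < e / 8 by rewrite divr_gt0.
have [n hn] := truncate Lu e8.
pose D : set R := `[- n%:R, n%:R]%classic.
pose v x := if `|u x| <= n%:R then u x else 0.
have mv : measurable_fun setT v.
  apply: measurable_fun_if => //.
    by apply: measurable_fun_ler => //; apply: measurableT_comp.
  exact: measurable_funS mu_.
have vn x : `|v x| <= n%:R by rewrite /v; case: ifP => //; rewrite normr0.
have mD : measurable D by exact: measurable_itv.
have Dfin : (mu D < +oo)%E by rewrite lebesgue_measure_itv/=; case: ifP; rewrite ?ltry.
have iv : mu.-integrable D (EFin \o v).
  apply: measurable_bounded_integrable => //; first exact: measurable_funS mv.
  by exists n%:R; split => // M nM x _; apply: le_trans (vn x) (ltW nM).
have [g [cg ig /fine_cvgP[fg gv]]] := approximation_continuous_integrable mD Dfin iv.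
have n1 : 0 < (n%:R * 2 + 1 : R) by rewrite ltr_wpDl// mulr_ge0.
(* The factor 2 n of the passage from L^1 to L^2, increased by 1 so that it can be divided by when n
   = 0. *)
have e5 : 0 < e / 8 / (n%:R * 2 + 1) by rewrite divr_gt0.
near (\oo : set_system nat) => j.
have gj : (\int[mu]_(x in D) `|(v x - g j x)%:E| < (e / 8 / (n%:R * 2 + 1))%:E)%E.
  have fin : (\int[mu]_(x in D) `|(v x - g j x)%:E|)%E \is a fin_num by near: j.
  rewrite -(fineK fin) lte_fin.
  have : `|0 - fine (\int[mu]_(x in D) `|(v x - g j x)%:E|)%E| < e / 8 / (n%:R * 2 + 1).
    by near: j; move/cvgrPdist_lt : gv; exact.
  by rewrite sub0r normrN; apply: le_lt_trans; rewrite ler_norm.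
pose h x := clip n%:R (g j x).
have ch : continuous h by exact: continuous_clip.
have hn' x : `|h x| <= n%:R by exact: clip_norm.
exists n, h; split => //.
have mh : measurable_fun setT h by exact: continuous_measurable_fun.
have mwh : measurable_fun setT (window h n%:R).
  by apply: measurable_funM => //; exact: measurable_indic.
have mwv : measurable_fun setT (fun x => \1_D x * v x).
  by apply: measurable_funM => //; exact: measurable_indic.
have step2 : (sqnorm setT (toC (fun x => \1_D x * v x - window h n%:R x)%R) <= (e / 8)%:E)%E.
  apply: (@le_trans _ _ ((n%:R * 2 + 1)%:E * \int[mu]_(x in D) `|(v x - g j x)%:E|)%E); last first.
    apply: le_trans (lee_wpmul2l _ (ltW gj)) _; first by rewrite lee_fin ltW.
    by rewrite -EFinM lee_fin mulrC divfK// gt_eqF.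
  rewrite sqnorm_toC -ge0_integralZl_EFin ?(ltW n1)//; last first.
    apply: measurableT_comp => //; apply/measurable_EFinP; apply: measurable_funB.
      exact: measurable_funS mv.
    by apply: measurable_funTS; apply: continuous_measurable_fun; exact: cg.
  rewrite [leRHS]integral_mkcond; apply: ge0_le_integral => //.
  - by move=> x _; rewrite lee_fin sqr_ge0.
  - by apply/measurable_EFinP; apply: measurable_funX; exact: measurable_funB.
  - apply: (measurable_restrictT _ mD).1; apply: measurable_funeM.
    apply: measurableT_comp => //; apply/measurable_EFinP; apply: measurable_funB.
      exact: measurable_funS mv.
    by apply: measurable_funTS; apply: continuous_measurable_fun; exact: cg.
  - move=> x _; rewrite patchE /window -/D indicE; case: (x \in D); last first.
      by rewrite !mul0r subrr expr0n.
    rewrite !mul1r abse_EFin -EFinM lee_fin -real_normK ?num_real// expr2.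
    apply: ler_pM => //.
      apply: le_trans (ler_normB _ _) _; have := vn x; have := hn' x; lra.
    exact: clip_dist.
apply: (@le_lt_trans _ _ (sqnorm setT (fun x => (u x - \1_D x * v x)%:C + (\1_D x * v x - window h n%:R x)%:C))).
  by rewrite (_ : (fun x => _ + _) = toC (fun x => u x - window h n%:R x))//;
    apply/funext => x; rewrite -rmorphD/=; congr (_%:C); ring.
apply: le_lt_trans (sqnormD_le ltr01 measurableT _ _) _.
- by apply: cmeasurableR; exact: measurable_funB.
- by apply: cmeasurableR; exact: measurable_funB.
rewrite invr1; apply: (@le_lt_trans _ _ ((1 + 1)%:E * (e / 8)%:E + (1 + 1)%:E * (e / 8)%:E)%E).
  by apply: leeD; apply: lee_wpmul2l => //; exact: ltW.
by rewrite -?EFinM -?EFinD lte_fin; lra.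
Unshelve. all: by end_near. Qed.

(** Dominated convergence: the windowed function is continuous off the null set {- n, n}, and once
    |s k| <= 1 the difference vanishes off [- (n + 1), n + 1] and is at most 2 n. *)
Let trans_window (h : R -> R) (n : nat) (s : nat -> R) :
  continuous h -> (forall x, `|h x| <= n%:R) -> s k @[k --> \oo] --> 0 ->
  sqnorm setT (toC (fun x => window h n%:R (x + s k) - window h n%:R x)) @[k --> \oo] --> 0%E.
Proof.
move=> ch hn s0; pose w := window h n%:R.
have mw : measurable_fun setT w.
  by apply: measurable_funM; [exact: measurable_indic|exact: continuous_measurable_fun].
have mwk k : measurable_fun setT (fun x : R => w (x + s k)).
  apply: (measurableT_comp mw); exact: measurable_funD.
have -> : (fun k => sqnorm setT (toC (fun x => window h n%:R (x + s k) - window h n%:R x))) =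
    fun k => (\int[mu]_x ((w (x + s k) - w x) ^+ 2)%:E)%E.
  by apply/funext => k; rewrite sqnorm_toC.
have [K hK] : exists K, forall k, (K <= k)%N -> `|s k| <= 1.
  have /cvgr0Pnorm_le/(_ 1 ltr01)[K _ hK] := s0.
  by exists K => k /hK.
apply: (@cvg_tail _ _ _ K).
have := @dominated_convergence _ _ _ mu setT measurableT
  (fun k (x : R) => ((w (x + s (k + K)%N) - w x) ^+ 2)%:E) (fun=> 0%E)
  (fun x => ((2 * n%:R) ^+ 2 * \1_`[- (n%:R + 1), n%:R + 1] x)%:E).
case => //.
- move=> k; apply/measurable_EFinP; apply: (measurable_funX 2).
  exact: (measurable_funB (mwk _) mw).
- have neg (a : R) : {ae mu, forall x, x != a}.
    exists [set a]; split; [exact: measurable_set1|exact: lebesgue_measure_set1|].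
    by move=> x /= /negP; rewrite negbK => /eqP.
  apply: aeS2 (neg (- n%:R)) (neg n%:R) => x x1 x2 _.
  apply: cvg_EFin_seq.
  rewrite (_ : 0 = (w x - w x) ^+ 2); last by rewrite subrr expr0n.
  rewrite expr2; under eq_fun do rewrite expr2.
  suff cw : w (x + s (k + K)%N) @[k --> \oo] --> w x.
    by apply: cvgM; (apply: cvgB; [exact: cw|exact: cvg_cst]).
  have xs : x + s (k + K)%N @[k --> \oo] --> x.
    rewrite -[X in _ --> X]addr0; apply: cvgD; first exact: cvg_cst.
    by rewrite (cvg_shiftn K).
  apply: (cvg_comp _ _ xs).
  rewrite /w /window; apply: cvgM; last exact: ch.
  have [xn|xn] := ltrP `|x| n%:R.
    apply: cvg_near_cst; rewrite indicE mem_set; last first.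
      by rewrite /= in_itv/= -ler_norml ltW.
    near=> y; rewrite indicE mem_set//= in_itv/= -ler_norml ltW//.
    near: y; apply: (@cvgr_norm_lt _ _ _ _ _ id x) => //.
  have {}xn : n%:R < `|x|.
    rewrite lt_neqAle xn andbT; apply/eqP => nx.
    have [x0|x0] := lerP 0 x.
      by move: nx; rewrite ger0_norm// => nx; rewrite nx eqxx in x2.
    by move: nx; rewrite ltr0_norm// => nx; rewrite nx opprK eqxx in x1.
  apply: cvg_near_cst; rewrite indicE memNset; last first.
    by rewrite /= in_itv/= -ler_norml leNgt xn.
  near=> y; rewrite indicE memNset//= in_itv/= -ler_norml; apply/negP; rewrite -ltNge.
  near: y; apply: (@cvgr_norm_gt _ _ _ _ _ id x) => //.
- apply/integrableP; split.
    by apply/measurable_EFinP; apply: measurable_funM => //; exact: measurable_indic.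
  under eq_integral do rewrite gee0_abs ?lee_fin ?mulr_ge0 ?sqr_ge0//.
  under eq_integral do rewrite EFinM.
  rewrite ge0_integralZl_EFin ?sqr_ge0//; last by apply/measurable_EFinP; exact: measurable_indic.
  have Afin : (mu `[(- (n%:R + 1))%R, (n%:R + 1)%R]%classic < +oo)%E.
    by rewrite lebesgue_measure_itv/=; case: ifP; rewrite ?ltry.
  by rewrite integral_indic//= setIT lte_mul_pinfty// lee_fin sqr_ge0.
- apply: aeT => x k _; rewrite gee0_abs ?lee_fin ?sqr_ge0//.
  have wb y : `|w y| <= n%:R.
    rewrite /w /window indicE; case: (_ \in _); rewrite ?mul1r// mul0r normr0//.
  rewrite indicE; have [xin|xout] := boolP (x \in _).
    rewrite mulr1 -real_normK ?num_real// lerXn2r ?nnegrE ?mulr_ge0//.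
    apply: le_trans (ler_normB _ _) _; have := wb x; have := wb (x + s (k + K)%N); lra.
  have nx : n%:R + 1 < `|x|.
    rewrite ltNge; apply: contra xout => h'; rewrite inE/= in_itv/= -ler_norml//.
  have sk : `|s (k + K)%N| <= 1 by apply: hK; rewrite leq_addl.
  have wz y : n%:R < `|y| -> w y = 0.
    move=> ny; rewrite /w /window indicE memNset ?mul0r//= in_itv/= -ler_norml.
    by apply/negP; rewrite -ltNge.
  rewrite !wz ?subrr ?expr0n ?mulr0//; first lra.
  have := ler_normD (x + s (k + K)%N) (- s (k + K)%N); rewrite addrK normrN; lra.
by move=> _ _; rewrite integral0.
Unshelve. all: by end_near. Qed.

(** u is split into a windowed continuous function w, settled by [trans_window], and a small rest d,
    whose norm a translation does not change. *)
Lemma L2_translation_continuous u (s : nat -> R) : L2 (toC u) ->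
  s k @[k --> \oo] --> 0 ->
  sqnorm setT (toC (fun x => u (x + s k) - u x)) @[k --> \oo] --> 0%E.
Proof.
move=> Lu s0; have mu_ : measurable_fun setT u by case: (L2_measurable Lu).
have Lk k : L2 (toC (fun x => u (x + s k) - u x)).
  have := L2B (@L2_affine R 1 (s k) _ ltr01 Lu) Lu; congr L2; apply/funext => x.
  by rewrite mul1r rmorphB.
apply/fine_cvgP; split; first by near=> k; exact: sqnorm_fin_num.
apply/cvgrPdist_le => e e0.
(* The two nested splittings give 2 (e / 16) + 2 (2 (e / 16) + 2 (e / 16)) = 5 e / 8. *)
have e16 : 0 < e / 16 by rewrite divr_gt0.
have [n [h [ch hn un]]] := L2_approx Lu e16.
have := trans_window ch hn s0.
set w := window h n%:R in un *.
move=> /fine_cvgP[fw /cvgrPdist_le/(_ _ e16) hw].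
near=> k; rewrite sub0r normrN ger0_norm ?fine_ge0 ?sqnorm_ge0//.
rewrite -lee_fin fineK; last exact: sqnorm_fin_num.
have mw : measurable_fun setT w.
  by apply: measurable_funM; [exact: measurable_indic|exact: continuous_measurable_fun].
have mt (a : R -> R) : measurable_fun setT a -> measurable_fun setT (fun x : R => a (x + s k)).
  by move=> ma; apply: (measurableT_comp ma); exact: measurable_funD.
pose d x := u x - w x.
have md : measurable_fun setT d by exact: measurable_funB.
have -> : toC (fun x => u (x + s k) - u x) = fun x => (w (x + s k) - w x)%:C +
    ((d (x + s k))%:C + (- d x)%:C).
  by apply/funext => x; rewrite -!rmorphD/=; congr (_%:C); rewrite /d; ring.
have mN : measurable_fun setT (fun x => - d x) by exact: measurable_funN.
have h1 := sqnormD_le ltr01 measurableT (cmeasurableR (mt _ md)) (cmeasurableR mN).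
have h2 := sqnormD_le ltr01 measurableT (cmeasurableR (measurable_funB (mt _ mw) mw))
  (cmeasurableD (cmeasurableR (mt _ md)) (cmeasurableR mN)).
apply: le_trans h2 _.
have dt : sqnorm setT (toC (fun x => d (x + s k))) = sqnorm setT (toC d).
  have := @sqnorm_affine R 1 (s k) _ ltr01 (cmeasurableR md); rewrite invr1 mul1e => <-.
  by apply: eq_integral => x _; rewrite mul1r.
have dn : sqnorm setT (toC (fun x => - d x)) = sqnorm setT (toC d).
  by apply: eq_integral => x _; rewrite !normsqR sqrrN.
rewrite dt dn in h1.
have wk : (sqnorm setT (toC (fun x => w (x + s k) - w x)%R) <= (e / 16)%:E)%E.
  have fin : sqnorm setT (toC (fun x => w (x + s k) - w x)) \is a fin_num by near: k.
  rewrite -(fineK fin) lee_fin.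
  have : `|0 - fine (sqnorm setT (toC (fun x => w (x + s k) - w x)))| <= e / 16 by near: k.
  by rewrite sub0r normrN; apply: le_trans; rewrite ler_norm.
have two : (0 <= (1 + 1 : R)%:E)%E by rewrite lee_fin.
apply: (@le_trans _ _ ((1 + 1)%:E * (e / 16)%:E + (1 + 1)%:E * ((1 + 1)%:E * (e / 16)%:E + (1 + 1)%:E * (e / 16)%:E))%E).
  rewrite invr1; apply: leeD; apply: lee_wpmul2l => //.
  apply: le_trans h1 _; rewrite invr1; apply: leeD; apply: lee_wpmul2l => //; exact: ltW.
by rewrite -?EFinM -?EFinD -?EFinM -?EFinD lee_fin; lra.
Unshelve. all: by end_near. Qed.

End Translation_continuity.

Section Product_integrability.
Context (R : realType).
Local Notation mu := (@lebesgue_measure R).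
Implicit Types (u a b : R -> R).

Lemma EFin_RintegralE u : mu.-integrable setT (EFin \o u) ->
  (\int[mu]_x u x)%R%:E = (\int[mu]_x (u x)%:E)%E.
Proof. by move=> iu; rewrite /Rintegral fineK//; exact: integrable_fin_num. Qed.

Lemma integrable_measurable u : mu.-integrable setT (EFin \o u) -> measurable_fun setT u.
Proof. by move=> /integrableP[mu_ _]; exact/measurable_EFinP. Qed.

Lemma integrable_mulr_bounded u a : mu.-integrable setT (EFin \o u) ->
  measurable_fun setT a -> (forall x, `|a x| <= 1) ->
  mu.-integrable setT (EFin \o (fun x => u x * a x)).
Proof.
move=> iu ma a1; apply: (le_integrable measurableT _ _ iu) => //.
  by apply/measurable_EFinP; apply: measurable_funM => //; exact: integrable_measurable.
by move=> x _; rewrite !abse_EFin lee_fin normrM ler_piMr.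
Qed.

Lemma integrable_prod_bounded (F g : R * R -> R) :
  (mu \x mu)%E.-integrable setT (EFin \o F) ->
  measurable_fun setT g -> (forall p, `|g p| <= 1) ->
  (mu \x mu)%E.-integrable setT (EFin \o (fun p => F p * g p)).
Proof.
move=> iF mg g1; apply: (le_integrable measurableT _ _ iF) => //.
  apply/measurable_EFinP; apply: measurable_funM => //.
  by move: iF => /integrableP[/measurable_EFinP].
by move=> x _; rewrite !abse_EFin lee_fin normrM ler_piMr.
Qed.

Lemma integrable_prod a b : mu.-integrable setT (EFin \o a) ->
  mu.-integrable setT (EFin \o b) ->
  (mu \x mu)%E.-integrable setT (EFin \o (fun p : R * R => a p.1 * b p.2)).
Proof.
move=> ia ib; have ma := integrable_measurable ia; have mb := integrable_measurable ib.
have mab : measurable_fun setT (EFin \o (fun p : R * R => a p.1 * b p.2)).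
  apply/measurable_EFinP; apply: measurable_funM.
    by apply: (measurableT_comp ma); exact: measurable_fst.
  by apply: (measurableT_comp mb); exact: measurable_snd.
apply: (@integrable12ltyP _ _ _ _ R mu mu _ mab).2 => /=.
have /integrableP[_ fb] := ib; have /integrableP[mea fa] := ia.
have e x : (\int[mu]_y `|(a x * b y)%:E| = `|(a x)%:E| * \int[mu]_y `|(b y)%:E|)%E.
  rewrite -ge0_integralZl//; last by apply: measurableT_comp => //; exact/measurable_EFinP.
  by apply: eq_integral => y _; rewrite EFinM abseM.
under eq_integral do rewrite e.
rewrite ge0_integralZr//; last 2 first.
- by apply: measurableT_comp.
- exact: integral_ge0.
by rewrite lte_mul_pinfty// ?integral_ge0// ge0_fin_numE// integral_ge0.
Qed.

Lemma integrable_prod_shear u : mu.-integrable setT (EFin \o u) ->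
  (mu \x mu)%E.-integrable setT (EFin \o (fun p : R * R => u p.1 * u (p.1 + p.2))).
Proof.
move=> iu; have mu_ := integrable_measurable iu.
have mf : measurable_fun setT (EFin \o (fun p : R * R => u p.1 * u (p.1 + p.2))).
  apply/measurable_EFinP; apply: measurable_funM.
    by apply: (measurableT_comp mu_); exact: measurable_fst.
  apply: (measurableT_comp mu_); apply: measurable_funD; [exact: measurable_fst|exact: measurable_snd].
apply: (@integrable12ltyP _ _ _ _ R mu mu _ mf).2 => /=.
have /integrableP[meu fu] := iu.
have e x : (\int[mu]_y `|(u x * u (x + y))%:E| = `|(u x)%:E| * \int[mu]_y `|(u y)%:E|)%E.
  have mabs : measurable_fun setT (fun y => `|(u y)%:E|)%E by exact: measurableT_comp.
  rewrite -(ge0_integral_shift x mabs)// -ge0_integralZl//; last first.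
    apply: (measurableT_comp mabs).
    by have := @measurable_affine R 1 x; under eq_fun do rewrite mul1r.
  by apply: eq_integral => y _; rewrite EFinM abseM addrC.
under eq_integral do rewrite e.
rewrite ge0_integralZr//; last 2 first.
- by apply: measurableT_comp.
- exact: integral_ge0.
by rewrite lte_mul_pinfty// ?integral_ge0// ge0_fin_numE// integral_ge0.
Qed.

(** The translation is the first coordinate here, so that integrating out the second one leaves the
    autocorrelation. *)
Lemma integrable_prod_shear_swap u : mu.-integrable setT (EFin \o u) ->
  (mu \x mu)%E.-integrable setT (EFin \o (fun p : R * R => u p.2 * u (p.2 + p.1))).
Proof.
move=> iu; have mu_ := integrable_measurable iu.
have mf : measurable_fun setT (EFin \o (fun p : R * R => u p.2 * u (p.2 + p.1))).
  apply/measurable_EFinP; apply: measurable_funM.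
    by apply: (measurableT_comp mu_); exact: measurable_snd.
  apply: (measurableT_comp mu_); apply: measurable_funD; [exact: measurable_snd|exact: measurable_fst].
apply: (@integrable21ltyP _ _ _ _ R mu mu _ mf).2 => /=.
have /integrableP[meu fu] := iu.
have e x : (\int[mu]_y `|(u x * u (x + y))%:E| = `|(u x)%:E| * \int[mu]_y `|(u y)%:E|)%E.
  have mabs : measurable_fun setT (fun y => `|(u y)%:E|)%E by exact: measurableT_comp.
  rewrite -(ge0_integral_shift x mabs)// -ge0_integralZl//; last first.
    apply: (measurableT_comp mabs).
    by have := @measurable_affine R 1 x; under eq_fun do rewrite mul1r.
  by apply: eq_integral => y _; rewrite EFinM abseM addrC.
under eq_integral do rewrite e.
rewrite ge0_integralZr//; last 2 first.
- by apply: measurableT_comp.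
- exact: integral_ge0.
by rewrite lte_mul_pinfty// ?integral_ge0// ge0_fin_numE// integral_ge0.
Qed.

Lemma cos_norm_le1 (t : R) : `|cos t| <= 1.
Proof. by rewrite ler_norml cos_geN1 cos_le1. Qed.

Lemma sin_norm_le1 (t : R) : `|sin t| <= 1.
Proof. by rewrite ler_norml sin_geN1 sin_le1. Qed.

End Product_integrability.

Section Plancherel_real.
Context (R : realType).
Local Notation mu := (@lebesgue_measure R).
Local Notation toC u := (fun x => (u x)%:C : R[i]).
Implicit Types (tau : R -> R).

Definition trig_transform tau (u : R -> R) (xi : R) : R :=
  (\int[mu]_x (u x * tau (xi * x)))%R.

Context (u : R -> R).
Context (iu : mu.-integrable setT (EFin \o u)).

Lemma integrable_trig tau xi : measurable_fun setT tau -> (forall t, `|tau t| <= 1) ->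
  mu.-integrable setT (EFin \o (fun x => u x * tau (xi * x))).
Proof.
move=> mt t1; apply: integrable_mulr_bounded => //.
by apply: (measurableT_comp mt); exact: mulrl_measurable.
Qed.

(** Over all xi the product integrand need not be integrable; the weight exp (- |xi|) makes it so,
    Fubini's theorem gives measurability of the weighted transform, and the weight is divided
    out. *)
Lemma measurable_trig_transform tau : measurable_fun setT tau ->
  (forall t, `|tau t| <= 1) -> measurable_fun setT (trig_transform tau u).
Proof.
move=> mt t1.
have ie := @integrable_expRN_norm R 1 ltr01.
have ip := integrable_prod ie iu.
have mp : measurable_fun setT (fun p : R * R => tau (p.1 * p.2)).
  apply: (measurableT_comp mt); apply: measurable_funM;
    [exact: measurable_fst|exact: measurable_snd].
have ipt := integrable_prod_bounded ip mp (fun p => t1 _).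
have mF := measurable_fubini_F ipt.
have -> : trig_transform tau u = fun xi => expR (1 * `|xi|) *
    fine (\int[mu]_y (expR (- (1 * `|xi|)) * u y * tau (xi * y))%:E)%E.
  apply/funext => xi; under eq_integral do rewrite -mulrA EFinM.
  rewrite integralZl//; last exact: integrable_trig.
  rewrite -EFin_RintegralE; last exact: integrable_trig.
  by rewrite -EFinM/= mulrA -expRD subrr expR0 mul1r.
apply: measurable_funM.
  apply: measurableT_comp; first exact: measurable_expR.
  by apply: measurable_funM => //.
by apply: measurableT_comp => //; exact: mF.
Qed.

Context (Lu : L2 (toC u)).

Definition autocorrelation (s : R) : R := (\int[mu]_x (u x * u (x + s)))%R.

Let Lus s : L2 (toC (fun x => u (x + s))).
Proof.
have := @L2_affine R 1 s _ ltr01 Lu; congr L2; apply/funext => x.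
by rewrite mul1r.
Qed.

Let N := Re (cdot (toC u) (toC u)).

Lemma autocorrelationE s : autocorrelation s = Re (cdot (toC u) (toC (fun x => u (x + s)))).
Proof.
rewrite /autocorrelation /cdot /cintegral/=; apply: eq_Rintegral => x _.
by rewrite oppr0 mulr0 subr0.
Qed.

Let integrable_auto s : mu.-integrable setT (EFin \o (fun x => u x * u (x + s))).
Proof.
have [+ _] := L2_mulJ Lu (Lus s); congr (integrable _ _ _); apply/funext => x /=.
by rewrite oppr0 mulr0 subr0.
Qed.

Lemma autocorrelation_le s : `|autocorrelation s| <= N.
Proof.
have N0 : 0 <= N by exact: (ip_ge0 (inner_product_L2 R)).
rewrite autocorrelationE -(@ler_pXn2r _ 2)// ?nnegrE// real_normK ?num_real//.
apply: le_trans (Re_sqr_le _) _; apply: le_trans (ip_CS (inner_product_L2 R) Lu (Lus s)) _.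
rewrite expr2 ler_wpM2l// -lee_fin !cdot_sqnorm//.
have := @sqnorm_affine R 1 s _ ltr01 (L2_measurable Lu); rewrite invr1 mul1e => <-.
by rewrite (_ : (fun x => (u (1 * x + s))%:C) = toC (fun x => u (x + s)))//;
  apply/funext => x; rewrite mul1r.
Qed.

(** By polarization the autocorrelation at s is N - ||u(. + s) - u||^2 / 2, and translations are
    continuous in L^2. *)
Lemma autocorrelation_cvg (s : nat -> R) : s k @[k --> \oo] --> 0 ->
  autocorrelation (s k) @[k --> \oo] --> N.
Proof.
move=> s0; have := L2_translation_continuous Lu s0.
have Ld k : L2 (toC (fun x => u (x + s k) - u x)).
  have := L2B (Lus (s k)) Lu; congr L2; apply/funext => x.
  by rewrite rmorphB.
move/(sqnorm_cvg_fine Ld) => h.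
have e k : autocorrelation (s k) =
    N - 2^-1 * Re (cdot (toC (fun x => u (x + s k) - u x)) (toC (fun x => u (x + s k) - u x))).
  rewrite autocorrelationE.
  have := ip_nnD (inner_product_L2 R) (-1) Lu (Lus (s k)).
  have -> : (fun x => -1 * toC u x + toC (fun x => u (x + s k)) x) = toC (fun x => u (x + s k) - u x).
    by apply/funext => x; rewrite mulN1r addrC rmorphB.
  move=> ->; rewrite normsqN normsq1 mulN1r cReN.
  have -> : Re (cdot (toC (fun x => u (x + s k))) (toC (fun x => u (x + s k)))) = N.
    apply: EFin_inj; rewrite !cdot_sqnorm//.
    have := @sqnorm_affine R 1 (s k) _ ltr01 (L2_measurable Lu); rewrite invr1 mul1e => <-.
    by congr sqnorm; apply/funext => x; rewrite mul1r.
  by rewrite -/N; lra.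
have -> : (fun k => autocorrelation (s k)) = fun k => N - 2^-1 *
    Re (cdot (toC (fun x => u (x + s k) - u x)) (toC (fun x => u (x + s k) - u x))).
  by apply/funext => k; exact: e.
rewrite -[X in _ --> X]subr0 -[X in _ - X](mulr0 2^-1).
by apply: cvgB; [exact: cvg_cst|exact: cvgMr].
Qed.

Lemma integrable_autocorrelation : mu.-integrable setT (EFin \o autocorrelation).
Proof.
have := integrable_fubini_F (integrable_prod_shear_swap iu).
congr (integrable _ _ _); apply/funext => s; rewrite /fubini_F/= /autocorrelation.
by rewrite EFin_RintegralE.
Qed.

Let mcos : measurable_fun setT (@cos R). Proof. exact: measurable_cos. Qed.
Let msin : measurable_fun setT (@sin R). Proof. exact: measurable_sin. Qed.

(** The squared modulus of the Fourier transform of the real function u. *)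
Let power xi := trig_transform cos u xi ^+ 2 + trig_transform sin u xi ^+ 2.

Let power_ge0 xi : 0 <= power xi. Proof. by rewrite addr_ge0// sqr_ge0. Qed.

Let mpower : measurable_fun setT power.
Proof.
apply: measurable_funD; apply: measurable_funX; apply: measurable_trig_transform => //.
  exact: cos_norm_le1.
exact: sin_norm_le1.
Qed.

(** Wiener-Khinchin relation, by Fubini's theorem for u(x) u(x + s) cos (xi s): the integral over s
    is computed with y = x + s and the addition formula of the cosine. *)
Lemma power_autocorrelation xi :
  (power xi)%:E = (\int[mu]_s (autocorrelation s * cos (xi * s))%:E)%E.
Proof.
set C := trig_transform cos u xi; set S := trig_transform sin u xi.
have ic := integrable_trig xi mcos (@cos_norm_le1 R).
have isn := integrable_trig xi msin (@sin_norm_le1 R).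
have mu_ := integrable_measurable iu.
have mp : measurable_fun setT (fun p : R * R => cos (xi * p.2)).
  by apply: (measurableT_comp mcos); apply: measurable_funM => //; exact: measurable_snd.
have ip := integrable_prod_bounded (integrable_prod_shear iu) mp (fun p => cos_norm_le1 _).
have inner x : (\int[mu]_s (u x * u (x + s) * cos (xi * s))%:E =
    (u x * (C * cos (xi * x) + S * sin (xi * x)))%:E)%E.
  have icx : mu.-integrable setT (EFin \o (fun y => u y * cos (xi * (y - x)))).
    apply: integrable_mulr_bounded => //; last by move=> y; exact: cos_norm_le1.
    apply: (measurableT_comp mcos); apply: measurable_funM => //.
    exact: measurable_funB.
  have e1 : (\int[mu]_s (u (x + s) * cos (xi * s))%:E =
      \int[mu]_y (u y * cos (xi * (y - x)))%:E)%E.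
    have [/measurable_EFinP micx _] := integrableP _ _ _ icx.
    have := @integral_affine R 1 x (fun y => (u y * cos (xi * (y - x)))%:E) ltr01.
    rewrite invr1 mul1e => <-; last exact/measurable_EFinP.
    by apply: eq_integral => s _; rewrite mul1r addrK addrC.
  under eq_integral do rewrite -mulrA EFinM.
  rewrite integralZl//; last first.
    have := @integrable_affine R 1 x _ ltr01 icx; congr (integrable _ _ _).
    by apply/funext => s /=; rewrite mul1r addrK addrC.
  rewrite e1 EFinM; congr (_ * _)%E.
  have e2 : (\int[mu]_y (u y * cos (xi * (y - x)))%:E = \int[mu]_y ((cos (xi * x))%:E *
      (u y * cos (xi * y))%:E + (sin (xi * x))%:E * (u y * sin (xi * y))%:E))%E.
    apply: eq_integral => y _; rewrite -!EFinM -EFinD; congr EFin.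
    by rewrite mulrBr cosB; ring.
  rewrite e2 integralD//; try exact: integrableZl.
  rewrite !integralZl// -!EFin_RintegralE// -!EFinM -EFinD; congr EFin.
  by rewrite /C /S /trig_transform; ring.
have F := Fubini ip.
transitivity (\int[mu]_x \int[mu]_y (u x * u (x + y) * cos (xi * y))%:E)%E; last first.
  rewrite [LHS]F; apply: eq_integral => s _ /=.
  transitivity (\int[mu]_x ((cos (xi * s))%:E * (u x * u (x + s))%:E))%E.
    by apply: eq_integral => x _; rewrite -EFinM mulrC.
  rewrite (integralZl measurableT (integrable_auto s)).
  by rewrite -(EFin_RintegralE (integrable_auto s)) -EFinM mulrC.
under eq_integral do rewrite inner.
transitivity (\int[mu]_x (C%:E * (u x * cos (xi * x))%:E + S%:E * (u x * sin (xi * x))%:E))%E.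
  rewrite (integralD measurableT (integrableZl measurableT C ic) (integrableZl measurableT S isn)).
  rewrite (integralZl measurableT ic) (integralZl measurableT isn).
  by rewrite -(EFin_RintegralE ic) -(EFin_RintegralE isn) -!EFinM -EFinD /power !expr2.
by apply: eq_integral => x _; rewrite -!EFinM -EFinD; congr EFin; ring.
Qed.

(** Damping makes the double integral of exp (- e |xi|) and the autocorrelation absolutely
    convergent. Its cosine transform is the Poisson kernel, which s -> e s rescales to the fixed
    profile 2 / (1 + s^2). *)
Lemma poisson_power e : 0 < e ->
  (\int[mu]_xi (expR (- (e * `|xi|)) * power xi)%:E =
   \int[mu]_s (autocorrelation (e * s) * (2 * (1 + s ^+ 2)^-1))%:E)%E.
Proof.
move=> e0.
have ie := integrable_expRN_norm e0.
have ia := integrable_autocorrelation.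
have ma := integrable_measurable ia.
have mp : measurable_fun setT (fun p : R * R => cos (p.1 * p.2)).
  apply: (measurableT_comp mcos); apply: measurable_funM;
    [exact: measurable_fst|exact: measurable_snd].
have ip := integrable_prod_bounded (integrable_prod ie ia) mp (fun p => cos_norm_le1 _).
have iac xi : mu.-integrable setT (EFin \o (fun s => autocorrelation s * cos (xi * s))).
  apply: integrable_mulr_bounded => //; last by move=> y; exact: cos_norm_le1.
  by apply: (measurableT_comp mcos); apply: measurable_funM.
transitivity (\int[mu]_xi \int[mu]_s (expR (- (e * `|xi|)) * autocorrelation s * cos (xi * s))%:E)%E.
  apply: eq_integral => xi _; rewrite EFinM power_autocorrelation -integralZl//; last exact: iac.
  by apply: eq_integral => s _; rewrite -EFinM mulrA.
rewrite (Fubini ip) /=.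
transitivity (\int[mu]_s (autocorrelation s * (2 * e / (e ^+ 2 + s ^+ 2)))%:E)%E.
  apply: eq_integral => s _; rewrite EFinM -integral_poisson// -integralZl//; last first.
    apply: integrable_mulr_bounded => //; last by move=> y; exact: cos_norm_le1.
    by apply: (measurableT_comp mcos); exact: mulrl_measurable.
  by apply: eq_integral => xi _; rewrite -EFinM; congr EFin; rewrite [s * xi]mulrC; ring.
have mker : measurable_fun setT (fun s => autocorrelation s * (2 * e / (e ^+ 2 + s ^+ 2))).
  apply: measurable_funM => //; apply: measurable_funM => //.
  apply: continuous_measurable_fun => s; apply: cvgV.
    by rewrite gt_eqF// ltr_pwDl ?exprn_gt0// sqr_ge0.
  by apply: cvgD; [exact: cvg_cst|exact: exprn_continuous].
have aff := @integral_affine R e 0 _ e0 (iffRL (measurable_EFinP _ _) mker).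
have -> : (\int[mu]_s (autocorrelation s * (2 * e / (e ^+ 2 + s ^+ 2)))%:E =
  e%:E * ((e^-1)%:E * \int[mu]_s (autocorrelation s * (2 * e / (e ^+ 2 + s ^+ 2)))%:E))%E.
  by rewrite muleA -EFinM mulfV ?gt_eqF// mul1e.
rewrite -aff /= -integralZl//; last first.
  have ik : mu.-integrable setT (EFin \o (fun s => autocorrelation s * (2 * e / (e ^+ 2 + s ^+ 2)))).
    have -> : EFin \o (fun s => autocorrelation s * (2 * e / (e ^+ 2 + s ^+ 2))) =
       (fun s => (2 / e)%:E * (autocorrelation s * (e ^+ 2 / (e ^+ 2 + s ^+ 2)))%:E)%E.
      apply/funext => s; rewrite /= -EFinM; congr EFin; field.
      by rewrite !gt_eqF// ltr_pwDl ?exprn_gt0// sqr_ge0.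
    apply: integrableZl => //; apply: integrable_mulr_bounded => //.
      apply: measurable_funM => //.
      apply: continuous_measurable_fun => s; apply: cvgV.
        by rewrite gt_eqF// ltr_pwDl ?exprn_gt0// sqr_ge0.
      by apply: cvgD; [exact: cvg_cst|exact: exprn_continuous].
    move=> s; rewrite ger0_norm; last by rewrite divr_ge0 ?addr_ge0 ?sqr_ge0.
    by rewrite ler_pdivrMr ?mul1r ?lerDl ?sqr_ge0// ltr_pwDl ?exprn_gt0// sqr_ge0.
  exact: (integrable_affine 0 e0 ik).
apply: eq_integral => s _; rewrite -EFinM addr0; congr EFin; field.
by rewrite !gt_eqF//= ?ltr_pwDl ?exprn_gt0// ?sqr_ge0// exprMn addr_gt0// ?exprn_gt0//.
Qed.

(** As e decreases to 0 the left side of [poisson_power] increases to the integral of [power], by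
    monotone convergence. On the right the autocorrelation tends to its value N at 0 and is bounded
    by N, and the profile has integral 2 pi. *)
Lemma plancherel_real : (\int[mu]_xi (power xi)%:E = (2 * pi)%:E * \int[mu]_x (u x ^+ 2)%:E)%E.
Proof.
pose e (k : nat) : R := k.+1%:R^-1.
have e0 k : 0 < e k by rewrite invr_gt0.
have ecvg : e k @[k --> \oo] --> 0 by exact: cvg_harmonic.
have ia := integrable_autocorrelation.
have ma := integrable_measurable ia.
have mcz : measurable_fun setT (fun s : R => (1 + s ^+ 2)^-1).
  by apply: continuous_measurable_fun; exact: continuous_oneDsqrV.
have L : (\int[mu]_xi (expR (- (e k * `|xi|)) * power xi)%:E)%E @[k --> \oo] -->
    (\int[mu]_xi (power xi)%:E)%E.
  have := @cvg_monotone_convergence _ _ _ mu setT measurableT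
    (fun k xi => (expR (- (e k * `|xi|)) * power xi)%:E).
  have pw xi : limn (fun k => (expR (- (e k * `|xi|)) * power xi)%:E) = (power xi)%:E.
    apply/cvg_lim => //; apply: cvg_EFin_seq; rewrite -[X in _ --> X]mul1r.
    apply: cvgMl; rewrite -(@expR0 R) -oppr0 -(mul0r `|xi|).
    apply: continuous_cvg; first exact: continuous_expR.
    by apply: cvgN; apply: cvgMl.
  under [X in _ -> _ -> _ -> _ --> X]eq_integral do rewrite pw.
  apply.
  - move=> k; apply/measurable_EFinP; apply: measurable_funM => //.
    exact: measurable_expRN_norm.
  - by move=> k x _; rewrite lee_fin mulr_ge0// expR_ge0.
  - move=> x _ k l kl; rewrite lee_fin ler_wpM2r// ler_expR lerN2 ler_wpM2r//.
    by rewrite /e lef_pV2 ?posrE// ler_nat.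
have RR : (\int[mu]_s (autocorrelation (e k * s) * (2 * (1 + s ^+ 2)^-1))%:E)%E @[k --> \oo] -->
    (\int[mu]_s (N * (2 * (1 + s ^+ 2)^-1))%:E)%E.
  have mc : measurable_fun setT (fun s : R => 2 * (1 + s ^+ 2)^-1).
    exact: measurable_funM.
  have := @dominated_convergence _ _ _ mu setT measurableT
    (fun k s => (autocorrelation (e k * s) * (2 * (1 + s ^+ 2)^-1))%:E)
    (fun s => (N * (2 * (1 + s ^+ 2)^-1))%:E) (fun s => (N * (2 * (1 + s ^+ 2)^-1))%:E).
  case => //.
  - move=> k; apply/measurable_EFinP.
    exact: (measurable_funM (measurableT_comp ma (mulrl_measurable _)) mc).
  - apply/measurable_EFinP; exact: (measurable_funM (measurable_cst N) mc).
  - apply: aeT => s _; apply: cvg_EFin_seq; apply: cvgMl; apply: autocorrelation_cvg.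
    by rewrite -(mul0r s); apply: cvgMl.
  - have -> : (fun s => (N * (2 * (1 + s ^+ 2)^-1))%:E) =
       (fun s : R => (N * 2)%:E * ((1 + s ^+ 2)^-1)%:E)%E.
      by apply/funext => s; rewrite -EFinM mulrA.
    apply: integrableZl => //; apply/integrableP; split.
      exact/measurable_EFinP.
    under eq_integral do rewrite gee0_abs ?lee_fin ?invr_ge0 ?addr_ge0 ?sqr_ge0//.
    by rewrite integral_cauchy ltry.
  - apply: aeT => s k _; rewrite abse_EFin lee_fin normrM.
    have h0 : 0 <= 2 * (1 + s ^+ 2)^-1 by rewrite mulr_ge0 ?invr_ge0 ?addr_ge0 ?sqr_ge0.
    by rewrite (ger0_norm h0) ler_wpM2r// autocorrelation_le.
have e1 : (fun k => \int[mu]_xi (expR (- (e k * `|xi|)) * power xi)%:E)%E =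
   (fun k => \int[mu]_s (autocorrelation (e k * s) * (2 * (1 + s ^+ 2)^-1))%:E)%E.
  by apply/funext => k; exact: poisson_power.
rewrite e1 in L.
rewrite (cvg_unique _ L RR)// -sqnorm_toC -cdot_sqnorm// -/N.
transitivity (\int[mu]_s ((N * 2)%:E * ((1 + s ^+ 2)^-1)%:E))%E.
  by apply: eq_integral => s _; rewrite -EFinM mulrA.
rewrite ge0_integralZl_EFin//.
- by rewrite integral_cauchy -!EFinM; congr EFin; ring.
- by move=> s _; rewrite lee_fin invr_ge0 addr_ge0// sqr_ge0.
- exact/measurable_EFinP.
- by rewrite mulr_ge0//; exact: (ip_ge0 (inner_product_L2 R)).
Qed.

End Plancherel_real.

(** * Transforms of complex integrable functions *)

Section Fourier_L1.
Context (R : realType).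
Local Notation mu := (@lebesgue_measure R).
Implicit Types (f g u v : R -> R[i]).

Lemma mule2_inj (x y : \bar R) : (2%:E * x = 2%:E * y)%E -> x = y.
Proof.
have p2 : (0 < 2%:E :> \bar R)%E by rewrite lte_fin.
case: x => [r| |]; case: y => [t| |] //; rewrite ?gt0_muley ?gt0_muleNy//.
by rewrite -!EFinM => -[] /mulfI -> //; rewrite pnatr_eq0.
Qed.

Lemma cintegrable_expi f (a : R -> R) : measurable_fun setT a -> cintegrable f ->
  cintegrable (fun x => f x * expi (a x)).
Proof.
move=> ma [f1 f2].
have mc : measurable_fun setT (fun x => cos (a x)).
  by apply: (measurableT_comp _ ma); exact: measurable_cos.
have ms : measurable_fun setT (fun x => sin (a x)).
  by apply: (measurableT_comp _ ma); exact: measurable_sin.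
have B (u b : R -> R) : mu.-integrable setT (EFin \o u) -> measurable_fun setT b ->
    (forall x : R, `|b x| <= 1) -> mu.-integrable setT (fun x => (u x * b x)%:E).
  exact: integrable_mulr_bounded.
split.
  have -> : (fun x => (Re (f x * expi (a x)))%:E) =
    ((fun x => (Re (f x) * cos (a x))%:E) \- (fun x => (Im (f x) * sin (a x))%:E))%E.
    by apply/funext => x; rewrite cReM.
  apply: integrableB => //; apply: B => // x; [exact: cos_norm_le1|exact: sin_norm_le1].
have -> : (fun x => (Im (f x * expi (a x)))%:E) =
    ((fun x => (Re (f x) * sin (a x))%:E) \+ (fun x => (Im (f x) * cos (a x))%:E))%E.
  by apply/funext => x; rewrite cImM.
apply: integrableD => //; apply: B => // x; [exact: sin_norm_le1|exact: cos_norm_le1].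
Qed.

Lemma cintegrable_fourier f xi : cintegrable f ->
  cintegrable (fun x => f x * expi (- (xi * x))).
Proof.
by apply: cintegrable_expi; apply: measurable_funN; exact: mulrl_measurable.
Qed.

Lemma fourierL1_lin (c : R[i]) f g : cintegrable f -> cintegrable g ->
  fourierL1 (fun x => c * f x + g x) = fun xi => c * fourierL1 f xi + fourierL1 g xi.
Proof.
move=> cf cg; apply/funext => xi; rewrite /fourierL1 -cintegral_lin;
  try exact: cintegrable_fourier.
by congr cintegral; apply/funext => x; rewrite mulrDl mulrA.
Qed.

Lemma Re_fourierL1 f xi : cintegrable f -> Re (fourierL1 f xi) =
  trig_transform cos (fun x => Re (f x)) xi + trig_transform sin (fun x => Im (f x)) xi.
Proof.
move=> [f1 f2]; rewrite /fourierL1 /cintegral/= /trig_transform.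
rewrite -RintegralD//; try (apply: integrable_trig => //;
  [exact: measurable_cos|exact: cos_norm_le1]); try (apply: integrable_trig => //;
  [exact: measurable_sin|exact: sin_norm_le1]).
by apply: eq_Rintegral => x _; rewrite cReM /= cosN sinN mulrN opprK.
Qed.

Lemma Im_fourierL1 f xi : cintegrable f -> Im (fourierL1 f xi) =
  trig_transform cos (fun x => Im (f x)) xi - trig_transform sin (fun x => Re (f x)) xi.
Proof.
move=> [f1 f2]; rewrite /fourierL1 /cintegral/= /trig_transform.
rewrite -RintegralB//; try (apply: integrable_trig => //;
  [exact: measurable_cos|exact: cos_norm_le1]); try (apply: integrable_trig => //;
  [exact: measurable_sin|exact: sin_norm_le1]).
by apply: eq_Rintegral => x _; rewrite cImM /= cosN sinN mulrN addrC.
Qed.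

Lemma cmeasurable_fourierL1 f : cintegrable f -> cmeasurable setT (fourierL1 f).
Proof.
move=> cf; have [f1 f2] := cf; split.
  have -> : (fun xi => Re (fourierL1 f xi)) =
    trig_transform cos (fun x => Re (f x)) \+ trig_transform sin (fun x => Im (f x)).
    by apply/funext => xi; exact: Re_fourierL1.
  apply: measurable_funD; apply: measurable_trig_transform => //;
    [exact: measurable_cos|exact: cos_norm_le1|exact: measurable_sin|exact: sin_norm_le1].
have -> : (fun xi => Im (fourierL1 f xi)) =
    trig_transform cos (fun x => Im (f x)) \- trig_transform sin (fun x => Re (f x)).
  by apply/funext => xi; exact: Im_fourierL1.
apply: measurable_funB; apply: measurable_trig_transform => //;
  [exact: measurable_cos|exact: cos_norm_le1|exact: measurable_sin|exact: sin_norm_le1].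
Qed.

Lemma trig_transform_cosN (u : R -> R) xi : mu.-integrable setT (EFin \o u) ->
  trig_transform cos u (- xi) = trig_transform cos u xi.
Proof. by move=> iu; apply: eq_Rintegral => x _; rewrite mulNr cosN. Qed.

Lemma trig_transform_sinN (u : R -> R) xi : mu.-integrable setT (EFin \o u) ->
  trig_transform sin u (- xi) = - trig_transform sin u xi.
Proof.
move=> iu; rewrite -[RHS]mulN1r /trig_transform -RintegralZl//; last first.
  by apply: integrable_trig => //; [exact: measurable_sin|exact: sin_norm_le1].
by apply: eq_Rintegral => x _; rewrite mulNr sinN; ring.
Qed.

(** For f = a + i b the cross terms of the squared modulus are odd in xi. Adding the values at xi
    and - xi therefore leaves twice the sum of the powers of a and b, to which the real case
    applies. *)
Lemma fourierL1_sqnorm f : cintegrable f -> L2 f ->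
  sqnorm setT (fourierL1 f) = ((2 * pi)%:E * sqnorm setT f)%E.
Proof.
move=> cf Lf; have [f1 f2] := cf.
have mF := emeasurable_normsq (cmeasurable_fourierL1 cf).
pose a x := Re (f x); pose b x := Im (f x).
have mf := L2_measurable Lf.
have La : L2 (fun x => (a x)%:C).
  apply: (L2_le _ Lf); first by apply: cmeasurableR; case: mf.
  by move=> x; rewrite normsqR Re_sqr_le.
have Lb : L2 (fun x => (b x)%:C).
  apply: (L2_le _ Lf); first by apply: cmeasurableR; case: mf.
  by move=> x; rewrite normsqR Im_sqr_le.
have Pa := plancherel_real f1 La; have Pb := plancherel_real f2 Lb.
have fsum : sqnorm setT f = (\int[mu]_x (a x ^+ 2)%:E + \int[mu]_x (b x ^+ 2)%:E)%E.
  rewrite -ge0_integralD//.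
  - by apply: eq_integral => x _; rewrite normsqE EFinD.
  - by move=> x _; rewrite lee_fin sqr_ge0.
  - by apply/measurable_EFinP; apply: (measurable_funX 2); case: mf.
  - by move=> x _; rewrite lee_fin sqr_ge0.
  - by apply/measurable_EFinP; apply: (measurable_funX 2); case: mf.
have mt (u tau : R -> R) : mu.-integrable setT (EFin \o u) -> measurable_fun setT tau ->
    (forall t, `|tau t| <= 1) -> measurable_fun setT (fun xi => (trig_transform tau u xi ^+ 2)%:E).
  move=> iu mtau t1; apply/measurable_EFinP; apply: (measurable_funX 2).
  exact: measurable_trig_transform.
have mp (u : R -> R) : mu.-integrable setT (EFin \o u) -> measurable_fun setT
    (fun xi => (trig_transform cos u xi ^+ 2 + trig_transform sin u xi ^+ 2)%:E).
  move=> iu; under eq_fun do rewrite EFinD.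
  by apply: emeasurable_funD; apply: mt => //;
    [exact: measurable_cos|exact: cos_norm_le1|exact: measurable_sin|exact: sin_norm_le1].
have pos (u : R -> R) xi : (0 <= (trig_transform cos u xi ^+ 2 + trig_transform sin u xi ^+ 2)%:E)%E.
  by rewrite lee_fin addr_ge0 ?sqr_ge0.
have refl : sqnorm setT (fourierL1 f) = (\int[mu]_xi (normsq (fourierL1 f (- xi)))%:E)%E.
  by rewrite (ge0_integral_reflect mF)// => x; rewrite lee_fin normsq_ge0.
have mFN : measurable_fun setT (fun xi : R => (normsq (fourierL1 f (- xi)))%:E).
  by apply: (measurableT_comp mF); exact: oppr_measurable.
have n0 (g : R -> R[i]) x : setT x -> (0 <= (normsq (g x))%:E)%E.
  by move=> _; rewrite lee_fin normsq_ge0.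
have p0 (g : R -> R) x : setT x -> (0 <= (g x ^+ 2)%:E)%E.
  by move=> _; rewrite lee_fin sqr_ge0.
have S1 : (sqnorm setT (fourierL1 f) + sqnorm setT (fourierL1 f) =
    \int[mu]_xi ((normsq (fourierL1 f xi))%:E + (normsq (fourierL1 f (- xi)))%:E))%E.
  have D := @ge0_integralD _ _ _ mu setT measurableT _ _ (n0 (fourierL1 f)) mF
    (n0 (fun xi => fourierL1 f (- xi))) mFN.
  by rewrite D {2}refl.
have S2 : ((2 * pi)%:E * sqnorm setT f =
    \int[mu]_xi ((trig_transform cos a xi ^+ 2 + trig_transform sin a xi ^+ 2)%:E +
      (trig_transform cos b xi ^+ 2 + trig_transform sin b xi ^+ 2)%:E))%E.
  have D := @ge0_integralD _ _ _ mu setT measurableT _ _ (fun x _ => pos a x) (mp a f1)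
    (fun x _ => pos b x) (mp b f2).
  rewrite D fsum ge0_muleDr; last 2 first.
  - by apply: integral_ge0 => x; exact: p0.
  - by apply: integral_ge0 => x; exact: p0.
  by rewrite -Pa -Pb.
have key : (2%:E * sqnorm setT (fourierL1 f) = 2%:E * ((2 * pi)%:E * sqnorm setT f))%E.
  have Z := @ge0_integralZl_EFin _ _ _ mu setT measurableT _
    (fun x _ => adde_ge0 (pos a x) (pos b x)) (emeasurable_funD (mp a f1) (mp b f2)) 2 (ler0n R 2).
  rewrite S2 -Z mule_natl mule2n S1.
  apply: eq_integral => xi _; rewrite -!EFinD -EFinM; congr EFin.
  rewrite (normsqE (fourierL1 f xi)) (normsqE (fourierL1 f (- xi))).
  rewrite (Re_fourierL1 xi cf) (Re_fourierL1 (- xi) cf) (Im_fourierL1 xi cf) (Im_fourierL1 (- xi) cf).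
  rewrite -/a -/b (trig_transform_cosN _ f1) (trig_transform_cosN _ f2).
  rewrite (trig_transform_sinN _ f1) (trig_transform_sinN _ f2).
  move: (trig_transform _ _ _) (trig_transform _ _ _) (trig_transform _ _ _) (trig_transform _ _ _).
  move=> *; ring.
exact: mule2_inj key.
Qed.

Lemma fourierL1_L2 f : cintegrable f -> L2 f -> L2 (fourierL1 f).
Proof.
move=> cf Lf; split; first exact: cmeasurable_fourierL1.
rewrite fourierL1_sqnorm// lte_mul_pinfty//; first by rewrite lee_fin mulr_ge0// pi_ge0.
by case: Lf.
Qed.

Let ip := inner_product_L2 R.

Lemma cdot_of_scaled_norms (K : R) (F G f g : R -> R[i]) : L2 F -> L2 G -> L2 f -> L2 g ->
  (forall c, sqnorm setT (fun x => c * F x + G x) =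
     (K%:E * sqnorm setT (fun x => c * f x + g x)%R)%E) ->
  sqnorm setT F = (K%:E * sqnorm setT f)%E -> sqnorm setT G = (K%:E * sqnorm setT g)%E ->
  cdot F G = K%:C * cdot f g.
Proof.
move=> LF LG Lf Lg hc hF hG; apply: (ip_dot_of_nn ip) => // c.
have toR h h' : L2 h -> L2 h' -> sqnorm setT h = (K%:E * sqnorm setT h')%E ->
    Re (cdot h h) = K * Re (cdot h' h').
  by move=> Lh Lh' e; apply: EFin_inj; rewrite EFinM !cdot_sqnorm.
rewrite (toR _ _ (L2_lin c LF LG) (L2_lin c Lf Lg) (hc c)).
rewrite (toR _ _ LF Lf hF) (toR _ _ LG Lg hG) (ip_nnD ip c Lf Lg).
move: (Re (cdot f f)) (Re (cdot g g)) (cdot f g) => s t d.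
rewrite !cE /=; ring.
Qed.

Lemma fourierL1_dot f g : cintegrable f -> L2 f -> cintegrable g -> L2 g ->
  cdot (fourierL1 f) (fourierL1 g) = (2 * pi)%:C * cdot f g.
Proof.
move=> cf Lf cg Lg; have LF := fourierL1_L2 cf Lf; have LG := fourierL1_L2 cg Lg.
apply: cdot_of_scaled_norms => //; last 2 first.
- exact: fourierL1_sqnorm.
- exact: fourierL1_sqnorm.
move=> c; have Lcfg := L2_lin c Lf Lg.
have ccfg : cintegrable (fun x => c * f x + g x).
  by apply: cintegrableD => //; exact: cintegrableZ.
by have := fourierL1_sqnorm ccfg Lcfg; rewrite (fourierL1_lin c cf cg).
Qed.

Lemma cFubini (F : R -> R -> R[i]) :
  (mu \x mu)%E.-integrable setT (EFin \o (fun p : R * R => Re (F p.1 p.2))) ->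
  (mu \x mu)%E.-integrable setT (EFin \o (fun p : R * R => Im (F p.1 p.2))) ->
  (forall x, cintegrable (F x)) -> (forall y, cintegrable (F ^~ y)) ->
  cintegral (fun x => cintegral (F x)) = cintegral (fun y => cintegral (F ^~ y)).
Proof.
move=> iRe iIm c1 c2; apply: eqcP; rewrite /cintegral/=; congr fine.
  transitivity (\int[mu]_x \int[mu]_y (Re (F x y))%:E)%E.
    by apply: eq_integral => x _; rewrite EFin_RintegralE//; case: (c1 x).
  rewrite (Fubini iRe); apply: eq_integral => y _ /=.
  by rewrite EFin_RintegralE//; case: (c2 y).
transitivity (\int[mu]_x \int[mu]_y (Im (F x y))%:E)%E.
  by apply: eq_integral => x _; rewrite EFin_RintegralE//; case: (c1 x).
rewrite (Fubini iIm); apply: eq_integral => y _ /=.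
by rewrite EFin_RintegralE//; case: (c2 y).
Qed.

(** Fubini's theorem for v(xi) u(x) exp (- i xi x). Surjectivity of the transform on L^2 will rest
    on the extension of this formula. *)
Lemma fourierL1_mult u v : cintegrable u -> cintegrable v ->
  cintegral (fun xi => fourierL1 u xi * v xi) = cintegral (fun x => u x * fourierL1 v x).
Proof.
move=> cu cv; pose F (xi x : R) := v xi * (u x * expi (- (xi * x))).
have mu_ := cintegrable_measurable cu; have mv := cintegrable_measurable cv.
have c1 xi : cintegrable (F xi) by apply: cintegrableZ; exact: cintegrable_fourier.
have c2 x : cintegrable (F ^~ x).
  have := cintegrableZ (u x) (cintegrable_fourier x cv); congr cintegrable.
  by apply/funext => xi; rewrite /F mulrCA [xi * x]mulrC.
transitivity (cintegral (fun xi => cintegral (F xi))).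
  congr cintegral; apply/funext => xi; rewrite /F cintegralZ; last exact: cintegrable_fourier.
  by rewrite mulrC.
have absI (w : R -> R[i]) : cintegrable w ->
    mu.-integrable setT (EFin \o (fun x => `|Re (w x)| + `|Im (w x)|)).
  move=> [w1 w2]; have -> : EFin \o (fun x => `|Re (w x)| + `|Im (w x)|) =
    ((fun x => `|(Re (w x))%:E|) \+ (fun x => `|(Im (w x))%:E|))%E by [].
  by apply: integrableD => //; exact: integrable_abse.
have idom := integrable_prod (absI _ cv) (absI _ cu).
have m1 (w : R -> R) : measurable_fun setT w -> measurable_fun setT (fun p : R * R => w p.1).
  by move=> mw; apply: (measurableT_comp mw); exact: measurable_fst.
have m2 (w : R -> R) : measurable_fun setT w -> measurable_fun setT (fun p : R * R => w p.2).
  by move=> mw; apply: (measurableT_comp mw); exact: measurable_snd.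
have mph : measurable_fun setT (fun p : R * R => - (p.1 * p.2)).
  by apply: measurable_funN; apply: measurable_funM; [exact: measurable_fst|exact: measurable_snd].
have mc : measurable_fun setT (fun p : R * R => cos (- (p.1 * p.2))).
  by apply: (measurableT_comp _ mph); exact: measurable_cos.
have ms : measurable_fun setT (fun p : R * R => sin (- (p.1 * p.2))).
  by apply: (measurableT_comp _ mph); exact: measurable_sin.
have [/m2 u1 /m2 u2] := mu_; have [/m1 v1 /m1 v2] := mv.
have bound (z w : R[i]) (t r : R) : r ^+ 2 <= normsq (z * (w * expi t)) ->
    `|r| <= (`|Re z| + `|Im z|) * (`|Re w| + `|Im w|).
  have nl (y : R[i]) : normsq y <= (`|Re y| + `|Im y|) ^+ 2.
    rewrite normsqE -(real_normK (num_real (Re y))) -(real_normK (num_real (Im y))).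
    have := normr_ge0 (Re y); have := normr_ge0 (Im y); nra.
  rewrite !normsqM normsq_expi mulr1 => h.
  rewrite -(@ler_pXn2r _ 2)// ?nnegrE ?mulr_ge0 ?addr_ge0// real_normK ?num_real//.
  by apply: le_trans h _; rewrite exprMn ler_pM ?normsq_ge0.
rewrite (@cFubini F)//.
- congr cintegral; apply/funext => x.
  have -> : F ^~ x = fun xi => u x * (v xi * expi (- (x * xi))).
    by apply/funext => xi; rewrite /F mulrCA [xi * x]mulrC.
  by rewrite cintegralZ//; exact: cintegrable_fourier.
- apply: (le_integrable measurableT _ _ idom).
    apply/measurable_EFinP.
    rewrite /F; under eq_fun do rewrite !cE /=.
    apply: measurable_funB; apply: measurable_funM => //.
      by apply: measurable_funB; apply: measurable_funM.
    by apply: measurable_funD; apply: measurable_funM.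
  move=> p _; rewrite !abse_EFin lee_fin [leRHS]ger0_norm; last first.
    by rewrite mulr_ge0 ?addr_ge0.
  by apply: bound; exact: Re_sqr_le.
- apply: (le_integrable measurableT _ _ idom).
    apply/measurable_EFinP.
    rewrite /F; under eq_fun do rewrite !cE /=.
    apply: measurable_funD; apply: measurable_funM => //.
      by apply: measurable_funD; apply: measurable_funM.
    by apply: measurable_funB; apply: measurable_funM.
  move=> p _; rewrite !abse_EFin lee_fin [leRHS]ger0_norm; last first.
    by rewrite mulr_ge0 ?addr_ge0.
  by apply: bound; exact: Im_sqr_le.
Qed.

End Fourier_L1.

(** * The Fourier transform on L^2 *)

Section Fourier_L2.
Context (R : realType).
Local Notation mu := (@lebesgue_measure R).
Implicit Types (f g h u v : R -> R[i]).

Let ip := inner_product_L2 R.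

Lemma L2_cst_indic (A : set R) (c : R[i]) : measurable A -> (mu A < +oo)%E ->
  L2 (fun x => (\1_A x)%:C * c).
Proof.
move=> mA Afin; split.
  by apply: cmeasurableM; [exact: cmeasurable_indic|exact: cmeasurable_cst].
rewrite -sqnorm_mkcond /sqnorm integral_cst//.
by rewrite lte_mul_pinfty// lee_fin normsq_ge0.
Qed.

Lemma L2_cintegrable (A : set R) f : measurable A -> (mu A < +oo)%E -> L2 f ->
  cintegrable (fun x => (\1_A x)%:C * f x).
Proof.
move=> mA Afin Lf; have := L2_mul (L2_cst_indic 1 mA Afin) Lf.
by congr cintegrable; apply/funext => x; rewrite mulr1.
Qed.

Let ball0 (k : nat) : set R := `[- k%:R, k%:R]%classic.

Let mball k : measurable (ball0 k). Proof. exact: measurable_itv. Qed.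

Let ball_fin k : (mu (ball0 k) < +oo)%E.
Proof. by rewrite lebesgue_measure_itv/=; case: ifP; rewrite ?ltry. Qed.

Lemma L2_truncation f : L2 f ->
  sqnorm setT (fun x => (\1_(ball0 k) x)%:C * f x - f x) @[k --> \oo] --> 0%E.
Proof.
move=> Lf; have mf := L2_measurable Lf.
pose w (k : nat) (x : R) := (normsq ((\1_(ball0 k) x)%:C * f x - f x))%:E.
have mw k : measurable_fun setT (w k).
  apply: emeasurable_normsq; apply: cmeasurableB => //; apply: cmeasurableM => //.
  exact: cmeasurable_indic.
have If : mu.-integrable setT (fun x => (normsq (f x))%:E).
  apply/integrableP; split; first exact: emeasurable_normsq.
  by under eq_integral do rewrite gee0_abs ?lee_fin ?normsq_ge0//; case: Lf.
have := @dominated_convergence _ _ _ mu setT measurableT w (fun=> 0%E) _ mw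
  (measurable_cst _) _ If.
case => //.
- apply: aeT => x _; apply: cvg_EFin_seq; apply: cvg_near_cst; near=> k.
  have xk : `|x| <= k%:R by near: k; exact: nbhs_infty_ger.
  by rewrite indicE mem_set ?mul1r ?subrr ?normsq0//= /ball0 /= in_itv/= -ler_norml.
- apply: aeT => x k _; rewrite gee0_abs ?lee_fin ?normsq_ge0//.
  rewrite indicE; case: (_ \in _); rewrite ?mul1r ?subrr ?normsq0 ?normsq_ge0//.
  by rewrite mul0r sub0r normsqN.
by move=> _ _; rewrite integral0.
Unshelve. all: by end_near. Qed.

Let P2 : 0 <= 2 * pi :> R. Proof. by rewrite mulr_ge0// pi_ge0. Qed.

Let fourierL1B f g : cintegrable f -> cintegrable g ->
  fourierL1 (fun x => f x - g x) = fun xi => fourierL1 f xi - fourierL1 g xi.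
Proof.
move=> cf cg; have := fourierL1_lin (-1) cg cf.
have -> : (fun x => -1 * g x + f x) = fun x => f x - g x.
  by apply/funext => x; rewrite mulN1r addrC.
by move=> ->; apply/funext => xi; rewrite mulN1r addrC.
Qed.

Lemma cintegrableB f g : cintegrable f -> cintegrable g -> cintegrable (fun x => f x - g x).
Proof.
move=> cf cg; have := cintegrableD cf (cintegrableZ (-1) cg).
by congr cintegrable; apply/funext => x; rewrite mulN1r.
Qed.

(** The truncations of f are integrable, and by [fourierL1_sqnorm] their transforms are Cauchy
    because they are; completeness provides the limit. *)
Lemma fourier_exists f : L2 f -> exists g, is_fourier f g.
Proof.
move=> Lf; pose u k x := (\1_(ball0 k) x)%:C * f x.
have cu k : cintegrable (u k) by exact: L2_cintegrable.
have Lu k : L2 (u k) by exact: L2_indic.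
have uf := L2_truncation Lf; rewrite -/(u _) in uf.
have [|g Lg ug] := @L2_complete R (fun k => fourierL1 (u k)) (fun k => fourierL1_L2 (cu k) (Lu k)).
  (* 8 pi is the factor 2 pi of Plancherel times 2 + 2 from splitting u k - u l at f. *)
  move=> e e0; have e1 : 0 < e / (8 * pi) by rewrite divr_gt0// mulr_gt0// pi_gt0.
  have /fine_cvgP[[K1 _ h1] /cvgrPdist_le/(_ _ e1)[K2 _ h2]] := uf.
  have small k : (K1 <= k)%N -> (K2 <= k)%N ->
      (sqnorm setT (fun x => u k x - f x)%R <= (e / (8 * pi))%:E)%E.
    move=> k1 k2; rewrite -(fineK (h1 k k1)) lee_fin.
    by have := h2 k k2; rewrite /= sub0r normrN; apply: le_trans; rewrite ler_norm.
  exists (maxn K1 K2) => k l; rewrite !geq_max => /andP[k1 k2] /andP[l1 l2].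
  rewrite -fourierL1B// fourierL1_sqnorm; [|exact: cintegrableB|exact: L2B].
  have -> : (fun x => u k x - u l x) = fun x => (u k x - f x) + - (u l x - f x).
    by apply/funext => x; ring.
  have mk j : cmeasurable setT (fun x => u j x - f x).
    by apply: L2_measurable; exact: L2B.
  have := sqnormD_le ltr01 measurableT (mk k) (cmeasurableN (mk l)).
  rewrite sqnormN invr1 => h; apply: le_trans (lee_wpmul2l _ h) _; first by rewrite lee_fin.
  apply: (@le_trans _ _ ((2 * pi)%:E * ((1 + 1)%:E * (e / (8 * pi))%:E + (1 + 1)%:E * (e / (8 * pi))%:E)))%E.
    apply: lee_wpmul2l; first by rewrite lee_fin.
    by apply: leeD; apply: lee_wpmul2l; rewrite ?lee_fin//; exact: small.
  have pi0 : pi != 0 :> R by rewrite gt_eqF ?pi_gt0.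
  have E : e = 8 * pi * (e / (8 * pi)) by rewrite [RHS]mulrC divfK// mulf_neq0// pnatr_eq0.
  rewrite [in leRHS]E; move: (e / (8 * pi)) => t.
  have -> : 8 * pi * t = 2 * pi * ((1 + 1) * t + (1 + 1) * t) by ring.
  exact: lexx.
exists g; split => //; exists u; split => //.
Qed.

(** The choice made by [xget] is arbitrary, so analytic facts about [fourier] are derived from this
    property and hold almost everywhere. *)
Lemma fourierP f : L2 f -> is_fourier f (fourier f).
Proof. by move=> Lf; have [g hg] := fourier_exists Lf; exact: (xgetPex (fun=> 0) (ex_intro _ g hg)). Qed.

#[local] Opaque fourier.

Lemma is_fourier_dot f g f' g' : L2 f -> L2 f' -> is_fourier f g -> is_fourier f' g' ->
  cdot g g' = (2 * pi)%:C * cdot f f'.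
Proof.
(* Both sides are limits of the identity for the integrable approximants. *)
move=> Lf Lf' [Lg [u [cu uf ug]]] [Lg' [v [cv vf vg]]].
have LFu k : L2 (fourierL1 (u k)) by case: (cu k) => ? ?; exact: fourierL1_L2.
have LFv k : L2 (fourierL1 (v k)) by case: (cv k) => ? ?; exact: fourierL1_L2.
have Lu k : L2 (u k) by case: (cu k).
have Lv k : L2 (v k) by case: (cv k).
have c1 := cdot_cvg LFu LFv Lg Lg' ug vg.
have c2 := cdot_cvg Lu Lv Lf Lf' uf vf.
apply: (normsq_cvg_unique c1).
have -> : (fun k => normsq (cdot (fourierL1 (u k)) (fourierL1 (v k)) - (2 * pi)%:C * cdot f f')) =
    fun k => (2 * pi) ^+ 2 * normsq (cdot (u k) (v k) - cdot f f').
  apply/funext => k; case: (cu k) => cuk _; case: (cv k) => cvk _.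
  by rewrite fourierL1_dot// -mulrBr normsqM normsqR.
by rewrite -(mulr0 ((2 * pi) ^+ 2)); exact: cvgMr.
Qed.

Lemma is_fourier_mult f g f' g' : L2 f -> L2 f' -> is_fourier f g -> is_fourier f' g' ->
  cintegral (fun x => g x * f' x) = cintegral (fun x => f x * g' x).
Proof.
move=> Lf Lf' [Lg [u [cu uf ug]]] [Lg' [v [cv vf vg]]].
have LFu k : L2 (fourierL1 (u k)) by case: (cu k) => ? ?; exact: fourierL1_L2.
have LFv k : L2 (fourierL1 (v k)) by case: (cv k) => ? ?; exact: fourierL1_L2.
have Lu k : L2 (u k) by case: (cu k).
have Lv k : L2 (v k) by case: (cv k).
have J (w : nat -> R -> R[i]) h : sqnorm setT (fun x => w k x - h x) @[k --> \oo] --> 0%E ->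
    sqnorm setT (fun x => conjc (w k x) - conjc (h x)) @[k --> \oo] --> 0%E.
  have -> : (fun k => sqnorm setT (fun x => conjc (w k x) - conjc (h x))) =
      fun k => sqnorm setT (fun x => w k x - h x); last by [].
  by apply/funext => k; rewrite -sqnormJ; congr sqnorm; apply/funext => x; rewrite -rmorphB conjcK.
have E a b : cintegral (fun x => a x * b x) = cdot a (fun x => conjc (b x)).
  by congr cintegral; apply/funext => x; rewrite conjcK.
rewrite !E.
have c1 := cdot_cvg LFu (fun k => L2J (Lv k)) Lg (L2J Lf') ug (J _ _ vf).
have c2 := cdot_cvg Lu (fun k => L2J (LFv k)) Lf (L2J Lg') uf (J _ _ vg).
apply: (normsq_cvg_unique c1).
have -> : (fun k => normsq (cdot (fourierL1 (u k)) (fun x => conjc (v k x)) -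
    cdot f (fun x => conjc (g' x)))) =
  (fun k => normsq (cdot (u k) (fun x => conjc (fourierL1 (v k) x)) - cdot f (fun x => conjc (g' x)))).
  apply/funext => k; case: (cu k) => cuk _; case: (cv k) => cvk _.
  by rewrite -!E fourierL1_mult.
exact: c2.
Qed.

Lemma fourier_L2 f : L2 f -> L2 (fourier f).
Proof. by move=> /fourierP[]. Qed.

Lemma fourier_dot f g : L2 f -> L2 g ->
  cdot (fourier f) (fourier g) = (2 * pi)%:C * cdot f g.
Proof. by move=> Lf Lg; apply: is_fourier_dot => //; exact: fourierP. Qed.

Lemma fourier_sqnorm f : L2 f ->
  sqnorm setT (fourier f) = ((2 * pi)%:E * sqnorm setT f)%E.
Proof.
move=> Lf; have LF := fourier_L2 Lf.
by rewrite -!cdot_sqnorm// fourier_dot// -EFinM; congr EFin; rewrite !cE /=; ring.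
Qed.

Lemma ae_eq_of_dots (F G : R -> R[i]) : L2 F -> L2 G ->
  cdot F F = cdot G G -> cdot F G = cdot G G -> {ae mu, forall x, F x = G x}.
Proof.
move=> LF LG h1 h2.
have LFG := L2B LF LG.
have : sqnorm setT (fun x => F x - G x) = 0%E.
  rewrite -cdot_sqnorm// (ip_dotBl ip)// !(ip_dotBr ip)//.
  by rewrite (ip_dotC ip LF LG) h1 h2 -(ip_dotC ip LG LG) !subrr.
move/(sqnorm_eq0 measurableT (L2_measurable LFG)); apply: aeS => x /(_ I)/eqP.
by rewrite subr_eq0 => /eqP.
Qed.

Lemma fourier_unique f g : L2 f -> is_fourier f g -> {ae mu, forall x, fourier f x = g x}.
Proof.
move=> Lf hg; have hf := fourierP Lf; have Lg : L2 g by case: hg.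
apply: ae_eq_of_dots => //; first exact: fourier_L2.
  by rewrite (is_fourier_dot Lf Lf hf hf) (is_fourier_dot Lf Lf hg hg).
by rewrite (is_fourier_dot Lf Lf hf hg) (is_fourier_dot Lf Lf hg hg).
Qed.

#[local] Opaque cdot.

(** The representatives chosen for the sum and for the summands are unrelated. By Plancherel the two
    sides have the same norm and the same inner product with each other, so their difference has
    norm 0. *)
Lemma fourier_lin_ae (c : R[i]) f g : L2 f -> L2 g ->
  {ae mu, forall x, fourier (fun x => c * f x + g x) x = c * fourier f x + fourier g x}.
Proof.
move=> Lf Lg; have Lfg := L2_lin c Lf Lg.
have Ff := fourier_L2 Lf; have Fg := fourier_L2 Lg.
have Ffg := fourier_L2 Lfg; have LFfg := L2_lin c Ff Fg.
have e1 : cdot (fourier (fun x => c * f x + g x)) (fun x => c * fourier f x + fourier g x) =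
    (2 * pi)%:C * cdot (fun x => c * f x + g x) (fun x => c * f x + g x).
  rewrite (ip_dotr ip c Ff Fg Ffg) (fourier_dot Lfg Lf) (fourier_dot Lfg Lg).
  rewrite (ip_dotr ip c Lf Lg Lfg); move: (cdot _ f) (cdot _ g) (2 * pi)%:C => *; ring.
have e2 : cdot (fun x => c * fourier f x + fourier g x) (fun x => c * fourier f x + fourier g x) =
    (2 * pi)%:C * cdot (fun x => c * f x + g x) (fun x => c * f x + g x).
  rewrite (ip_dotl ip c Ff Fg LFfg) (ip_dotr ip c Ff Fg Ff) (ip_dotr ip c Ff Fg Fg).
  rewrite (fourier_dot Lf Lf) (fourier_dot Lf Lg) (fourier_dot Lg Lf) (fourier_dot Lg Lg).
  rewrite (ip_dotl ip c Lf Lg Lfg) (ip_dotr ip c Lf Lg Lf) (ip_dotr ip c Lf Lg Lg).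
  move: (cdot f f) (cdot f g) (cdot g f) (cdot g g) (2 * pi)%:C => *; ring.
by apply: (ae_eq_of_dots Ffg LFfg); rewrite ?e1 ?e2 ?fourier_dot.
Qed.

Lemma fourier0_ae : {ae mu, forall x, fourier (fun _ : R => 0 : R[i]) x = 0}.
Proof.
have L0 := L2_0 R; have := fourier_lin_ae 0 L0 L0.
have -> : (fun _ : R => 0 * 0 + 0) = fun _ : R => 0 : R[i].
  by apply/funext => x; rewrite mul0r addr0.
have h := fourier_sqnorm L0.
have z : sqnorm setT (fun _ : R => 0 : R[i]) = 0%E.
  by rewrite /sqnorm normsq0 integral0.
move=> _; rewrite z mule0 in h.
have := sqnorm_eq0 measurableT (L2_measurable (fourier_L2 L0)) h.
by apply: aeS => x /(_ I).
Qed.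

#[local] Transparent cdot.

(* The multiplication formula makes [conj \o fourier \o conj] the adjoint of the
   isometry, hence a right inverse up to the factor 2 pi. *)
Lemma fourier_surjective g : L2 g ->
  exists2 f, L2 f & {ae mu, forall x, fourier f x = g x}.
Proof.
move=> Lg; have LJ := L2J Lg; have LFJ := fourier_L2 LJ.
have n2 : (2 * pi)%:C != 0 :> R[i].
  by rewrite -(rmorph0 (real_complex R)) (inj_eq (@complexI R)) gt_eqF// mulr_gt0// pi_gt0.
pose f x := ((2 * pi)^-1)%:C * conjc (fourier (fun x => conjc (g x)) x).
have Lf : L2 f by apply: L2Z; exact: L2J.
exists f => //.
have JJ a b : L2 a -> L2 b -> cdot (fun x => conjc (a x)) (fun x => conjc (b x)) = conjc (cdot a b).
  by move=> La Lb; rewrite /cdot -cintegralJ; congr cintegral; apply/funext => x; rewrite rmorphM.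
have e1 : cdot (fourier f) (fourier f) = cdot g g.
  rewrite fourier_dot// /f (ip_dotZl ip) ?(ip_dotZr ip); try exact: L2J; try (apply: L2Z; exact: L2J).
  have -> : cdot (fun x => conjc (fourier (fun x => conjc (g x)) x))
      (fun x => conjc (fourier (fun x => conjc (g x)) x)) = (2 * pi)%:C * cdot g g.
    rewrite JJ// fourier_dot// JJ//.
    have -> z : conjc ((2 * pi)%:C * conjc z) = (2 * pi)%:C * z :> R[i].
      by apply: eqcP; rewrite !cE /=; ring.
    by [].
  rewrite conjc_real fmorphV; set t := cdot g g; set s := (2 * pi)%:C in n2 *.
  by rewrite !mulrA mulfV// mul1r mulVf// mul1r.
have LFf := fourier_L2 Lf.
have e2 : cdot (fourier f) g = cdot f (fun x => (2 * pi)%:C * f x).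
  rewrite /cdot (is_fourier_mult Lf LJ (fourierP Lf) (fourierP LJ)).
  congr cintegral; apply/funext => x; congr (_ * _).
  by rewrite /f fmorphV mulrA mulfV// mul1r conjcK.
apply: (ae_eq_of_dots LFf Lg e1).
by rewrite -e1 (fourier_dot Lf Lf) e2 (ip_dotZr ip _ Lf Lf) conjc_real.
Qed.

Lemma fourierL1_affine (a b : R) f : 0 < a -> cintegrable f ->
  fourierL1 (fun x => f (a * x + b)) =
  fun xi => (a^-1)%:C * expi (xi * b / a) * fourierL1 f (xi / a).
Proof.
move=> a0 cf; apply/funext => xi; rewrite /fourierL1.
pose G y := expi (xi * b / a) * (f y * expi (- (xi / a * y))).
have cG : cintegrable G by apply: cintegrableZ; exact: cintegrable_fourier.
have -> : (fun x => f (a * x + b) * expi (- (xi * x))) = fun x => G (a * x + b).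
  apply/funext => x; rewrite /G mulrCA -expiD; congr (_ * expi _).
  by field; rewrite gt_eqF.
rewrite cintegral_affine//; last exact: cintegrable_measurable.
rewrite -mulrA; congr (_ * _).
by rewrite /G cintegralZ//; exact: cintegrable_fourier.
Qed.

Lemma cintegrable_affine (a b : R) f : 0 < a -> cintegrable f ->
  cintegrable (fun x => f (a * x + b)).
Proof. by move=> a0 [f1 f2]; split; [exact: (integrable_affine b a0 f1)|exact: (integrable_affine b a0 f2)]. Qed.

Lemma cvge_scale (c : R) (w w' : nat -> \bar R) : (forall k, w' k = c%:E * w k)%E ->
  w k @[k --> \oo] --> 0%E -> w' k @[k --> \oo] --> 0%E.
Proof.
move=> e h; have -> : w' = fun k => (c%:E * w k)%E by apply/funext.
by rewrite -(mule0 c%:E); apply: cvgeZl.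
Qed.

(** Approximants of f composed with the affine map approximate the composition, and their transforms
    are explicit by [fourierL1_affine]; the claimed function is then a transform, and transforms are
    unique almost everywhere. *)
Lemma fourier_affine (a b : R) f : 0 < a -> L2 f ->
  {ae mu, forall xi, fourier (fun x => f (a * x + b)) xi =
     (a^-1)%:C * expi (xi * b / a) * fourier f (xi / a)}.
Proof.
move=> a0 Lf; have [Lg [u [cu uf ug]]] := fourierP Lf.
have ai0 : 0 < a^-1 by rewrite invr_gt0.
have mph : measurable_fun setT (fun xi : R => xi * b / a).
  by apply: measurable_funM => //; apply: measurable_funM.
have tr (h : R -> R[i]) : L2 h -> L2 (fun xi => (a^-1)%:C * expi (xi * b / a) * h (xi / a)).
  move=> Lh; have := L2Z (a^-1)%:C (L2_expi mph (L2_affine 0 ai0 Lh)).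
  by congr L2; apply/funext => x; rewrite addr0 mulrA [a^-1 * x]mulrC.
apply: fourier_unique; first exact: L2_affine.
split; first exact: tr.
exists (fun k x => u k (a * x + b)); split.
- by move=> k; case: (cu k) => c l; split; [exact: cintegrable_affine|exact: L2_affine].
- apply: (cvge_scale (c := a^-1)) uf => k.
  apply: (@sqnorm_affine R a b (fun x => u k x - f x)) => //.
  by apply: L2_measurable; apply: L2B => //; case: (cu k).
- apply: (cvge_scale (c := a^-1)) ug => k; case: (cu k) => c l.
  have LD : L2 (fun xi => fourierL1 (u k) xi - fourier f xi).
    by apply: L2B => //; exact: fourierL1_L2.
  have -> : (fun xi => fourierL1 (fun x => u k (a * x + b)) xi -
      (a^-1)%:C * expi (xi * b / a) * fourier f (xi / a)) =
    fun xi => (a^-1)%:C * (expi (xi * b / a) *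
      (fun y => fourierL1 (u k) y - fourier f y) (a^-1 * xi + 0)).
    by apply/funext => xi; rewrite fourierL1_affine// addr0 [a^-1 * xi]mulrC; ring.
  have mD := cmeasurable_affine a^-1 0 (L2_measurable LD).
  rewrite sqnormZ//; last by apply: cmeasurableM => //; exact: cmeasurable_expi.
  have -> : sqnorm setT (fun xi => expi (xi * b / a) *
      (fun y => fourierL1 (u k) y - fourier f y) (a^-1 * xi + 0)) =
    sqnorm setT (fun xi => (fun y => fourierL1 (u k) y - fourier f y) (a^-1 * xi + 0)).
    by apply: eq_integral => x _; rewrite normsqM normsq_expi mul1r.
  rewrite (@sqnorm_affine R a^-1 0 (fun y => fourierL1 (u k) y - fourier f y)) ?invr_gt0//; last exact: L2_measurable.
  by rewrite normsqR muleA -EFinM invrK expr2 divfK ?gt_eqF.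
Qed.

End Fourier_L2.

(** * Parseval's identity on an interval *)

Section Parseval.
Context (R : realType).
Local Notation mu := (@lebesgue_measure R).
Implicit Types (f g h : R -> R[i]).

Let ip := inner_product_L2 R.

(** The equivalence with k = kappa x says at once that the pieces are disjoint on E and cover it. *)
Lemma integral_partition (I : countType) (E : set R) (D : I -> set R) (kappa : R -> I)
    (G : R -> \bar R) : measurable E -> (forall k, measurable (D k)) ->
  (forall x, E x -> forall k, D k x <-> k = kappa x) ->
  measurable_fun E G -> (forall x, 0 <= G x)%E ->
  (\int[mu]_(x in E) G x = \esum_(k in [set: I]) \int[mu]_(x in E `&` D k) G x)%E.
Proof.
move=> mE mD hD mG G0.
have -> : (\esum_(k in [set: I]) \int[mu]_(x in E `&` D k) G x =
    \esum_(k in [set: I]) \int[mu]_(x in E) (G \_ (D k)) x)%E.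
  by apply: eq_esum => k _; rewrite integral_mkcondr.
have r0 k x : (0 <= (G \_ (D k)) x)%E by rewrite patchE; case: ifP.
rewrite -integral_esum//; last first.
  move=> k; apply/(measurable_restrict G (mD k) mE).
  by apply: measurable_funS mG => // x [].
apply: eq_integral => x; rewrite inE => Ex.
transitivity (\esum_(k in [set kappa x]) G x)%E; first by rewrite esum_set1.
rewrite esum_mkcond; apply: eq_esum => k _; rewrite patchE.
case: ifPn; rewrite ?inE.
  by move=> kx; rewrite mem_set//; apply/(hD x Ex).
by move=> /negP kx; rewrite memNset// => /(hD x Ex) e; apply: kx; rewrite inE.
Qed.

Lemma periodization (a L : R) (G : R -> \bar R) : 0 < L ->
  measurable_fun setT G -> (forall x, 0 <= G x)%E ->
  (\int[mu]_x G x =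
   \int[mu]_(x in `[a, (a + L)%R[) \esum_(k in [set: int]) G (x + L * k%:~R)%R)%E.
Proof.
move=> L0 mG G0.
pose D (k : int) : set R := `[a + L * k%:~R, a + L * k%:~R + L[%classic.
have mD k : measurable (D k) by exact: measurable_itv.
have mGk (k : int) : measurable_fun setT (fun x : R => G (x + L * k%:~R)).
  by apply: (measurableT_comp mG); exact: measurable_funD.
have mGk' k := measurable_funTS (D := `[a, (a + L)%R[%classic) (mGk k).
rewrite integral_esum//.
rewrite (@integral_partition int setT D (fun x => Num.floor ((x - a) / L)))//.
  apply: eq_esum => k _; rewrite setTI.
  have r0 x : (0 <= (G \_ (D k)) x)%E by rewrite patchE; case: ifP.
  have mr : measurable_fun setT (G \_ (D k)).
    by apply/(measurable_restrictT G (mD k)); exact: measurable_funTS.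
  etransitivity; first exact: integral_mkcond.
  etransitivity; first exact: (esym (ge0_integral_shift (L * k%:~R) mr r0)).
  rewrite [RHS]integral_mkcond; apply: eq_integral => x _; rewrite !patchE.
  have -> // : (x + L * k%:~R \in D k) = (x \in `[a, a + L[%classic).
  by apply/idP/idP; rewrite !inE /D /= !in_itv/= => /andP[h1 h2]; apply/andP; split; lra.
move=> x _ k; rewrite /D /= in_itv/=; split.
  move=> /andP[h1 h2]; apply/esym/floor_def; rewrite intrD rmorph1.
  rewrite ler_pdivlMr// ltr_pdivrMr// mulrDl mul1r [_ * L]mulrC.
  by apply/andP; split; lra.
move=> ->; have /andP[] := floor_itv ((x - a) / L).
rewrite intrD rmorph1 ler_pdivlMr// ltr_pdivrMr//; move: (_%:~R) => q h1 h2.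
by apply/andP; split; lra.
Qed.

Let I (c : R) : set R := `[c, c + 2 * pi[%classic.

Let P2 : 0 < 2 * pi :> R. Proof. by rewrite mulr_gt0// pi_gt0. Qed.

Let mI c : measurable (I c). Proof. exact: measurable_itv. Qed.

Let muI c : mu (I c) = (2 * pi)%:E.
Proof. by rewrite lebesgue_measure_itv/= lte_fin ltrDl P2 -EFinD [c + _]addrC addrK. Qed.

Let I_fin c : (mu (I c) < +oo)%E. Proof. by rewrite muI ltry. Qed.

Let conjRM (a : R) (z : R[i]) : conjc (a%:C * z) = a%:C * conjc z.
Proof. by apply: eqcP; rewrite !cE /=; ring. Qed.

Lemma cintegral_expi_period c (m : int) : m != 0 ->
  cintegral (fun x => (\1_(I c) x)%:C * expi (m%:~R * x)) = 0.
Proof.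
move=> m0; have mR : m%:~R != 0 :> R by rewrite intr_eq0.
have per : expi (m%:~R * (c + 2 * pi)) = expi (m%:~R * c) :> R[i].
  by rewrite mulrDr expiD (_ : m%:~R * (2 * pi) = 2 * m%:~R * pi) ?expi_2pi ?mulr1//; ring.
have ftc (F f : R -> R) : continuous F -> continuous f ->
    (forall x : R, is_derive x (1 : R) F (m%:~R * f x)) ->
    F (c + 2 * pi) = F c -> (\int[mu]_(x in I c) (f x)%:E = 0)%E.
  move=> cF cf dF hF; rewrite integral_itv_bndo_bndc; last first.
    by apply/measurable_EFinP; apply: measurable_funTS; exact: continuous_measurable_fun.
  have dG (x : R) : is_derive x (1 : R) (fun x => m%:~R^-1 * F x) (f x).
    by apply: is_derive_eq; rewrite /GRing.scale/= ?mulr0 ?add0r mulrA mulVf// mul1r.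
  have cG : continuous (fun x => m%:~R^-1 * F x).
    by move=> x; apply: cvgM; [exact: cvg_cst|exact: cF].
  rewrite (@continuous_FTC2 _ f (fun x => m%:~R^-1 * F x)).
  - by rewrite hF subee.
  - by rewrite ltrDl.
  - exact: continuous_subspaceT.
  - split; first by move=> x _; exact: (@ex_derive _ _ _ _ _ _ _ (dG x)).
      by apply: cvg_at_right_filter; exact: cG.
    by apply: cvg_at_left_filter; exact: cG.
  - by move=> x _; rewrite derive1E; exact: (@derive_val _ _ _ _ _ _ _ (dG x)).
have eI (u : R -> R) : (\int[mu]_x (\1_(I c) x * u x)%:E = \int[mu]_(x in I c) (u x)%:E)%E.
  rewrite [RHS]integral_mkcond; apply: eq_integral => x _; rewrite patchE indicE.
  by case: (x \in I c); rewrite ?mul1r ?mul0r.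
apply: eqcP; rewrite /cintegral/= /Rintegral.
  under eq_integral do rewrite mul0r subr0.
  have d x : is_derive x (1 : R) (fun x => sin (m%:~R * x)) (m%:~R * cos (m%:~R * x)).
    by apply: is_derive_eq; rewrite /GRing.scale/=; ring.
  rewrite eI (ftc _ _ (@continuous_sinZ R m%:~R) (@continuous_cosZ R m%:~R) d)//.
  by case: per.
under eq_integral do rewrite mul0r addr0.
have d x : is_derive x (1 : R) (fun x => - cos (m%:~R * x)) (m%:~R * sin (m%:~R * x)).
  by apply: is_derive_eq; rewrite /GRing.scale/=; ring.
have cN : continuous (fun x : R => - cos (m%:~R * x)).
  by move=> x; apply: cvgN; exact: continuous_cosZ.
rewrite eI (ftc _ _ cN (@continuous_sinZ R m%:~R) d)//.
by case: per => ->.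
Qed.

(** Cut off to one period so as to be an element of L^2 of the line; its squared norm is 2 pi. *)
Definition trig_basis (c : R) (k : int) : R -> R[i] :=
  fun x => (\1_(I c) x)%:C * expi (k%:~R * x).

Lemma L2_trig_basis c k : L2 (trig_basis c k).
Proof.
have mk : measurable_fun setT (fun x : R => k%:~R * x) by exact: measurable_funM.
have := L2_expi mk (L2_cst_indic 1 (mI c) (I_fin c)).
by congr L2; apply/funext => x; rewrite mulr1 mulrC.
Qed.

Lemma trig_basis_orth c k l :
  cdot (trig_basis c k) (trig_basis c l) = if k == l then (2 * pi)%:C else 0.
Proof.
have -> : cdot (trig_basis c k) (trig_basis c l) =
    cintegral (fun x => (\1_(I c) x)%:C * expi ((k - l)%:~R * x)).
  congr cintegral; apply/funext => x; rewrite /trig_basis conjRM -expiN.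
  rewrite mulrACA -expiD -rmorphM -mulrBl -intrB; congr (_%:C * _).
  by rewrite indicE; case: (x \in I c); rewrite ?mulr1 ?mulr0.
case: eqP => [->|/eqP kl]; last by rewrite cintegral_expi_period// subr_eq0.
have e : (fun x => (\1_(I c) x)%:C * expi ((l - l)%:~R * x)) = fun x => (\1_(I c) x)%:C.
  by apply/funext => x; rewrite subrr mul0r expi0 mulr1.
rewrite e; apply: eqcP; rewrite /cintegral/= /Rintegral; last by rewrite integral0.
by have -> := @integral_indic _ _ _ mu setT measurableT (I c) (mI c); rewrite setIT; exact: (congr1 fine (muI c)).
Qed.

Definition supported (D : set R) f := forall x, ~ D x -> f x = 0.

Let suppE D f : supported D f -> f = fun x => (\1_D x)%:C * f x.
Proof.
move=> h; apply/funext => x; rewrite indicE; case: (boolP (x \in D)) => [_|].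
  by rewrite mul1r.
by move/negP; rewrite inE => /h ->; rewrite mulr0.
Qed.

Lemma L2_supported_cintegrable c f : L2 f -> supported (I c) f -> cintegrable f.
Proof. by move=> Lf /suppE ->; exact: L2_cintegrable. Qed.

Lemma fourierL1_cdot c f (k : int) : supported (I c) f ->
  fourierL1 f k%:~R = cdot f (trig_basis c k).
Proof.
move=> h; congr cintegral; apply/funext => x; rewrite {1}(suppE h) /trig_basis.
by rewrite conjRM -expiN -mulrA mulrCA.
Qed.

Let n0 (z : R[i]) : (0 <= (normsq z)%:E)%E. Proof. by rewrite lee_fin normsq_ge0. Qed.

Lemma bessel c f : L2 f -> supported (I c) f ->
  (\esum_(k in [set: int]) (normsq (fourierL1 f k%:~R))%:E <= (2 * pi)%:E * sqnorm setT f)%E.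
Proof.
move=> Lf h; apply: ge_ereal_sup => _ [F [finF _] <-].
rewrite fsbig_finite//= sumEFin -cdot_sqnorm// -EFinM lee_fin.
under eq_bigr do rewrite (fourierL1_cdot _ h).
exact: (ip_bessel ip P2 (L2_trig_basis c) (trig_basis_orth c) (finmap.fset_uniq _) Lf).
Qed.

Let modul f (t : R) x := f x * expi (- (t * x)).

Let mph (t : R) : measurable_fun setT (fun x : R => - (t * x)).
Proof. by apply: measurable_funN; exact: measurable_funM. Qed.

Let L2_modul f t : L2 f -> L2 (modul f t).
Proof.
by move=> Lf; have := L2_expi (mph t) Lf; congr L2; apply/funext => x; rewrite /modul mulrC.
Qed.

Let supp_modul D f t : supported D f -> supported D (modul f t).
Proof. by move=> h x /h; rewrite /modul => ->; rewrite mul0r. Qed.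

Let sqnorm_modul f t : sqnorm setT (modul f t) = sqnorm setT f.
Proof. by apply: eq_integral => x _; rewrite normsqM normsq_expi mulr1. Qed.

Let fourierL1_modul f t (s : R) : fourierL1 (modul f t) s = fourierL1 f (s + t).
Proof.
congr cintegral; apply/funext => x; rewrite /modul -mulrA -expiD; congr (_ * expi _); ring.
Qed.

(** |exp (- i t x) - 1|^2 = 2 - 2 cos (t x), which is small uniformly over the bounded interval. The
    bound e < 1 keeps [0, e) inside the interval [0, 1) over which [parseval] integrates. *)
Let expi_near1 c (eta : R) : 0 < eta -> exists2 e, 0 < e < 1 &
  forall t x, 0 <= t < e -> I c x -> normsq (expi (- (t * x)) - 1) <= eta.
Proof.
move=> eta0; have e2 : 0 < eta / 2 by rewrite divr_gt0.
have := @continuous_cos R 0 => /cvgrPdist_le/(_ _ e2)/nbhs_norm0P[/= d d0 hd].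
pose B := `|c| + 2 * pi + 1.
have B0 : 0 < B by rewrite /B; have := normr_ge0 c; have := P2; lra.
exists (Num.min (d / B) (1/2)).
  by rewrite lt_min divr_gt0//= gt_min; apply/andP; split; [|apply/orP; right]; lra.
move=> t x /andP[t0]; rewrite lt_min ltr_pdivlMr// => /andP[tB _].
rewrite /I /= in_itv/= => /andP[x1 x2].
have xB : `|x| <= B.
  rewrite ler_norml /B; have := ler_norm c; have := ler_norm (- c); rewrite normrN; have := P2.
  by move=> ? ? ?; apply/andP; split; lra.
have : `|- (t * x)| < d.
  rewrite normrN normrM (ger0_norm t0); apply: le_lt_trans tB.
  by rewrite ler_wpM2l.
move/hd; rewrite /= cos0 => h; have {h} := le_trans (ler_norm _) h.
rewrite normsqE !cE /=; have := cos2Dsin2 (- (t * x)).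
move: (cos _) (sin _) => C S; nra.
Qed.

(** The averaged equality concerns almost every translate, whereas t = 0 is wanted. The difference
    of the coefficients at k + t and k is the coefficient of f (exp (- i t x) - 1), small in L^2 for
    small t; so S 0 < C would keep S strictly below C on an interval [0, e), against its mean value
    C. *)
Lemma parseval c f : L2 f -> supported (I c) f ->
  (\esum_(k in [set: int]) (normsq (fourierL1 f k%:~R))%:E = (2 * pi)%:E * sqnorm setT f)%E.
Proof.
move=> Lf sf; have cf := L2_supported_cintegrable Lf sf.
apply/eqP; rewrite eq_le (bessel Lf sf)/=.
pose S t := (\esum_(k in [set: int]) (normsq (fourierL1 f (k%:~R + t)))%:E)%E.
have -> : (\esum_(k in [set: int]) (normsq (fourierL1 f k%:~R))%:E = S 0%R)%E.
  by apply: eq_esum => k _; rewrite addr0.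
have nf : ((2 * pi)%:E * sqnorm setT f)%E \is a fin_num.
  by rewrite fin_numM//; exact: sqnorm_fin_num.
have Sle t : (S t <= (2 * pi)%:E * sqnorm setT f)%E.
  have := bessel (L2_modul t Lf) (supp_modul t sf); rewrite sqnorm_modul.
  by under eq_esum do rewrite fourierL1_modul.
have S0 t : (0 <= S t)%E by apply: esum_ge0.
have mF := emeasurable_normsq (cmeasurable_fourierL1 cf).
have mS : measurable_fun setT S.
  apply: emeasurable_esum => // k; apply: (measurableT_comp mF).
  by apply: measurable_funD.
have intS : (\int[mu]_(t in `[0%R, 1%R[) S t = (2 * pi)%:E * sqnorm setT f)%E.
  have p := @periodization 0 1 _ ltr01 mF (fun x => n0 (fourierL1 f x)).
  rewrite -(fourierL1_sqnorm cf Lf) /sqnorm p add0r.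
  by apply: eq_integral => t _; apply: eq_esum => k _; rewrite mul1r addrC.
rewrite -(fineK nf); set C := fine _ in intS *.
have C0 : 0 <= C by rewrite fine_ge0// mule_ge0 ?sqnorm_ge0// lee_fin ltW.
rewrite -(fineK nf) in Sle intS; rewrite -/C in intS.
have {}Sle t : (S t <= C%:E)%E by exact: Sle.
have Sfin t : S t \is a fin_num by rewrite ge0_fin_numE// (le_lt_trans (Sle t))// ltry.
have key (d eta : R) : 0 < d -> 0 < eta -> C <= (1 + d) * fine (S 0) + (1 + d^-1) * (2 * pi * eta * fine (sqnorm setT f)).
  move=> d0 eta0; have [e /andP[e0 e1] he] := expi_near1 c eta0.
  set M := (X in _ <= X).
  have M0 : 0 <= M.
    rewrite addr_ge0// mulr_ge0 ?fine_ge0 ?sqnorm_ge0//; first by rewrite addr_ge0 ?(ltW d0).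
      by rewrite addr_ge0 ?invr_ge0 ?(ltW d0).
    by rewrite !mulr_ge0 ?(ltW eta0) ?fine_ge0 ?sqnorm_ge0// pi_ge0.
  have SM t : 0 <= t < e -> (S t <= M%:E)%E.
    move=> te; pose g x := f x * (expi (- (t * x)) - 1).
    have gE : g = fun x => modul f t x - f x by apply/funext => x; rewrite /g mulrBr mulr1.
    have Lg : L2 g by rewrite gE; apply: L2B => //; exact: L2_modul.
    have sg : supported (I c) g by move=> x /sf; rewrite /g => ->; rewrite mul0r.
    have gle : (sqnorm setT g <= eta%:E * sqnorm setT f)%E.
      rewrite -ge0_integralZl_EFin//; last 2 first.
      - by apply: emeasurable_normsq; exact: L2_measurable.
      - exact: ltW.
      apply: ge0_le_integral => //.
      - by apply: emeasurable_normsq; exact: L2_measurable.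
      - by apply: measurable_funeM; apply: emeasurable_normsq; exact: L2_measurable.
      move=> x _; rewrite -EFinM lee_fin /g normsqM mulrC.
      have [xI|xI] := pselect (I c x); first by rewrite ler_wpM2r ?normsq_ge0// he.
      by rewrite (sf _ xI) normsq0 !mulr0.
    have split_ (k : int) : fourierL1 f (k%:~R + t) = fourierL1 f (k%:~R + 0) + fourierL1 g k%:~R.
      rewrite addr0 -fourierL1_modul gE.
      have := fourierL1_lin (-1) cf (L2_supported_cintegrable (L2_modul t Lf) (supp_modul t sf)).
      have -> : (fun x => -1 * f x + modul f t x) = fun x => modul f t x - f x.
        by apply/funext => x; rewrite mulN1r addrC.
      by move=> ->; rewrite mulN1r addrA subrr add0r.
    apply: (@le_trans _ _ ((1 + d)%:E * S 0%R + (1 + d^-1)%:E *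
        \esum_(k in [set: int]) (normsq (fourierL1 g k%:~R))%:E)%E).
      have p1 : 0 <= 1 + d by rewrite addr_ge0// ltW.
      have p2 : 0 <= 1 + d^-1 by rewrite addr_ge0// invr_ge0 ltW.
      rewrite /S -!esumZl//.
      rewrite -esumD; last 2 first.
      - by move=> k _; rewrite mule_ge0.
      - by move=> k _; rewrite mule_ge0.
      by apply: le_esum => k _; rewrite split_ -!EFinM -EFinD lee_fin; exact: normsqD_le.
    have -> : M%:E = ((1 + d)%:E * S 0%R + (1 + d^-1)%:E * ((2 * pi * eta)%:E * sqnorm setT f))%E.
      by rewrite /M -(fineK (Sfin 0)) -(fineK (sqnorm_fin_num Lf)).
    apply: leeD2l; apply: lee_wpmul2l; first by rewrite lee_fin addr_ge0// invr_ge0 ltW.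
    apply: le_trans (bessel Lg sg) _; rewrite [(2 * pi * eta)%:E]EFinM -muleA.
    by apply: lee_wpmul2l => //; rewrite lee_fin ltW.
  (* S is at most M on [0, e) and at most C on [e, 1), while its integral is C; as e > 0, this
     forces C <= M. *)
  have : (C%:E <= (M * e + C * (1 - e))%:E)%E.
    rewrite -[leLHS]intS.
    have -> : `[0%R, 1%R[%classic = `[0%R, e[ `|` `[e, 1%R[ :> set R.
      apply/seteqP; split => x; rewrite /= !in_itv/=.
        move=> /andP[x0 x1]; case: (ltP x e) => xe; first by left; rewrite x0.
        by right.
      by case=> /andP[h1 h2]; apply/andP; split; lra.
    rewrite ge0_integral_setU//=; last 2 first.
    - exact: measurable_funTS.
    - by apply/disj_set2P; apply/seteqP; split => x //=; rewrite !in_itv/= => -[/andP[_ +] /andP[]]; lra.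
    rewrite EFinD; apply: leeD.
      apply: (@le_trans _ _ (\int[mu]_(t in `[0%R, e[) M%:E)%E).
        apply: ge0_le_integral => //; first exact: measurable_funTS.
      by rewrite integral_cst//= lebesgue_measure_itv/= lte_fin e0 oppr0 adde0.
    apply: (@le_trans _ _ (\int[mu]_(t in `[e, 1%R[) C%:E)%E).
      by apply: ge0_le_integral => //; exact: measurable_funTS.
    by rewrite integral_cst//= lebesgue_measure_itv/= lte_fin e1.
  by rewrite lee_fin; nra.
rewrite -(fineK (Sfin 0)) lee_fin; set s := fine (S 0) in key *; set F := fine (sqnorm _ _) in key.
have s0 : 0 <= s by rewrite fine_ge0.
have F0 : 0 <= F by rewrite fine_ge0// sqnorm_ge0.
rewrite leNgt; apply/negP => sC.
(* d and eta make the two errors at most (C - s) / 2 and (C - s) / 4, together less than the gap C -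
   s. *)
pose d := (C - s) / (2 * (s + 1)).
have d0 : 0 < d by rewrite divr_gt0 ?subr_gt0// mulr_gt0//; lra.
have ds : d * s <= (C - s) / 2.
  rewrite /d -mulrA ler_wpM2l ?subr_ge0 ?(ltW sC)// mulrC ler_pdivrMr ?mulr_gt0//; lra.
pose K := (1 + d^-1) * (2 * pi * (F + 1)).
have K0 : 0 < K.
  have F1 : 0 < F + 1 by lra.
  have di : 0 < 1 + d^-1 by rewrite ltr_pwDl// invr_ge0 ltW.
  by rewrite mulr_gt0// mulr_gt0.
pose eta := (C - s) / (4 * K).
have eta0 : 0 < eta by rewrite divr_gt0 ?subr_gt0// mulr_gt0.
have := key d eta d0 eta0.
have : (1 + d^-1) * (2 * pi * eta * F) <= (C - s) / 4.
  have -> : (C - s) / 4 = K * eta by rewrite /eta; field; rewrite gt_eqF.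
  have -> : (1 + d^-1) * (2 * pi * eta * F) = (1 + d^-1) * (2 * pi) * F * eta by ring.
  rewrite /K ler_wpM2r ?(ltW eta0)// !mulrA ler_wpM2l; [by []| |lra].
  by rewrite !mulr_ge0 ?pi_ge0 ?addr_ge0 ?invr_ge0 ?(ltW d0).
by lra.
Qed.

(** Induction with d = 1 / L in [normsqD_le]: (1 + 1 / L) L and 1 + L are both L + 1. *)
Lemma normsq_sum_le (L : nat) (z : 'I_L -> R[i]) :
  normsq (\sum_(l < L) z l) <= L%:R * \sum_(l < L) normsq (z l).
Proof.
elim: L z => [|[|L] IH] z; first by rewrite !big_ord0 normsq0 mulr0.
  by rewrite !big_ord_recr !big_ord0 /= !add0r mul1r.
have L0 : (0 < L.+1)%N by []. move: L0 IH z; move: L.+1 => {}L L0 IH z; rewrite !big_ord_recr /=.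
have LR : 0 < L%:R :> R by rewrite ltr0n.
have Li : 0 < L%:R^-1 :> R by rewrite invr_gt0.
apply: le_trans (normsqD_le _ _ Li) _; rewrite invrK mulrDr -natr1 [1 + L%:R]addrC lerD2r.
apply: le_trans (ler_wpM2l _ (IH _)) _; first by rewrite addr_ge0// ltW.
by rewrite mulrA mulrDl mul1r mulVf ?gt_eqF.
Qed.

(** The interval is cut into L periods, on each of which Bessel's inequality applies; adding the L
    coefficients costs the factor L. *)
Lemma bessel_long c (L : nat) f : L2 f -> supported `[c, c + L%:R * (2 * pi)[%classic f ->
  (\esum_(k in [set: int]) (normsq (fourierL1 f k%:~R))%:E <=
   (L%:R * (2 * pi))%:E * sqnorm setT f)%E.
Proof.
move=> Lf sf; pose D (l : 'I_L) := I (c + l%:R * (2 * pi)).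
pose fl l x := (\1_(D l) x)%:C * f x.
have Lfl l : L2 (fl l) by apply: L2_indic => //; exact: mI.
have sfl l : supported (D l) (fl l) by move=> x xD; rewrite /fl indicE memNset// mul0r.
have unique_l x : f x != 0 -> exists l, forall l', D l' x <-> l' = l.
  move=> fx; have : `[c, c + L%:R * (2 * pi)[%classic x.
    by apply: contrapT => /sf h; rewrite h eqxx in fx.
  rewrite /= in_itv/= => /andP[x1 x2].
  have y0 : 0 <= (x - c) / (2 * pi) by rewrite divr_ge0 ?subr_ge0// ltW.
  have yL : (Num.truncn ((x - c) / (2 * pi)) < L)%N.
    rewrite -(ltr_nat R); apply: (@le_lt_trans _ _ ((x - c) / (2 * pi))); first by rewrite truncn_le.
    by rewrite ltr_pdivrMr//; lra.
  have /andP[] := truncn_itv y0; rewrite ler_pdivlMr// ltr_pdivrMr// => t1 t2.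
  exists (Ordinal yL) => l'; rewrite /D /I /= in_itv/=; split.
    move=> /andP[h1 h2]; apply/val_inj => /=; apply/esym/truncn_def.
    by rewrite ler_pdivlMr// ltr_pdivrMr// -natr1 mulrDl mul1r; apply/andP; split; lra.
  move=> -> /=; rewrite -natr1 mulrDl mul1r in t2.
  by apply/andP; split; lra.
have fE : f = fun x => \sum_(l < L) fl l x.
  apply/funext => x; have [fx|fx] := eqVneq (f x) 0.
    by rewrite big1// => l _; rewrite /fl fx mulr0.
  have [l hl] := unique_l x fx; rewrite (bigD1 l)//= big1 ?addr0.
    by rewrite /fl indicE mem_set ?mul1r//; exact/hl.
  by move=> l' /eqP ll'; rewrite /fl indicE memNset ?mul0r// => /hl.
have cfl l : cintegrable (fl l) by exact: (L2_supported_cintegrable (Lfl l) (sfl l)).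
have FE (k : int) : fourierL1 f k%:~R = \sum_(l < L) fourierL1 (fl l) k%:~R.
  have : forall s : seq 'I_L, cintegrable (fun x => \sum_(l <- s) fl l x) /\
      fourierL1 (fun x => \sum_(l <- s) fl l x) k%:~R = \sum_(l <- s) fourierL1 (fl l) k%:~R.
    elim=> [|l s [IH1 IH2]].
      have e : (fun x => \sum_(l <- [::]) fl l x) = fun=> 0 by apply/funext => x; rewrite big_nil.
      rewrite e big_nil; split; first by split; exact: integrable0.
      apply: eqcP; rewrite /fourierL1 /cintegral/= /Rintegral.
        by under eq_integral do rewrite !mul0r subr0; rewrite integral0.
      by under eq_integral do rewrite !mul0r addr0; rewrite integral0.
    have e : (fun x => \sum_(l' <- l :: s) fl l' x) = fun x => 1 * fl l x + \sum_(l' <- s) fl l' x.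
      by apply/funext => x; rewrite big_cons mul1r.
    rewrite e (fourierL1_lin 1 (cfl l) IH1) mul1r IH2 big_cons; split => //.
    by apply: cintegrableD => //; exact: cintegrableZ.
  by move=> /(_ (index_enum 'I_L))[_ <-]; rewrite {1}fE.
have nE : sqnorm setT f = (\sum_(l < L) sqnorm setT (fl l))%E.
  rewrite /sqnorm -ge0_integral_sum//; last first.
    by move=> l; apply: emeasurable_normsq; exact: L2_measurable.
  apply: eq_integral => x _; rewrite sumEFin; congr EFin.
  have [fx|fx] := eqVneq (f x) 0.
    by rewrite fx normsq0 big1// => l _; rewrite /fl fx mulr0 normsq0.
  have [l hl] := unique_l x fx; rewrite (bigD1 l)//= big1 ?addr0.
    by rewrite /fl indicE mem_set ?mul1r//; exact/hl.
  by move=> l' /eqP ll'; rewrite /fl indicE memNset ?mul0r ?normsq0// => /hl.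
apply: (@le_trans _ _ (L%:R%:E * \sum_(l < L) \esum_(k in [set: int]) (normsq (fourierL1 (fl l) k%:~R))%:E)%E).
  rewrite -esum_sum// -esumZl//; last by move=> k; apply: sume_ge0.
  apply: le_esum => k _; rewrite FE sumEFin -EFinM lee_fin; exact: normsq_sum_le.
rewrite EFinM -muleA nE; apply: lee_wpmul2l; first by rewrite lee_fin.
rewrite ge0_sume_distrr; last by move=> l _; exact: sqnorm_ge0.
by apply: lee_sum => l _; exact: (bessel (Lfl l) (sfl l)).
Qed.

End Parseval.

(** * Subspaces of sequences and the trace *)

Section Sequence_space.
Context (R : realType) (n : nat).
Local Notation X := (int * 'I_n)%type.
Implicit Types (h g : X -> R) (a b : zseq R n).

Let S h : \bar R := (\esum_(q in [set: X]) (h q)%:E)%E.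

Let S_ge0 h : (forall q, 0 <= h q) -> (0 <= S h)%E.
Proof. by move=> h0; apply: esum_ge0 => q _; rewrite lee_fin. Qed.

Let SD h g : (forall q, 0 <= h q) -> (forall q, 0 <= g q) ->
  S (fun q => h q + g q)%R = (S h + S g)%E.
Proof. by move=> h0 g0; rewrite /S -esumD// => q _; rewrite lee_fin. Qed.

Let SZ (c : R) h : 0 <= c -> (forall q, 0 <= h q) -> S (fun q => c * h q)%R = (c%:E * S h)%E.
Proof. by move=> c0 h0; rewrite /S -esumZl// => q; rewrite lee_fin. Qed.

Let S_le h g : (forall q, h q <= g q) -> (S h <= S g)%E.
Proof. by move=> hg; apply: le_esum => q _; rewrite lee_fin. Qed.

Lemma esum_single (I : choiceType) (i : I) (c : \bar R) : (0 <= c)%E ->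
  (\esum_(j in [set: I]) (if j == i then c else 0) = c)%E.
Proof.
move=> c0; rewrite -[RHS](@esum_set1 R I i (fun=> c))// [RHS]esum_mkcond.
apply: eq_esum => j _; have [->|ji] := eqVneq j i; first by rewrite mem_set.
by rewrite memNset// => /eqP; rewrite (negbTE ji).
Qed.

Definition abs_summable h : Prop := (S (fun q => `|h q|)%R < +oo)%E.

Lemma rsumE h : rsum h =
  fine (S (fun q => Num.max (h q) 0)%R - S (fun q => Num.max (- h q) 0)%R)%E.
Proof.
rewrite /rsum; congr (fine (_ - _)); apply: eq_esum => q _.
  by rewrite funeposE/= -EFin_max.
by rewrite funenegE/= EFin_max.
Qed.

Let S_fin h g : abs_summable g -> (forall q, 0 <= h q) -> (forall q, h q <= `|g q|) ->
  S h \is a fin_num.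
Proof.
move=> sg h0 hg; rewrite ge0_fin_numE ?S_ge0//; exact: le_lt_trans (S_le hg) sg.
Qed.

(** [rsum] is defined by positive and negative parts, but any expression as a difference of summable
    nonnegative families computes it; linearity follows without a discussion of signs. *)
Lemma rsumB h g : (forall q, 0 <= h q) -> (forall q, 0 <= g q) ->
  (S h < +oo)%E -> (S g < +oo)%E ->
  rsum (fun q => h q - g q) = fine (S h) - fine (S g).
Proof.
move=> h0 g0 sh sg.
have fh : S h \is a fin_num by rewrite ge0_fin_numE ?S_ge0.
have fg : S g \is a fin_num by rewrite ge0_fin_numE ?S_ge0.
rewrite rsumE; set p := fun q => Num.max _ 0; set m := fun q => Num.max (- _) 0.
have p0 q : 0 <= p q by rewrite le_max lexx orbT.
have m0 q : 0 <= m q by rewrite le_max lexx orbT.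
have ph q : p q <= h q by rewrite /p ge_max h0 lerBlDr lerDl g0.
have mg q : m q <= g q by rewrite /m ge_max g0 opprB lerBlDr lerDl h0.
have fp : S p \is a fin_num.
  by rewrite ge0_fin_numE ?S_ge0//; exact: le_lt_trans (S_le ph) sh.
have fm : S m \is a fin_num.
  by rewrite ge0_fin_numE ?S_ge0//; exact: le_lt_trans (S_le mg) sg.
have : (S p + S g = S m + S h)%E.
  rewrite -!SD//; congr S; apply/funext => q; rewrite /p /m opprB.
  by case: (leP (h q - g q) 0); case: (leP (g q - h q) 0); lra.
rewrite -(fineK fp) -(fineK fm) -(fineK fh) -(fineK fg) -!EFinD => -[e].
by rewrite /=; lra.
Qed.

Let pos h q := Num.max (h q) 0.
Let neg h q := Num.max (- h q) 0.
Let pos0 h q : 0 <= pos h q. Proof. by rewrite le_max lexx orbT. Qed.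
Let neg0 h q : 0 <= neg h q. Proof. by rewrite le_max lexx orbT. Qed.
Let posneg h q : h q = pos h q - neg h q.
Proof. by rewrite /pos /neg; case: (leP (h q) 0); case: (leP (- h q) 0); lra. Qed.
Let pos_le h q : pos h q <= `|h q|.
Proof. by rewrite /pos ge_max ler_norm normr_ge0. Qed.
Let neg_le h q : neg h q <= `|h q|.
Proof. by rewrite /neg ge_max -normrN ler_norm normr_ge0. Qed.

Let rsum_pn h : abs_summable h -> rsum h = fine (S (pos h)) - fine (S (neg h)).
Proof.
move=> sh; rewrite {1}(_ : h = fun q => pos h q - neg h q); last by apply/funext => q; exact: posneg.
by apply: rsumB => //; apply: le_lt_trans sh; apply: S_le.
Qed.

Lemma abs_summableD h g : abs_summable h -> abs_summable g -> abs_summable (fun q => h q + g q).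
Proof.
move=> sh sg; apply: (@le_lt_trans _ _ (S (fun q => `|h q| + `|g q|)%R)).
  by apply: S_le => q; exact: ler_normD.
by rewrite SD// lte_add_pinfty.
Qed.

Lemma abs_summableZ (c : R) h : abs_summable h -> abs_summable (fun q => c * h q).
Proof.
move=> sh; rewrite /abs_summable.
have -> : (fun q => `|c * h q|) = fun q => `|c| * `|h q| by apply/funext => q; rewrite normrM.
by rewrite SZ// lte_mul_pinfty.
Qed.

Lemma rsumD h g : abs_summable h -> abs_summable g ->
  rsum (fun q => h q + g q) = rsum h + rsum g.
Proof.
move=> sh sg; rewrite (rsum_pn sh) (rsum_pn sg).
have f1 := S_fin sh (pos0 h) (pos_le h); have f2 := S_fin sh (neg0 h) (neg_le h).
have f3 := S_fin sg (pos0 g) (pos_le g); have f4 := S_fin sg (neg0 g) (neg_le g).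
have -> : (fun q => h q + g q) = fun q => (pos h q + pos g q) - (neg h q + neg g q).
  by apply/funext => q; rewrite {1}(posneg h) {1}(posneg g); ring.
rewrite rsumB.
- by rewrite !SD// !fineD//; ring.
- by move=> q; rewrite addr_ge0.
- by move=> q; rewrite addr_ge0.
- by rewrite SD// lte_add_pinfty// ltey_eq ?f1 ?f3.
- by rewrite SD// lte_add_pinfty// ltey_eq ?f2 ?f4.
Qed.

Lemma rsumN h : abs_summable h -> rsum (fun q => - h q) = - rsum h.
Proof.
move=> sh; rewrite (rsum_pn sh).
have f1 := S_fin sh (pos0 h) (pos_le h); have f2 := S_fin sh (neg0 h) (neg_le h).
have -> : (fun q => - h q) = fun q => neg h q - pos h q.
  by apply/funext => q; rewrite {1}(posneg h); ring.
by rewrite rsumB// ?opprB// ltey_eq ?f1 ?f2.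
Qed.

Lemma rsumZ (c : R) h : abs_summable h -> rsum (fun q => c * h q) = c * rsum h.
Proof.
have key (d : R) : 0 <= d -> abs_summable h -> rsum (fun q => d * h q) = d * rsum h.
  move=> d0 sh; rewrite (rsum_pn sh).
  have f1 := S_fin sh (pos0 h) (pos_le h); have f2 := S_fin sh (neg0 h) (neg_le h).
  have -> : (fun q => d * h q) = fun q => d * pos h q - d * neg h q.
    by apply/funext => q; rewrite {1}(posneg h); ring.
  rewrite rsumB.
  - by rewrite !SZ// !fineM//= mulrBr.
  - by move=> q; rewrite mulr_ge0.
  - by move=> q; rewrite mulr_ge0.
  - by rewrite SZ// lte_mul_pinfty// ltey_eq ?f1 ?f2.
  - by rewrite SZ// lte_mul_pinfty// ltey_eq ?f1 ?f2.
move=> sh; have [c0|c0] := leP 0 c; first exact: key.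
have nc0 : 0 <= - c by rewrite oppr_ge0 ltW.
have := key _ nc0 sh; have := rsumN (abs_summableZ (- c) sh).
have -> : (fun q => - (- c * h q)) = fun q => c * h q by apply/funext => q; ring.
by move=> -> ->; ring.
Qed.

Lemma rsum_ge0E h : (forall q, 0 <= h q) -> (S h < +oo)%E -> (rsum h)%:E = S h.
Proof.
move=> h0 sh; have z0 : S (fun=> 0) = 0%E by rewrite /S esum1.
have := @rsumB h (fun=> 0) h0 (fun _ => lexx 0) sh; rewrite z0 => /(_ (ltry _)).
have -> : (fun q => h q - 0) = h by apply/funext => q; rewrite subr0.
by move=> ->; rewrite subr0 fineK// ge0_fin_numE// S_ge0.
Qed.

Lemma rsum_single (q0 : X) (v : R) : rsum (fun q : X => if q == q0 then v else 0) = v.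
Proof.
have S1 (w : R) : 0 <= w -> S (fun q => if q == q0 then w else 0)%R = w%:E.
  move=> w0; rewrite -[RHS](@esum_single _ q0)//.
  by apply: eq_esum => q _; case: eqP.
rewrite rsumE.
have -> : (fun q => Num.max (if q == q0 then v else 0) 0) =
    fun q => if q == q0 then Num.max v 0 else 0.
  by apply/funext => q; case: eqP => // _; rewrite maxxx.
have -> : (fun q => Num.max (- (if q == q0 then v else 0)) 0) =
    fun q => if q == q0 then Num.max (- v) 0 else 0.
  by apply/funext => q; case: eqP => // _; rewrite oppr0 maxxx.
rewrite !S1 ?le_max ?lexx ?orbT//=.
by case: (leP v 0); case: (leP (- v) 0); lra.
Qed.

Lemma l2sqnorm_ge0 a : (0 <= l2sqnorm a)%E.
Proof. by apply: esum_ge0 => q _; rewrite lee_fin normsq_ge0. Qed.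

Lemma l2_0 : l2 (fun _ : X => 0 : R[i]).
Proof. by rewrite /l2 /l2sqnorm esum1// => q _; rewrite normsq0. Qed.

Lemma l2sqnormZ (c : R[i]) a : l2sqnorm (fun q => c * a q)%R = ((normsq c)%:E * l2sqnorm a)%E.
Proof.
rewrite /l2sqnorm -esumZl ?normsq_ge0//; last by move=> q; rewrite lee_fin normsq_ge0.
by apply: eq_esum => q _; rewrite normsqM.
Qed.

Lemma l2_lin (c : R[i]) a b : l2 a -> l2 b -> l2 (fun q => c * a q + b q).
Proof.
move=> la lb; apply: (@le_lt_trans _ _ (2%:E * l2sqnorm (fun q => c * a q)%R + 2%:E * l2sqnorm b)%E).
  rewrite -SZ ?normsq_ge0//; last by move=> q; rewrite normsq_ge0.
  rewrite -[X in (_ + X)%E]SZ//; last by move=> q; rewrite normsq_ge0.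
  rewrite -SD; [|by move=> q; rewrite mulr_ge0 ?normsq_ge0..].
  by apply: S_le => q; exact: normsqD_le2.
by rewrite l2sqnormZ lte_add_pinfty// lte_mul_pinfty ?lee_fin ?normsq_ge0 ?lte_mul_pinfty ?lee_fin ?normsq_ge0.
Qed.

Let summ a b (r : X -> R) : l2 a -> l2 b -> (forall q, r q ^+ 2 <= normsq (a q * conjc (b q))) ->
  abs_summable r.
Proof.
move=> la lb h; apply: (@le_lt_trans _ _ (S (fun q => normsq (a q) + normsq (b q))%R)).
  apply: S_le => q; have := h q; rewrite normsqM normsqJ => {}h.
  have n1 := normsq_ge0 (a q); have n2 := normsq_ge0 (b q).
  rewrite -(@ler_pXn2r _ 2)// ?nnegrE ?addr_ge0 ?normsq_ge0// real_normK ?num_real//.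
  move: h n1 n2; move: (normsq _) (normsq _) => s t; nra.
by rewrite SD ?lte_add_pinfty// => q; rewrite normsq_ge0.
Qed.

Lemma summable_Re_dot a b : l2 a -> l2 b -> abs_summable (fun q => Re (a q * conjc (b q))).
Proof. by move=> la lb; apply: (summ la lb) => q; exact: Re_sqr_le. Qed.

Lemma summable_Im_dot a b : l2 a -> l2 b -> abs_summable (fun q => Im (a q * conjc (b q))).
Proof. by move=> la lb; apply: (summ la lb) => q; exact: Im_sqr_le. Qed.

Lemma l2dot_sqnorm a : l2 a -> (Re (l2dot a a))%:E = l2sqnorm a.
Proof.
move=> la; rewrite /l2dot/=.
have -> : (fun q => Re (a q * conjc (a q))) = fun q => normsq (a q).
  by apply/funext => q; rewrite mulJ.
by rewrite rsum_ge0E// => q; rewrite normsq_ge0.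
Qed.

Lemma inner_product_l2 : inner_product (@l2 R n) (@l2dot R n).
Proof.
split; [exact: l2_0|exact: l2_lin| | |].
- move=> c f g h lf lg lh.
  have r1 := summable_Re_dot lf lh; have i1 := summable_Im_dot lf lh.
  have r2 := summable_Re_dot lg lh; have i2 := summable_Im_dot lg lh.
  apply: eqcP; rewrite !cE /l2dot /=.
    have -> : (fun q => Re ((c * f q + g q) * conjc (h q))) =
      fun q => (Re c * Re (f q * conjc (h q)) + (- Im c) * Im (f q * conjc (h q))) + Re (g q * conjc (h q)).
      by apply/funext => q; rewrite mulrDl -mulrA cReD (cReM c); ring.
    rewrite rsumD//; last by apply: abs_summableD; exact: abs_summableZ.
    by rewrite rsumD ?rsumZ//; [ring|exact: abs_summableZ..].
  have -> : (fun q => Im ((c * f q + g q) * conjc (h q))) =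
      fun q => (Re c * Im (f q * conjc (h q)) + Im c * Re (f q * conjc (h q))) + Im (g q * conjc (h q)).
    by apply/funext => q; rewrite mulrDl -mulrA cImD (cImM c); ring.
  rewrite rsumD//; last by apply: abs_summableD; exact: abs_summableZ.
  by rewrite rsumD ?rsumZ//; exact: abs_summableZ.
- move=> f g lf lg; apply: eqcP; rewrite !cE /l2dot /=.
    by congr rsum; apply/funext => q; rewrite !cE; ring.
  rewrite -rsumN; last exact: summable_Im_dot.
  by congr rsum; apply/funext => q; rewrite !cE; ring.
- by move=> f lf; rewrite -lee_fin l2dot_sqnorm// l2sqnorm_ge0.
Qed.

Definition unit_seq (q0 : X) : zseq R n := fun q => (q == q0)%:R.

Lemma l2_unit_seq q : l2 (unit_seq q).
Proof.
rewrite /l2 /l2sqnorm (_ : esum _ _ = 1%E) ?ltry// -(@esum_single _ q 1%E)//.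
by apply: eq_esum => q' _; rewrite /unit_seq; case: eqP; rewrite ?normsq1 ?normsq0.
Qed.

Lemma l2dot_unit_seq a q : l2dot a (unit_seq q) = a q.
Proof.
apply: eqcP; rewrite /l2dot/=.
  rewrite -[RHS](rsum_single q); congr rsum; apply/funext => q'.
  by rewrite /unit_seq; case: eqP => [->|_]; rewrite ?conjc1 ?conjc0 ?mulr1 ?mulr0.
rewrite -[RHS](rsum_single q); congr rsum; apply/funext => q'.
by rewrite /unit_seq; case: eqP => [->|_]; rewrite ?conjc1 ?conjc0 ?mulr1 ?mulr0.
Qed.

Let ip := inner_product_l2.

Section Dimension.
Context (M : set (zseq R n)) (P : zseq R n -> zseq R n).
Context (cM : closed_subspace M) (pP : orth_proj M P).

Lemma subspace_l2 a : M a -> l2 a. Proof. by case: cM => h _ _ _ /h. Qed.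

Lemma proj_in a : l2 a -> M (P a). Proof. by move=> /pP[]. Qed.

Let lP a : l2 a -> l2 (P a). Proof. by move=> /proj_in /subspace_l2. Qed.

Lemma proj_dot a b : l2 a -> M b -> l2dot (P a) b = l2dot a b.
Proof.
move=> la Mb; have [_ /(_ b Mb)] := pP la; have lb := subspace_l2 Mb.
by rewrite (ip_dotBl ip la (lP la) lb) => /eqP; rewrite subr_eq0 => /eqP.
Qed.

(** A squared norm, hence a nonnegative extended real ready for [esum]; [proj_diagE] identifies it
    with the diagonal entry of P. *)
Definition proj_diag (q : X) : \bar R := l2sqnorm (P (unit_seq q)).

Lemma proj_diagE q : proj_diag q = (Re (P (unit_seq q) q))%:E.
Proof.
have ld := l2_unit_seq q; have lPd := lP ld; rewrite /proj_diag -l2dot_sqnorm//.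
by rewrite (proj_dot ld (proj_in ld)) (ip_dotC ip lPd ld) l2dot_unit_seq cReJ.
Qed.

Lemma sub_lin_combo d (e : 'I_d -> zseq R n) (s : seq 'I_d) (c : 'I_d -> R[i]) :
  (forall l, M (e l)) -> M (fun q => \sum_(l <- s) c l * e l q).
Proof.
case: cM => _ M0 Mlin _ Me; elim: s => [|l s IH].
  by have := M0; congr M; apply/funext => q; rewrite big_nil.
by have := Mlin (c l) _ _ (Me l) IH; congr M; apply/funext => q; rewrite big_cons.
Qed.

Definition orthonormal_in d (e : 'I_d -> zseq R n) : Prop :=
  (forall l, M (e l)) /\ forall k l, l2dot (e k) (e l) = if k == l then (1 : R)%:C else 0.

Let le_e d (e : 'I_d -> zseq R n) : orthonormal_in e -> forall l, l2 (e l).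
Proof. by move=> [Me _] l; exact: subspace_l2. Qed.

Lemma orthonormal_indep d (e : 'I_d -> zseq R n) : orthonormal_in e -> lin_indep e.
Proof.
move=> oe c h l; have le := le_e oe.
have := ip_dotsuml ip (index_enum 'I_d) c le (le l).
have -> : (fun q => \sum_(i <- index_enum 'I_d) c i * e i q) = fun=> 0.
  by apply/funext => q; exact: h.
rewrite (ip_dot0l ip (le l)) (bigD1 l)//= (proj2 oe) eqxx big1 ?addr0 ?mulr1//.
by move=> j jl; rewrite (proj2 oe) (negbTE jl) mulr0.
Qed.

Let sum_norm d (e : 'I_d -> zseq R n) : orthonormal_in e ->
  (\esum_(q in [set: X]) (\sum_(l < d) normsq (e l q))%:E = d%:R%:E)%E.
Proof.
move=> oe; have le := le_e oe.
under eq_esum do rewrite -sumEFin.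
rewrite esum_sum; last by move=> q l _ _; rewrite lee_fin normsq_ge0.
rewrite (eq_bigr (fun=> 1%E)); last first.
  move=> l _; have := l2dot_sqnorm (le l); rewrite (proj2 oe) eqxx.
  by rewrite /l2sqnorm => <-.
by rewrite sumEFin sumr_const card_ord.
Qed.

Let dot_e d (e : 'I_d -> zseq R n) q l : orthonormal_in e ->
  l2dot (P (unit_seq q)) (e l) = conjc (e l q).
Proof.
move=> oe; have le := le_e oe; rewrite proj_dot; [|exact: l2_unit_seq|by case: oe].
by rewrite (ip_dotC ip (le l) (l2_unit_seq q)) l2dot_unit_seq.
Qed.

Let proj_diag_bessel d (e : 'I_d -> zseq R n) q : orthonormal_in e ->
  ((\sum_(l < d) normsq (e l q))%:E <= proj_diag q)%E.
Proof.
move=> oe; have le := le_e oe; have lPd := lP (l2_unit_seq q).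
have := ip_bessel ip ltr01 le (proj2 oe) (index_enum_uniq _) lPd.
rewrite -lee_fin mul1r l2dot_sqnorm//; apply: le_trans; rewrite lee_fin.
by apply: ler_sum => l _; rewrite dot_e// normsqJ.
Qed.

Let size_le d (e : 'I_d -> zseq R n) : orthonormal_in e ->
  (d%:R%:E <= \esum_(q in [set: X]) proj_diag q)%E.
Proof. by move=> oe; rewrite -(sum_norm oe); apply: le_esum => q _; exact: proj_diag_bessel. Qed.

(** If the remainder of a after subtracting its components were nonzero, it could be normalized and
    appended to the family. *)
Let maximal_spans d (e : 'I_d -> zseq R n) : orthonormal_in e ->
  (forall e' : 'I_d.+1 -> zseq R n, ~ orthonormal_in e') ->
  forall a, M a -> a = fun q => \sum_(l < d) l2dot a (e l) * e l q.
Proof.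
move=> oe hmax a Ma; have le := le_e oe; have la := subspace_l2 Ma.
pose g := fun q => \sum_(l < d) l2dot a (e l) * e l q.
have Mg : M g by apply: sub_lin_combo; case: oe.
have lg := subspace_l2 Mg.
pose r := fun q => a q - g q.
have Mr : M r.
  case: cM => _ _ Mlin _; have := Mlin (-1) _ _ Mg Ma; congr M.
  by apply/funext => q; rewrite /r mulN1r addrC.
have lr := subspace_l2 Mr.
have re l : l2dot r (e l) = 0.
  rewrite (ip_dotBl ip la lg (le l)) (ip_dotsuml ip _ _ le (le l)) (bigD1 l)//= (proj2 oe).
  rewrite eqxx big1 ?addr0 ?mulr1 ?subrr// => j jl.
  by rewrite (proj2 oe) (negbTE jl) mulr0.
have er l : l2dot (e l) r = 0 by rewrite (ip_dotC ip lr (le l)) re conjc0.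
set s := Re (l2dot r r).
have s0 : 0 <= s by exact: (ip_ge0 ip lr).
have rE : l2dot r r = s%:C by exact: (ip_nnE ip lr).
have {}s0 : s = 0.
  apply/eqP/negP => /negP sn0.
  have sp : 0 < Num.sqrt s by rewrite sqrtr_gt0 lt_neqAle eq_sym sn0.
  pose u := fun q => ((Num.sqrt s)^-1)%:C * r q.
  have Mu : M u.
    case: cM => _ M0 Mlin _; have := Mlin ((Num.sqrt s)^-1)%:C _ _ Mr M0; congr M.
    by apply/funext => q; rewrite addr0.
  (* [unlift ord_max] is [None] exactly at the last index, where u is placed. *)
  apply: (hmax (fun i => oapp e u (unlift ord_max i))); split.
    by move=> i; case: unliftP => [j _|_] //=; case: oe.
  move=> i j; case: unliftP => [k ->|->]; case: unliftP => [l ->|->] /=.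
  - by rewrite (proj2 oe) (inj_eq lift_inj).
  - by rewrite (ip_dotZr ip _ (le k) lr) er mulr0 eq_sym (negbTE (neq_lift _ _)).
  - by rewrite (ip_dotZl ip _ lr (le l)) re mulr0 (negbTE (neq_lift _ _)).
  - rewrite eqxx (ip_dotZl ip _ lr (subspace_l2 Mu)) (ip_dotZr ip _ lr lr) rE conjc_real.
    rewrite -!rmorphM/=; congr (_%:C); rewrite -{3}(@sqr_sqrtr _ s) ?ltW//; last first.
      by rewrite -sqrtr_gt0.
    by rewrite expr2 mulKf ?gt_eqF// mulVf ?gt_eqF.
have : l2sqnorm r = 0%E by rewrite -l2dot_sqnorm// -/s s0.
move=> hr; apply/funext => q; apply/eqP; rewrite -subr_eq0; apply/eqP; apply: normsq_eq0.
apply/eqP; rewrite eq_le normsq_ge0 andbT -lee_fin; apply: (@le_trans _ _ (l2sqnorm r)); last by rewrite hr.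
rewrite -[leLHS](@esum_single _ q); last by rewrite lee_fin normsq_ge0.
by apply: le_esum => q' _; case: eqP => [->|_] //; rewrite lee_fin normsq_ge0.
Qed.

(** Independence of v makes the coefficient matrix row free, and its rank is at most the number d of
    columns. *)
Lemma indep_in_span (d d' : nat) (e : 'I_d -> zseq R n) (v : 'I_d' -> zseq R n)
    (C : 'I_d' -> 'I_d -> R[i]) :
  lin_indep v -> (forall k, v k = fun q => \sum_(l < d) C k l * e l q) -> (d' <= d)%N.
Proof.
move=> iv hv; pose A := (\matrix_(k < d', l < d) C k l)%R.
have fA : row_free A.
  apply: inj_row_free => w wA; apply/rowP => k; rewrite mxE.
  apply: (iv (fun k => w 0 k)) => q.
  have -> : \sum_(k < d') w 0 k * v k q = \sum_(l < d) (w *m A) 0 l * e l q.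
    under eq_bigr do rewrite hv mulr_sumr.
    rewrite exchange_big/=; apply: eq_bigr => l _; rewrite mxE mulr_suml.
    by apply: eq_bigr => k' _; rewrite mxE mulrA.
  by rewrite wA big1// => l _; rewrite mxE mul0r.
by rewrite -(eqP fA) rank_leq_col.
Qed.

(** Orthonormal families of unbounded size make both sides infinite, on the right by Bessel's
    inequality. Otherwise one of largest size d spans M; Bessel's inequality for the P delta_q is
    then an equality, and summing the squared entries of the family over q gives d. *)
Theorem subspace_dim_trace : subspace_dim M = \esum_(q in [set: X]) proj_diag q.
Proof.
pose ON d := `[< exists e : 'I_d -> zseq R n, orthonormal_in e >].
have dim_ge d : ON d -> (d%:R%:E <= subspace_dim M)%E.
  move=> /asboolP[e oe]; apply: ereal_sup_ubound; exists d => //; exists e.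
  by split; [case: oe|exact: orthonormal_indep].
have [[K hK]|unb] := pselect (exists K, forall d, ON d -> (d <= K)%N); last first.
  have big K : exists2 d, ON d & (K < d)%N.
    apply: contrapT => h; apply: unb; exists K => d hd; rewrite leqNgt; apply/negP => Kd.
    by apply: h; exists d.
  have toinf (x : \bar R) : (forall d, ON d -> (d%:R%:E <= x)%E) -> x = +oo%E.
    case: x => [x| |] // h; last by have [d /h] := big 0%N.
    have [d /h + Kd] := big (Num.truncn x).+1; rewrite lee_fin leNgt => /negP[].
    apply: lt_le_trans (truncnS_gt x) _; by rewrite ler_nat ltnW.
  rewrite (toinf _ dim_ge) (toinf (esum _ _))// => d /asboolP[e]; exact: size_le.
have ON0 : ON 0%N.
  apply/asboolP; exists (fun _ => fun=> 0); split; by case.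
have [d /asboolP[e oe] dmax] := ex_maxnP (ex_intro _ 0%N ON0) hK.
have le := le_e oe.
have hmax (e' : 'I_d.+1 -> zseq R n) : ~ orthonormal_in e'.
  move=> oe'; have ON' : ON d.+1 by apply/asboolP; exists e'.
  by have := dmax _ ON'; rewrite ltnn.
have sp := maximal_spans oe hmax.
have -> : (\esum_(q in [set: X]) proj_diag q = d%:R%:E)%E.
  rewrite -(sum_norm oe); apply: eq_esum => q _; apply/eqP; rewrite eq_le.
  rewrite proj_diag_bessel// andbT.
  have lPd := lP (l2_unit_seq q).
  rewrite /proj_diag -l2dot_sqnorm// lee_fin {1}(sp _ (proj_in (l2_unit_seq q))).
  rewrite (ip_dotsuml ip _ _ le lPd) cRe_sum; apply: ler_sum => l _.
  by rewrite (ip_dotC ip lPd (le l)) mulJ /= dot_e// normsqJ.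
apply/eqP; rewrite eq_le dim_ge ?andbT; last by apply/asboolP; exists e.
apply: ge_ereal_sup => _ [d' [v [Mv iv]] <-]; rewrite lee_fin ler_nat.
by apply: (indep_in_span iv) => k; exact: sp.
Qed.

End Dimension.

End Sequence_space.

(** * Fibers of the core space *)

Section Vectors.
Context (R : realType) (n : nat).
Local Notation mu := (@lebesgue_measure R).
Implicit Types (f g h : vec R n).

Let ip := inner_product_L2 R.

(** Vectors are uncurried to functions of the pair (component, point), the form in which
    [inner_product] is stated. *)
Let cur (F : 'I_n * R -> R[i]) : vec R n := fun i x => F (i, x).

Lemma inner_product_L2n :
  inner_product (fun F => L2n (cur F)) (fun F G => dotn (cur F) (cur G)).
Proof.
have D f g : dotn f g = \sum_(i < n) cdot (f i) (g i) by [].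
split.
- by move=> i; exact: L2_0.
- by move=> c f g Lf Lg i; exact: (L2_lin c (Lf i) (Lg i)).
- move=> c f g h Lf Lg Lh; rewrite !D mulr_sumr -big_split/=; apply: eq_bigr => i _.
  exact: (ip_dotl ip c (Lf i) (Lg i) (Lh i)).
- move=> f g Lf Lg; rewrite !D rmorph_sum; apply: eq_bigr => i _.
  exact: (ip_dotC ip (Lf i) (Lg i)).
- move=> f Lf; rewrite D cRe_sum; apply: sumr_ge0 => i _.
  exact: (ip_ge0 ip (Lf i)).
Qed.

Lemma dotn_sqnormn f : L2n f -> (Re (dotn f f))%:E = sqnormn f.
Proof.
move=> Lf; rewrite /dotn /sqnormn cRe_sum -sumEFin; apply: eq_bigr => i _.
exact: (cdot_sqnorm (Lf i)).
Qed.

Let unc f : 'I_n * R -> R[i] := fun p => f p.1 p.2.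
Let ipn := inner_product_L2n.

Lemma L2n_lin (c : R[i]) f g : L2n f -> L2n g -> L2n (fun i x => c * f i x + g i x).
Proof. by move=> Lf Lg i; exact: (L2_lin c (Lf i) (Lg i)). Qed.

Lemma L2nB f g : L2n f -> L2n g -> L2n (fun i x => f i x - g i x).
Proof. by move=> Lf Lg i; exact: (L2B (Lf i) (Lg i)). Qed.

Lemma dotnC f g : L2n f -> L2n g -> dotn g f = conjc (dotn f g).
Proof. by move=> Lf Lg; exact: (@ip_dotC _ _ _ _ ipn (unc f) (unc g) Lf Lg). Qed.

Lemma dotnBl f g h : L2n f -> L2n g -> L2n h ->
  dotn (fun i x => f i x - g i x) h = dotn f h - dotn g h.
Proof. by move=> Lf Lg Lh; exact: (@ip_dotBl _ _ _ _ ipn (unc f) (unc g) (unc h) Lf Lg Lh). Qed.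

Lemma dotn_suml d (c : 'I_d -> R[i]) (v : 'I_d -> vec R n) h : (forall l, L2n (v l)) -> L2n h ->
  dotn (fun i x => \sum_(l < d) c l * v l i x) h = \sum_(l < d) c l * dotn (v l) h.
Proof.
move=> Lv Lh.
exact: (@ip_dotsuml _ _ _ _ ipn _ (index_enum 'I_d) c (fun l => unc (v l)) (unc h) Lv Lh).
Qed.

Lemma dotn_CS f g : L2n f -> L2n g ->
  normsq (dotn f g) <= Re (dotn f f) * Re (dotn g g).
Proof. by move=> Lf Lg; exact: (@ip_CS _ _ _ _ ipn (unc f) (unc g) Lf Lg). Qed.

Lemma dotn_of_nn f g z : L2n f -> L2n g ->
  (forall c, Re (dotn (fun i x => c * f i x + g i x) (fun i x => c * f i x + g i x)) -
     Re (dotn g g) - normsq c * Re (dotn f f) = 2 * Re (c * z)) -> dotn f g = z.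
Proof. by move=> Lf Lg h; exact: (@ip_dot_of_nn _ _ _ _ ipn (unc f) (unc g) z Lf Lg h). Qed.

(** Orthogonality passes to finite combinations by linearity and to their limits by
    Cauchy-Schwarz. *)
Lemma clspan_orth (A : set (vec R n)) h : L2n h -> (forall g, A g -> L2n g) ->
  (forall g, A g -> dotn g h = 0) -> forall f, clspan A f -> dotn f h = 0.
Proof.
move=> Lh LA Ah f [Lf hf]; apply: normsq_eq0; apply/eqP; rewrite eq_le normsq_ge0 andbT.
apply/ler_addgt0Pl => e e0; rewrite addr0.
have h0 : 0 <= Re (dotn h h) by exact: (@ip_ge0 _ _ _ _ ipn (unc h) Lh).
have e1 : 0 < e / (Re (dotn h h) + 1) by rewrite divr_gt0// ltr_wpDl.
have [g [d [c [v [Av gE]]]] hg] := hf _ e1.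
have Lv l : L2n (v l) by exact: LA.
have {gE} gE : g = fun i x => \sum_(l < d) c l * v l i x.
  by apply/funext => i; apply/funext => x; exact: gE.
have gh : dotn g h = 0.
  by rewrite gE dotn_suml// big1// => l _; rewrite Ah ?mulr0.
have Lg : L2n g.
  by rewrite gE => i; exact: (L2_sum (index_enum 'I_d) c (fun l => Lv l i)).
have Lfg := L2nB Lf Lg.
have <- : dotn (fun i x => f i x - g i x) h = dotn f h by rewrite dotnBl// gh subr0.
apply: le_trans (dotn_CS Lfg Lh) _.
move: hg; rewrite -dotn_sqnormn// lte_fin ltr_pdivlMr; last by rewrite ltr_wpDl.
have := @ip_ge0 _ _ _ _ ipn (unc (fun i x => f i x - g i x)) Lfg; rewrite /cur /unc /=.
by move: (Re (dotn _ _)) h0 => s; move: (Re (dotn _ _)) => t; nra.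
Qed.

Lemma sub_clspan (A : set (vec R n)) f : L2n f -> A f -> clspan A f.
Proof.
move=> Lf Af; split => // e e0; exists f.
  by exists 1%N, (fun=> 1), (fun=> f); split => // i x; rewrite big_ord1 mul1r.
rewrite /sqnormn big1 ?lte_fin// => i _; rewrite /sqnorm.
by under eq_integral do rewrite subrr normsq0; rewrite integral0.
Qed.

Context (theta : 'I_n -> R).

Local Notation I := (`[- pi, pi[%classic : set R).

(** [Tper] with the transforms as arguments, so that explicit functions equal to them almost
    everywhere can be substituted. *)
Definition fiber (g : 'I_n -> R -> R[i]) (xi : R) : zseq R n :=
  fun q => g q.2 (xi - theta q.2 + 2 * q.1%:~R * pi).

Lemma TperE f : Tper theta f = fiber (fun i => fourier (f i)).
Proof. by []. Qed.

Let P2 : 0 < 2 * pi :> R. Proof. by rewrite mulr_gt0// pi_gt0. Qed.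

Let n0 (z : R[i]) : (0 <= (normsq z)%:E)%E. Proof. by rewrite lee_fin normsq_ge0. Qed.

Lemma cmeasurable_fiber g q : (forall i, cmeasurable setT (g i)) ->
  cmeasurable setT (fun xi => fiber g xi q).
Proof.
move=> mg; have := cmeasurable_affine 1 (- theta q.2 + 2 * q.1%:~R * pi) (mg q.2).
by congr cmeasurable; apply/funext => x; rewrite /fiber mul1r addrA.
Qed.

(** For each component, the entries of the fibers over one period run once through the line:
    periodization with period 2 pi after a shift by theta i. *)
Lemma fiber_sqnorm g : (forall i, cmeasurable setT (g i)) ->
  (\int[mu]_(xi in I) l2sqnorm (fiber g xi) = \sum_(i < n) sqnorm setT (g i))%E.
Proof.
move=> mg; rewrite /l2sqnorm.
have mq q : measurable_fun I (fun xi => (normsq (fiber g xi q))%:E).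
  by apply: emeasurable_normsq; apply: cmeasurableS (cmeasurable_fiber q mg).
rewrite integral_esum// esum_finprod; last by move=> q; apply: integral_ge0.
apply: eq_bigr => i _.
have mi : measurable_fun setT (fun xi : R => (normsq (g i (xi - theta i)))%:E).
  apply: emeasurable_normsq; have := cmeasurable_affine 1 (- theta i) (mg i).
  by congr cmeasurable; apply/funext => x; rewrite mul1r.
have -> : sqnorm setT (g i) = (\int[mu]_xi (normsq (g i (xi - theta i)))%:E)%E.
  by rewrite /sqnorm -(ge0_integral_shift (- theta i) (emeasurable_normsq (mg i))).
rewrite (@periodization R (- pi) (2 * pi) _ P2 mi)//.
have -> : - pi + 2 * pi = pi :> R by ring.
have mik k : measurable_fun I (fun xi : R => (normsq (g i (xi + 2 * pi * k%:~R - theta i)))%:E).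
  have := mq (k, i); congr measurable_fun; apply/funext => x.
  by rewrite /fiber /=; congr (normsq (g i _))%:E; ring.
rewrite integral_esum//; apply: eq_esum => k _; apply: eq_integral => x _.
by rewrite /fiber /=; congr (normsq (g i _))%:E; ring.
Qed.

Lemma L2n_fourier_measurable f i : L2n f -> cmeasurable setT (fourier (f i)).
Proof. by move=> Lf; apply: L2_measurable; exact: fourier_L2. Qed.

Lemma Tper_sqnorm f : L2n f ->
  (\int[mu]_(xi in I) l2sqnorm (Tper theta f xi) = (2 * pi)%:E * sqnormn f)%E.
Proof.
move=> Lf; rewrite TperE fiber_sqnorm; last by move=> i; exact: L2n_fourier_measurable.
rewrite /sqnormn ge0_sume_distrr; last by move=> i _; exact: sqnorm_ge0.
by apply: eq_bigr => i _; exact: fourier_sqnorm.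
Qed.

Lemma ae_fiber g g' : (forall i, {ae mu, forall x, g i x = g' i x}) ->
  {ae mu, forall xi, fiber g xi = fiber g' xi}.
Proof.
move=> gg'; have h q : {ae mu, forall xi, fiber g xi q = fiber g' xi q}.
  have := ae_affine (- theta q.2 + 2 * q.1%:~R * pi) ltr01 (gg' q.2).
  by apply: aeS => x; rewrite /fiber mul1r addrA.
by have := ae_forall_count h; apply: aeS => x hx; apply/funext => q; exact: hx.
Qed.

Lemma Tper_lin (c : R[i]) f g : L2n f -> L2n g ->
  {ae mu, forall xi, Tper theta (fun i x => c * f i x + g i x) xi =
     fun q => c * Tper theta f xi q + Tper theta g xi q}.
Proof. move=> Lf Lg; exact: (ae_fiber (fun i => fourier_lin_ae c (Lf i) (Lg i))). Qed.

Lemma Tper_shift f (s : int) xi :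
  Tper theta f (xi + 2 * s%:~R * pi) = lambda (- s) (Tper theta f xi).
Proof.
apply/funext => q; rewrite /Tper /lambda/= opprK intrD; congr fourier; ring.
Qed.

(** Meant for functions unfolded from [-pi, pi), which have a different formula on each interval of
    length 2 pi. *)
Lemma measurable_partition (K : countType) d (T : measurableType d) (D : K -> set R)
    (kappa : R -> K) (f : R -> T) (F : K -> R -> T) :
  (forall k, measurable (D k)) -> (forall x, D (kappa x) x) ->
  (forall k, measurable_fun setT (F k)) -> (forall k x, D k x -> f x = F k x) ->
  measurable_fun setT f.
Proof.
move=> mD Dk mF fF; pose E j := if @unpickle K j is Some k then D k else set0.
have -> : [set: R] = \bigcup_j E j.
  by apply/seteqP; split => // x _; exists (pickle (kappa x)) => //; rewrite /E pickleK.
apply/measurable_fun_bigcup.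
  by move=> j; rewrite /E; case: unpickle.
move=> j; rewrite /E; case: unpickle => [k|]; last exact: measurable_fun_set0.
apply: (eq_measurable_fun (F k)); first by move=> x; rewrite inE => /fF.
exact: measurable_funTS.
Qed.

Lemma floor_period (k : int) (x : R) : - pi <= x -> x < pi ->
  Num.floor ((x + 2 * k%:~R * pi + pi) / (2 * pi)) = k.
Proof.
move=> x1 x2; apply: floor_def; rewrite intrD rmorph1.
by rewrite ler_pdivlMr// ltr_pdivrMr//; apply/andP; split; lra.
Qed.

Lemma floor_periodP (x : R) (k := Num.floor ((x + pi) / (2 * pi))) :
  - pi <= x - 2 * k%:~R * pi < pi.
Proof.
have /andP[] := floor_itv ((x + pi) / (2 * pi)); rewrite -/k intrD rmorph1.
by rewrite ler_pdivlMr// ltr_pdivrMr//; move: k%:~R => q h1 h2; apply/andP; split; lra.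
Qed.

(** The inverse of taking fibers: the field is unfolded to one function on the line per component,
    and surjectivity of the Fourier transform gives h. Elements of V with prescribed fibers are
    produced in this way. *)
Lemma field_Tper (a : R -> zseq R n) : (forall q, cmeasurable setT (fun xi => a xi q)) ->
  (\int[mu]_(xi in I) l2sqnorm (a xi) < +oo)%E ->
  exists2 h, L2n h & {ae mu, forall xi, I xi -> Tper theta h xi = a xi}.
Proof.
move=> ma afin; pose kap i (y : R) := Num.floor ((y + theta i + pi) / (2 * pi)).
pose g i y := a (y + theta i - 2 * (kap i y)%:~R * pi) (kap i y, i).
have ga xi : I xi -> fiber g xi = a xi.
  rewrite /= in_itv/= => /andP[x1 x2]; apply/funext => -[k i]; rewrite /fiber/= /g.
  have -> : kap i (xi - theta i + 2 * k%:~R * pi) = k.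
    by rewrite /kap -[RHS](floor_period k x1 x2); congr (Num.floor (_ / _)); ring.
  by congr (a _ _); ring.
have mg i : cmeasurable setT (g i).
  pose D (k : int) : set R := [set y | kap i y = k].
  pose G (k : int) y := a (y + theta i - 2 * k%:~R * pi) (k, i).
  have mD k : measurable (D k).
    have -> : D k = `[2 * k%:~R * pi - theta i - pi, 2 * k%:~R * pi - theta i + pi[%classic.
      apply/seteqP; split => y; rewrite /D /= in_itv/=.
        move=> <-; have := floor_periodP (y + theta i); rewrite -/(kap i y).
        by move=> /andP[h1 h2]; apply/andP; split; lra.
      move=> /andP[h1 h2]; have y1 : - pi <= y + theta i - 2 * k%:~R * pi by lra.
      have y2 : y + theta i - 2 * k%:~R * pi < pi by lra.
      by rewrite /kap -[RHS](floor_period k y1 y2); congr (Num.floor (_ / _)); ring.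
    exact: measurable_itv.
  have mG k : cmeasurable setT (G k).
    have := cmeasurable_affine 1 (theta i - 2 * k%:~R * pi) (ma (k, i)).
    by congr cmeasurable; apply/funext => x; rewrite /G mul1r addrA.
  split.
    apply: (@measurable_partition int _ _ D (kap i) _ (fun k y => Re (G k y))) => //.
      by move=> k; case: (mG k).
    by move=> k y <-.
  apply: (@measurable_partition int _ _ D (kap i) _ (fun k y => Im (G k y))) => //.
    by move=> k; case: (mG k).
  by move=> k y <-.
have Lg i : L2 (g i).
  split => //; apply: le_lt_trans afin.
  have -> : (\int[mu]_(xi in I) l2sqnorm (a xi) = \int[mu]_(xi in I) l2sqnorm (fiber g xi))%E.
    by apply: eq_integral => x; rewrite inE => Ix; rewrite ga.
  rewrite fiber_sqnorm// (bigD1 i)//= leeDl// sume_ge0// => j _; exact: sqnorm_ge0.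
have ex i : exists f : R -> R[i], L2 f /\ {ae mu, forall x, fourier f x = g i x}.
  by have [f Lf e] := fourier_surjective (Lg i); exists f.
have [h hh] := choice ex.
exists h; first by move=> i; case: (hh i).
have := ae_fiber (fun i => (hh i).2); apply: aeS => xi e Ix.
by rewrite TperE e ga.
Qed.

Lemma fourier_dotn f g : L2n f -> L2n g ->
  (2 * pi)%:C * dotn f g = \sum_(i < n) cdot (fourier (f i)) (fourier (g i)).
Proof.
move=> Lf Lg; rewrite /dotn mulr_sumr; apply: eq_bigr => i _.
by rewrite (fourier_dot (Lf i) (Lg i)).
Qed.

(** Range functions and fibers transform alike under translations by 2 pi s, so membership need only
    be established over one period. *)
Lemma ae_period (Q : R -> Prop) : {ae mu, forall xi, I xi -> Q xi} ->
  (forall xi (s : int), Q xi -> Q (xi + 2 * s%:~R * pi)) -> {ae mu, forall xi, Q xi}.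
Proof.
move=> hQ Qs; have h (s : int) := ae_affine (- (2 * s%:~R * pi)) ltr01 hQ.
have := ae_forall_count h; apply: aeS => xi hxi.
have := floor_periodP xi; set s := Num.floor _ => /andP[h1 h2].
have := hxi s; rewrite mul1r => /(_ _)/(Qs _ s); rewrite subrK; apply.
by rewrite /= in_itv/= h1 h2.
Qed.

End Vectors.

(** * Dilated shifts against test vectors *)

Section Wavelet_operators.
Context (R : realType) (N n : nat) (sigma : {perm 'I_n}) (theta : 'I_n -> R).
Context (N0 : (0 < N)%N).
Local Notation mu := (@lebesgue_measure R).
Local Notation I := (`[- pi, pi[%classic : set R).
Local Notation shz := (shiftz theta).
Local Notation dlz := (@dilationz R N n sigma).
Implicit Types (f g h F : vec R n).

Let ip := inner_product_L2 R.

Let NR0 : 0 < N%:R :> R. Proof. by rewrite ltr0n. Qed.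

Let sN0 : 0 < Num.sqrt N%:R :> R. Proof. by rewrite sqrtr_gt0. Qed.

Let NX0 l : 0 < N%:R ^+ l :> R. Proof. by rewrite exprn_gt0. Qed.

Lemma shiftzE k f i x :
  shz k f i x = expi (- (k%:~R * theta i)) * f i (x - k%:~R).
Proof.
have H0 (j : nat) (y : R) : iter j (Defs.shift theta) f i y = expi (- (j%:R * theta i)) * f i (y - j%:R).
  elim: j y => [|j IH] y; first by rewrite mulr0n mul0r oppr0 expi0 mul1r addr0.
  rewrite iterS /Defs.shift IH mulrA /zpt -expiD; congr (expi _ * f i _).
    by rewrite -natr1; ring.
  by rewrite -natr1; ring.
have H (j : nat) (y : R) : iter j (shift_inv theta) f i y = expi (j%:R * theta i) * f i (y + j%:R).
  elim: j y => [|j IH] y; first by rewrite mulr0n mul0r expi0 mul1r addr0.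
  rewrite iterS /shift_inv IH mulrA /zpt expiV opprK -expiD; congr (expi _ * f i _).
    by rewrite -natr1; ring.
  by rewrite -natr1; ring.
case: k => m; rewrite /shiftz /iterz; first by rewrite H0 -!pmulrn.
by rewrite H NegzE mulrNz -!pmulrn mulNr !opprK.
Qed.

Lemma dilationzE (l : nat) f i x :
  dlz l f i x = ((Num.sqrt N%:R)^-1 ^+ l)%:C * f ((sigma ^+ l)%g i) (x / N%:R ^+ l).
Proof.
rewrite /dilationz /=; elim: l i x => [|l IH] i x.
  by rewrite expr0 expr0 mul1r divr1 expg0 perm1.
rewrite iterS /dilation IH mulrA -rmorphM -exprS expgS permM; congr (_ * f _ _).
by rewrite exprS invfM mulrA.
Qed.

Lemma L2n_iterz (F G : vec R n -> vec R n) k f :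
  (forall g, L2n g -> L2n (F g)) -> (forall g, L2n g -> L2n (G g)) ->
  L2n f -> L2n (iterz F G k f).
Proof.
move=> hF hG Lf; case: k => m; rewrite /iterz.
  by elim: m => [|m IH] //; rewrite iterS; exact: hF.
by elim: m.+1 => [|j IH] //; rewrite iterS; exact: hG.
Qed.

Lemma L2n_shiftz k f : L2n f -> L2n (shz k f).
Proof.
move=> Lf i; have := L2Z (expi (- (k%:~R * theta i))) (L2_affine (- k%:~R) ltr01 (Lf i)).
by congr L2; apply/funext => x; rewrite shiftzE mul1r.
Qed.

Lemma L2n_dilationz k f : L2n f -> L2n (dlz k f).
Proof.
apply: L2n_iterz => g Lg i.
  have Ni : 0 < N%:R^-1 :> R by rewrite invr_gt0.
  have := L2Z ((Num.sqrt N%:R)^-1)%:C (L2_affine 0 Ni (Lg (sigma i))).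
  by congr L2; apply/funext => x; rewrite /dilation addr0 [_^-1 * x]mulrC.
have := L2Z (Num.sqrt N%:R)%:C (L2_affine 0 NR0 (Lg ((sigma^-1)%g i))).
by congr L2; apply/funext => x; rewrite /dilation_inv addr0.
Qed.

Lemma fourierZ_ae (c : R[i]) (f : R -> R[i]) : L2 f ->
  {ae mu, forall x, fourier (fun x => c * f x) x = c * fourier f x}.
Proof.
move=> Lf; have := fourier_lin_ae c Lf (L2_0 R).
have -> : (fun x => c * f x + 0) = fun x => c * f x by apply/funext => x; rewrite addr0.
by have := fourier0_ae R; apply: aeS2 => x -> ->; rewrite addr0.
Qed.

(** The factor sqrt N ^ l is the Jacobian N^l times the normalization sqrt N ^ - l of the dilation.
    The phase in theta stays apart from the modulation, as only its modulus 1 will count. *)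
Lemma fourier_wavelet (l : nat) k f i : L2n f ->
  {ae mu, forall y, fourier (dlz l (shz k f) i) y =
     ((Num.sqrt N%:R ^+ l)%:C * expi (- (k%:~R * theta ((sigma ^+ l)%g i)))) *
     (expi (- (k%:~R * (N%:R ^+ l * y))) * fourier (f ((sigma ^+ l)%g i)) (N%:R ^+ l * y))}.
Proof.
move=> Lf; set i' := (sigma ^+ l)%g i.
have a0 : 0 < (N%:R ^+ l)^-1 :> R by rewrite invr_gt0.
pose c := ((Num.sqrt N%:R)^-1 ^+ l)%:C * expi (- (k%:~R * theta i')).
have e : dlz l (shz k f) i = fun x => c * f i' ((N%:R ^+ l)^-1 * x + - k%:~R).
  by apply/funext => x; rewrite dilationzE shiftzE -/i' mulrA [x / _]mulrC.
rewrite e; have := fourierZ_ae c (L2_affine (- k%:~R) a0 (Lf i')).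
have := fourier_affine (- k%:~R) a0 (Lf i'); apply: aeS2 => y -> ->.
have -> : y * - k%:~R / (N%:R ^+ l)^-1 = - (k%:~R * (N%:R ^+ l * y)) by rewrite invrK; ring.
have -> : y / (N%:R ^+ l)^-1 = N%:R ^+ l * y by rewrite invrK mulrC.
rewrite invrK !mulrA; congr (_ * _ * _).
rewrite /c mulrAC -rmorphM; congr (_%:C * _).
have s2 : N%:R = Num.sqrt N%:R * Num.sqrt N%:R :> R by rewrite -expr2 sqr_sqrtr// ltW.
by rewrite {2}s2 exprMn exprVn mulrA mulVf ?mul1r// gt_eqF// exprn_gt0.
Qed.

(** The phase exp (- i k theta i) of the shift cancels the offset theta i of the fiber, and
    multiples of 2 pi drop out, so that all entries receive the same factor. The offsets in the
    definition of [Tper] serve this purpose. *)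
Lemma Tper_shiftz k f : L2n f ->
  {ae mu, forall xi, Tper theta (shz k f) xi =
     fun q => expi (- (k%:~R * xi)) * Tper theta f xi q}.
Proof.
move=> Lf; pose g i y := expi (- (k%:~R * theta i)) *
  (expi (- (k%:~R * y)) * fourier (f i) y).
have h i : {ae mu, forall y, fourier (shz k f i) y = g i y}.
  have := @fourier_wavelet 0 k f i Lf; apply: aeS => y.
  by rewrite expr0 expr0 expg0 perm1 !mul1r => ->.
have := ae_fiber theta h; apply: aeS => xi; rewrite TperE => ->.
apply/funext => q; rewrite /fiber /g /Tper mulrA -expiD; congr (_ * _).
rewrite (_ : - _ + - _ = - (k%:~R * xi) + 2 * (- (k * q.1))%:~R * pi).
  by rewrite expiD expi_2pi mulr1.
by rewrite mulrNz intrM; ring.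
Qed.

Definition test_fourier (E : set R) (q0 : int * 'I_n) (i : 'I_n) (y : R) : R[i] :=
  if i == q0.2 then (\1_E (y + theta i - 2 * q0.1%:~R * pi))%:C else 0.

(* For E inside [-pi, pi), the fibers of such an F on [-pi, pi) are those of the
   constant field unit_seq q0, restricted to E. *)
Definition test_vector E q0 F : Prop :=
  L2n F /\ forall i, {ae mu, forall y, fourier (F i) y = test_fourier E q0 i y}.

Context (E : set R) (q0 : int * 'I_n) (mE : measurable E) (EI : E `<=` I).

Let Efin : (mu E < +oo)%E.
Proof.
apply: (@le_lt_trans _ _ (mu I)); first by apply: le_measure; rewrite ?inE//; exact: measurable_itv.
by rewrite lebesgue_measure_itv/=; case: ifP => _; rewrite ?ltry.
Qed.

Let L2_E : L2 (fun x => (\1_E x)%:C : R[i]).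
Proof.
by have := L2_cst_indic 1 mE Efin; congr L2; apply/funext => x; rewrite mulr1.
Qed.

Lemma L2_test_fourier i : L2 (test_fourier E q0 i).
Proof.
rewrite /test_fourier; case: eqP => [->|_]; last exact: L2_0.
have := L2_affine (theta q0.2 - 2 * q0.1%:~R * pi) ltr01 L2_E.
by congr L2; apply/funext => x; rewrite mul1r addrA.
Qed.

Lemma test_vector_exists : exists F, test_vector E q0 F.
Proof.
have ex i : exists f : R -> R[i], L2 f /\ {ae mu, forall y, fourier f y = test_fourier E q0 i y}.
  by have [f Lf e] := fourier_surjective (L2_test_fourier i); exists f.
have [F hF] := choice ex; exists F; split => i; by case: (hF i).
Qed.

Context (F : vec R n) (tF : test_vector E q0 F).

Let LF : L2n F. Proof. by case: tF. Qed.

Lemma test_vector_Tper :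
  {ae mu, forall xi, I xi -> Tper theta F xi = fun q => (\1_E xi)%:C * unit_seq R q0 q}.
Proof.
have := ae_fiber theta (proj2 tF); apply: aeS => xi; rewrite TperE => -> xiI.
apply/funext => -[k i]; case: q0 => k0 i0; rewrite /fiber /test_fourier /unit_seq /= xpair_eqE.
have [->|_] := eqVneq i i0; last by rewrite andbF mulr0.
rewrite andbT; have -> : xi - theta i0 + 2 * k%:~R * pi + theta i0 - 2 * k0%:~R * pi =
    xi + 2 * (k - k0)%:~R * pi by rewrite intrB; ring.
have [->|kk] := eqVneq k k0; first by rewrite subrr mulr0 mul0r addr0 mulr1.
rewrite mulr0 indicE memNset// => /EI; move: xiI; rewrite /= !in_itv/= => /andP[x1 x2].
move=> /andP[y1 y2]; move/eqP: kk; apply.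
have := floor_period 0 y1 y2; rewrite mulr0 mul0r addr0 (floor_period (k - k0) x1 x2).
by move/eqP; rewrite subr_eq0 => /eqP.
Qed.

Lemma test_vector_dot g : L2n g ->
  (2 * pi)%:C * dotn F g =
  cintegral (fun xi => (\1_E xi)%:C * conjc (Tper theta g xi q0)).
Proof.
move=> Lg; rewrite fourier_dotn//.
have Lt := L2_test_fourier; have LG i := fourier_L2 (Lg i).
have e i : cdot (fourier (F i)) (fourier (g i)) = cdot (test_fourier E q0 i) (fourier (g i)).
  apply: cdot_ae; try exact: L2_measurable; try exact: aeT.
  - by apply: L2_measurable; exact: fourier_L2.
  - by case: tF.
under eq_bigr do rewrite e.
rewrite (bigD1 q0.2)//= big1 ?addr0; last first.
  move=> i iq; have -> : test_fourier E q0 i = fun=> 0.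
    by apply/funext => y; rewrite /test_fourier (negbTE iq).
  exact: (ip_dot0l ip (LG i)).
pose b := - theta q0.2 + 2 * q0.1%:~R * pi.
pose W y := test_fourier E q0 q0.2 y * conjc (fourier (g q0.2) y).
have mW : cmeasurable setT W.
  by apply: cmeasurableM; [exact: L2_measurable|apply: cmeasurableJ; exact: L2_measurable].
have := cintegral_affine b ltr01 mW; rewrite invr1 mul1r => h.
transitivity (cintegral W); first by [].
rewrite -h.
congr cintegral; apply/funext => x; rewrite /W /test_fourier eqxx mul1r /b.
congr (_%:C * conjc _); first by congr (\1_E _); ring.
by rewrite /Tper addrA.
Qed.

Context (l : nat) (f : vec R n) (Lf : L2n f).

Let i' := (sigma ^+ l)%g q0.2.

Let a : R := N%:R ^+ l.

Let b : R := a * (- theta q0.2 + 2 * q0.1%:~R * pi).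

(** The transform cut off to the image of E under x -> a x + b. Up to a constant its Fourier
    coefficients have the modulus of the inner products of F with the shifts at level l ([coef]), so
    sums over the shifts become sums of Fourier coefficients. *)
Let u z : R[i] := (\1_E (z / a + theta q0.2 - 2 * q0.1%:~R * pi))%:C * fourier (f i') z.

Let uE x : u (a * x + b) = (\1_E x)%:C * fourier (f i') (a * (x - theta q0.2 + 2 * q0.1%:~R * pi)).
Proof.
have a0 : a != 0 by rewrite gt_eqF// NX0.
rewrite /u /b; congr (_%:C * fourier _ _); last by ring.
by congr (\1_E _); rewrite -mulrDr mulrAC mulfV// mul1r; ring.
Qed.

Let Lind : L2 (fun z => (\1_E (z / a + theta q0.2 - 2 * q0.1%:~R * pi))%:C : R[i]).
Proof.
have a0 : 0 < a^-1 by rewrite invr_gt0 NX0.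
have := L2_affine (theta q0.2 - 2 * q0.1%:~R * pi) a0 L2_E.
by congr L2; apply/funext => x; rewrite [_^-1 * x]mulrC addrA.
Qed.

Let cu : cintegrable u. Proof. by apply: L2_mul => //; exact: fourier_L2. Qed.

Let Lu : L2 u.
Proof.
apply: (L2_le _ (fourier_L2 (Lf i'))); first exact: cintegrable_measurable.
by move=> x; rewrite /u normsqM normsqR indicE; case: (_ \in _);
  rewrite ?expr1n ?mul1r// expr0n mul0r normsq_ge0.
Qed.

Definition dilate_density (xi : R) : R :=
  normsq (fourier (f ((sigma ^+ l)%g q0.2)) (N%:R ^+ l * (xi - theta q0.2 + 2 * q0.1%:~R * pi))).

Let u_sqnorm : sqnorm setT u = (a%:E * \int[mu]_(xi in E) (dilate_density xi)%:E)%E.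
Proof.
have mu_ := cintegrable_measurable cu.
have := sqnorm_affine b (NX0 l) mu_.
have -> : sqnorm setT (fun x => u (a * x + b)) =
    (\int[mu]_(xi in E) (dilate_density xi)%:E)%E.
  rewrite [RHS](_ : _ = sqnorm E (fun xi => fourier (f i') (a * (xi - theta q0.2 + 2 * q0.1%:~R * pi))))//.
  by rewrite [RHS]sqnorm_mkcond; congr sqnorm; apply/funext => x; rewrite uE.
move=> ->; rewrite -/a muleA -EFinM mulfV ?mul1e// gt_eqF//; exact: NX0.
Qed.

(** The change of variables contributes a^-1, hence a^-2 after squaring, and the constant C of
    [fourier_wavelet] contributes a. *)
Let coef (k : int) :
  (2 * pi) ^+ 2 * normsq (dotn F (dlz l (shz k f))) = a^-1 * normsq (fourierL1 u k%:~R).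
Proof.
pose C := (Num.sqrt N%:R ^+ l)%:C * expi (- (k%:~R * theta i')) : R[i].
have nC : normsq C = a.
  by rewrite /C normsqM normsq_expi mulr1 normsqR -exprM mulnC exprM sqr_sqrtr// ltW.
have LG := L2n_dilationz l (L2n_shiftz k Lf).
have := test_vector_dot LG; set d := dotn _ _ => hd.
have -> : (2 * pi) ^+ 2 * normsq d = normsq ((2 * pi)%:C * d) by rewrite normsqM normsqR.
pose w z := u z * expi (- (k%:~R * z)).
have cw : cintegrable w by exact: cintegrable_fourier.
pose W z := conjc (C * w z).
have mW : cmeasurable setT W.
  by apply: cmeasurableJ; apply: cmeasurableM; [exact: cmeasurable_cst|exact: cintegrable_measurable].
have -> : (2 * pi)%:C * d = cintegral (fun x => W (a * x + b)).
  rewrite hd; apply: eq_cintegral_ae.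
  - apply: cmeasurableM; first by apply: cmeasurable_indic.
    apply: cmeasurableJ; rewrite TperE; apply: cmeasurable_fiber => i.
    exact: L2n_fourier_measurable.
  - exact: cmeasurable_affine.
  have := ae_affine (- theta q0.2 + 2 * q0.1%:~R * pi) ltr01 (fourier_wavelet l k q0.2 Lf).
  apply: aeS => x; rewrite mul1r addrA => hx.
  rewrite /W /w uE /Tper hx -/i' -/C -/a.
  have -> : a * x + b = a * (x - theta q0.2 + 2 * q0.1%:~R * pi) by rewrite /b; ring.
  move: (fourier _ _) (expi (- (k%:~R * _))) (\1_E x) (C) => z1 z2 r z3.
  by apply: eqcP; rewrite !cE /=; ring.
rewrite cintegral_affine//; last exact: NX0.
rewrite normsqM normsqR /W cintegralJ normsqJ cintegralZ// normsqM nC /fourierL1 -/w.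
by rewrite expr2 -mulrA [a^-1 * (a * _)]mulrA mulVf ?mul1r// gt_eqF//; exact: NX0.
Qed.

Let n0 (z : R[i]) : (0 <= (normsq z)%:E)%E. Proof. by rewrite lee_fin normsq_ge0. Qed.

Let P2 : 0 < 2 * pi :> R. Proof. by rewrite mulr_gt0// pi_gt0. Qed.

Let coef_sum : (((2 * pi) ^+ 2)%:E *
    (\esum_(k in [set: int]) (normsq (dotn F (dlz l (shz k f))))%:E) =
  (a^-1)%:E * \esum_(k in [set: int]) (normsq (fourierL1 u k%:~R))%:E)%E.
Proof.
rewrite -!esumZl ?sqr_ge0 ?invr_ge0 ?(ltW (NX0 l))//.
by apply: eq_esum => k _; rewrite -!EFinM coef.
Qed.

Let u_supp c : (forall x, E x -> c <= x) -> forall L : R,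
  (forall x, E x -> a * (x - c) < L) ->
  supported `[a * c + b, a * c + b + L[%classic u.
Proof.
move=> h1 L h2 z zN; rewrite /u indicE memNset ?mul0r// => Ez; apply: zN.
have za : a * (z / a + theta q0.2 - 2 * q0.1%:~R * pi) = z - b.
  rewrite /b; have : a * (z / a) = z by rewrite mulrC divfK// gt_eqF//; exact: NX0.
  by rewrite !mulrBr !mulrDr => ->; ring.
have := h2 _ Ez; rewrite mulrBr za => h3.
have := ler_wpM2l (ltW (NX0 l)) (h1 _ Ez); rewrite -/a za => h4.
by rewrite /= in_itv/=; apply/andP; split; lra.
Qed.

Let cancel_2pi (x y : \bar R) : (((2 * pi) ^+ 2)%:E * x = ((2 * pi)%:E * y))%E ->
  ((2 * pi)%:E * x = y)%E.
Proof.
rewrite expr2 EFinM -muleA => h.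
have : ((2 * pi)^-1%:E * ((2 * pi)%:E * ((2 * pi)%:E * x)) = (2 * pi)^-1%:E * ((2 * pi)%:E * y))%E.
  by rewrite h.
by rewrite !muleA -!EFinM mulVf ?gt_eqF// !mul1e mul1r.
Qed.

(** The hypotheses place N^l (E - c) in a single period, where Parseval's identity is exact. *)
Lemma frame_sum_eq c : (forall x, E x -> c <= x) ->
  (forall x, E x -> N%:R ^+ l * (x - c) < 2 * pi) ->
  ((2 * pi)%:E * (\esum_(k in [set: int]) (normsq (dotn F (dlz l (shz k f))))%:E) =
   \int[mu]_(xi in E) (dilate_density xi)%:E)%E.
Proof.
move=> h1 h2; apply: cancel_2pi; rewrite coef_sum.
rewrite (parseval Lu (u_supp h1 h2)) u_sqnorm muleCA; congr (_ * _)%E.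
by rewrite muleA -EFinM mulVf ?mul1e// gt_eqF//; exact: NX0.
Qed.

(** When the dilate of E spreads over L periods, [bessel_long] overestimates by the factor L. *)
Lemma frame_sum_le c (L : nat) : (forall x, E x -> c <= x) ->
  (forall x, E x -> N%:R ^+ l * (x - c) < L%:R * (2 * pi)) ->
  ((2 * pi)%:E * (\esum_(k in [set: int]) (normsq (dotn F (dlz l (shz k f))))%:E) <=
   L%:R%:E * \int[mu]_(xi in E) (dilate_density xi)%:E)%E.
Proof.
move=> h1 h2; rewrite -(@lee_pmul2l _ (2 * pi)%:E)// ?lte_fin//.
rewrite muleA -EFinM -expr2 coef_sum.
apply: (@le_trans _ _ ((a^-1)%:E * ((L%:R * (2 * pi))%:E * sqnorm setT u))%E).
  apply: lee_wpmul2l; first by rewrite lee_fin invr_ge0 ltW// NX0.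
  exact: (bessel_long Lu (u_supp h1 h2)).
rewrite u_sqnorm; move: (integral _ _ _) => X.
rewrite !muleA -!EFinM le_eqVlt; apply/orP; left; apply/eqP; congr (_%:E * _)%E.
by field; rewrite gt_eqF//; exact: NX0.
Qed.

End Wavelet_operators.

(** * Projections built fiber by fiber *)

Section Projection.
Context (R : realType) (n : nat) (theta : 'I_n -> R).
Local Notation mu := (@lebesgue_measure R).
Local Notation I := (`[- pi, pi[%classic : set R).
Implicit Types (f g h F : vec R n).

Let ip2 := inner_product_l2 R n.

Lemma entry_le_l2sqnorm (a : zseq R n) q : ((normsq (a q))%:E <= l2sqnorm a)%E.
Proof.
rewrite -[leLHS](@esum_single R _ q); last by rewrite lee_fin normsq_ge0.
by apply: le_esum => q' _; case: eqP => [->|_] //; rewrite lee_fin normsq_ge0.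
Qed.

(** The real part t of the q-th entry of P delta_q is also its squared norm, so t^2 <= t. *)
Lemma proj_diag_le1 (M : set (zseq R n)) (P : zseq R n -> zseq R n) q :
  closed_subspace M -> orth_proj M P -> (proj_diag P q <= 1)%E.
Proof.
move=> cM pP; have := entry_le_l2sqnorm (P (unit_seq R q)) q.
rewrite -/(proj_diag P q) (proj_diagE cM pP) !lee_fin => h.
have := le_trans (Re_sqr_le _) h; set t := Re _ => t2; nra.
Qed.

Lemma proj_diag_ge0 (P : zseq R n -> zseq R n) q : (0 <= proj_diag P q)%E.
Proof. exact: l2sqnorm_ge0. Qed.

Context (V : set (vec R n)) (J : R -> set (zseq R n)) (P : R -> zseq R n -> zseq R n).
Context (cJ : forall xi, closed_subspace (J xi)) (pP : forall xi, orth_proj (J xi) (P xi)).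
Context (mP : forall a b, l2 a -> l2 b -> cmeasurable setT (fun xi => l2dot (P xi a) b)).
Context (perJ : forall xi (k : int), J (xi + 2 * k%:~R * pi) = lambda (- k) @` J xi).
Context (VE : V = [set f | L2n f /\ {ae mu, forall xi, J xi (Tper theta f xi)}]).

Definition fiber_diag q xi : \bar R := proj_diag (P xi) q.

Lemma cmeasurable_proj q q' : cmeasurable setT (fun xi => P xi (unit_seq R q) q').
Proof.
have := mP (l2_unit_seq R q) (l2_unit_seq R q').
by congr cmeasurable; apply/funext => xi; rewrite l2dot_unit_seq.
Qed.

Lemma measurable_fiber_diag q D : measurable_fun D (fiber_diag q).
Proof.
apply: measurable_funTS; have -> : fiber_diag q = fun xi => (Re (P xi (unit_seq R q) q))%:E.
  by apply/funext => xi; exact: (proj_diagE (cJ xi) (pP xi)).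
by apply/measurable_EFinP; case: (cmeasurable_proj q q).
Qed.

Lemma fiber_diag_ge0 q xi : (0 <= fiber_diag q xi)%E.
Proof. exact: proj_diag_ge0. Qed.

Lemma fiber_diag_le1 q xi : (fiber_diag q xi <= 1)%E.
Proof. exact: (proj_diag_le1 q (cJ xi) (pP xi)). Qed.

Lemma range_L2n f : V f -> L2n f.
Proof. by rewrite VE => -[]. Qed.

Lemma measurable_l2sqnorm (D : set R) (a : R -> zseq R n) : measurable D ->
  (forall q, cmeasurable setT (a^~ q)) -> measurable_fun D (fun xi => l2sqnorm (a xi)).
Proof.
move=> mD ma; apply: emeasurable_esum => // [q|q xi]; last by rewrite lee_fin normsq_ge0.
by apply: measurable_funTS; exact: emeasurable_normsq.
Qed.

Lemma cmeasurable_Tper f q : L2n f -> cmeasurable setT (fun xi => Tper theta f xi q).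
Proof.
move=> Lf.
exact: (@cmeasurable_fiber R n theta (fun i => fourier (f i)) q (fun i => L2n_fourier_measurable i Lf)).
Qed.

Let mI : measurable I. Proof. exact: measurable_itv. Qed.

Let P2 : 0 < 2 * pi :> R. Proof. by rewrite mulr_gt0// pi_gt0. Qed.

Lemma l2sqnorm_orth (c : R[i]) (a b : zseq R n) : l2 a -> l2 b -> l2dot a b = 0 ->
  l2sqnorm (fun q => c * a q + b q) = ((normsq c)%:E * l2sqnorm a + l2sqnorm b)%E.
Proof.
move=> la lb o; have lab := ip_lin ip2 c la lb.
rewrite -(l2dot_sqnorm lab) (ip_nnD ip2 c la lb) o mulr0 mulr0 addr0.
by rewrite -(l2dot_sqnorm la) -(l2dot_sqnorm lb).
Qed.

(** Pythagoras in almost every fiber, integrated over a period, gives ||c d + g||^2 = |c|^2 ||d||^2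
    + ||g||^2 for all c, and polarization gives 0. Only squared norms of fibers are integrated,
    whose measurability is known. *)
Lemma fiber_orth d g : L2n d -> L2n g ->
  {ae mu, forall xi, I xi -> [/\ l2 (Tper theta d xi), l2 (Tper theta g xi) &
     l2dot (Tper theta d xi) (Tper theta g xi) = 0]} -> dotn d g = 0.
Proof.
move=> Ld Lg horth; apply: dotn_of_nn => // c; rewrite mulr0 mulr0.
have Lc := L2n_lin c Ld Lg.
have m0 f : L2n f -> measurable_fun I (fun xi => l2sqnorm (Tper theta f xi)).
  by move=> Lf; apply: measurable_l2sqnorm => // q; exact: cmeasurable_Tper.
have p0 f xi : I xi -> (0 <= l2sqnorm (Tper theta f xi))%E.
  by move=> _; exact: l2sqnorm_ge0.
have c0 : (0 <= normsq c) := normsq_ge0 c.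
have pc xi : I xi -> (0 <= (normsq c)%:E * l2sqnorm (Tper theta d xi))%E.
  by move=> _; rewrite mule_ge0 ?lee_fin// l2sqnorm_ge0.
have hS f : L2n f -> (\int[mu]_(xi in I) l2sqnorm (Tper theta f xi) = (2 * pi * Re (dotn f f))%:E)%E.
  by move=> Lf; rewrite (Tper_sqnorm theta Lf) -(dotn_sqnormn Lf).
have : (2 * pi * Re (dotn (fun i x => c * d i x + g i x) (fun i x => c * d i x + g i x)))%:E =
    ((normsq c)%:E * (2 * pi * Re (dotn d d))%:E + (2 * pi * Re (dotn g g))%:E)%E.
  etransitivity; first exact: (esym (hS _ Lc)).
  transitivity (\int[mu]_(xi in I) ((normsq c)%:E * l2sqnorm (Tper theta d xi) +
      l2sqnorm (Tper theta g xi)))%E.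
    apply: ae_eq_integral => //; first exact: m0.
      by apply: emeasurable_funD; [apply: measurable_funeM|]; exact: m0.
    have := Tper_lin theta c Ld Lg; apply: aeS2 horth => xi h e xiI; have [ld lg o] := h xiI.
    by rewrite e; exact: l2sqnorm_orth.
  etransitivity; first exact: (ge0_integralD mu mI pc (measurable_funeM _ (m0 d Ld)) (p0 g) (m0 g Lg)).
  congr (_ + _)%E; last exact: hS.
  etransitivity; first exact: (ge0_integralZl_EFin mu mI (p0 d) (m0 d Ld) c0).
  by congr (_ * _)%E; exact: hS.
rewrite -EFinM -EFinD => -[].
move: (Re _) (Re _) (Re _) => x y z e.
apply: (mulfI (lt0r_neq0 P2)).
by rewrite mulr0 !mulrBr e; ring.
Qed.

(** h is made by [field_Tper] from the field 1_E P(xi) delta_q, whose squared norms are at most 1.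
    The fibers of F - h are 1_E (delta_q - P(xi) delta_q), orthogonal to J(xi), so h and F have the
    same inner products with V. *)
Lemma range_projection q E F : measurable E -> E `<=` I -> test_vector theta E q F ->
  exists h, [/\ V h, forall g, V g -> dotn h g = dotn F g &
    ((2 * pi)%:E * sqnormn h = \int[mu]_(xi in E) fiber_diag q xi)%E].
Proof.
move=> mE EI tF; have LF : L2n F by case: tF.
pose a xi : zseq R n := fun q' => (\1_E xi)%:C * P xi (unit_seq R q) q'.
have ma q' : cmeasurable setT (fun xi => a xi q').
  by apply: cmeasurableM; [exact: cmeasurable_indic|exact: cmeasurable_proj].
have aE xi : l2sqnorm (a xi) = ((\1_E xi)%:E * fiber_diag q xi)%E.
  rewrite /a l2sqnormZ normsqR /fiber_diag /proj_diag; congr (_%:E * _)%E.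
  by rewrite indicE; case: (_ \in _); rewrite ?expr1n ?expr0n.
have intE : (\int[mu]_(xi in I) l2sqnorm (a xi) = \int[mu]_(xi in E) fiber_diag q xi)%E.
  rewrite -[in RHS](setIidr EI) integral_mkcondr; apply: eq_integral => xi _.
  by rewrite aE patchE indicE; case: (_ \in _); rewrite ?mul1e ?mul0e.
have [|h Lh hE] := field_Tper theta ma.
  apply: (@le_lt_trans _ _ (\int[mu]_(xi in I) 1)%E).
    apply: ge0_le_integral => //.
    - by move=> xi _; exact: l2sqnorm_ge0.
    - exact: measurable_l2sqnorm.
    move=> xi _; rewrite aE indicE; case: (_ \in _); rewrite ?mul1e ?mul0e ?lee_fin//.
    exact: fiber_diag_le1.
  have muI : (mu I < +oo)%E by rewrite lebesgue_measure_itv/=; case: ifP => _; rewrite ?ltry.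
  by rewrite integral_cst// mul1e; exact: muI.
have Pd xi : J xi (P xi (unit_seq R q)) by exact: (proj_in (pP xi) (l2_unit_seq R q)).
have Vh : V h.
  rewrite VE; split => //; apply: ae_period.
    apply: aeS hE => xi e /e ->; have [_ J0 Jlin _] := cJ xi.
    have := Jlin (\1_E xi)%:C _ _ (Pd xi) J0; congr J.
    by apply/funext => q'; rewrite addr0.
  by move=> xi s Jh; rewrite perJ Tper_shift; exists (Tper theta h xi).
exists h; split => //; last first.
  rewrite -intE -(Tper_sqnorm theta Lh); apply: ae_eq_integral => //.
  - by apply: measurable_l2sqnorm => // q'; exact: cmeasurable_Tper.
  - exact: measurable_l2sqnorm.
  - by apply: aeS hE => xi e /e ->.
move=> g Vg; have Lg := range_L2n Vg; apply/eqP; rewrite eq_sym -subr_eq0 -dotnBl//.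
have -> : (fun i x => F i x - h i x) = fun i x => -1 * h i x + F i x.
  by apply/funext => i; apply/funext => x; rewrite mulN1r addrC.
apply/eqP; apply: fiber_orth => //; first exact: L2n_lin.
have aeg : {ae mu, forall xi, J xi (Tper theta g xi)} by move: Vg; rewrite VE => -[].
have := test_vector_Tper EI tF; have := Tper_lin theta (-1) Lh LF.
move=> h1 h2; have h12 : {ae mu, forall xi, I xi -> Tper theta (fun i x => -1 * h i x + F i x) xi =
    fun q' => (\1_E xi)%:C * (unit_seq R q q' - P xi (unit_seq R q) q')}.
  apply: (aeS2 _ h1 (aeS2 _ h2 hE)); last first.
    by move=> xi; exact: (fun x y => conj x y).
  move=> xi e1 [e2 e3] xiI; rewrite e1 (e2 xiI) (e3 xiI); apply/funext => q'.
  by rewrite /a; ring.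
apply: aeS2 aeg h12 => xi Jg e xiI; rewrite (e xiI).
have ld := l2_unit_seq R q; have lP := subspace_l2 (cJ xi) (Pd xi); have lg := subspace_l2 (cJ xi) Jg.
have ldP := ip_sub ip2 ld lP.
split => //; first exact: (ip_scale ip2 _ ldP).
rewrite (ip_dotZl ip2 _ ldP lg).
by have [_ /(_ _ Jg) ->] := pP xi ld; rewrite mulr0.
Qed.

End Projection.

(** * The trace from the tight frame *)

Section Frame.
Context (R : realType) (N n : nat) (sigma : {perm 'I_n}) (theta : 'I_n -> R).
Context (hN : (2 <= N)%N) (p : nat) (psi : 'I_p -> vec R n).
Context (hpsi : semiorthogonal_wavelet N sigma theta psi).
Local Notation mu := (@lebesgue_measure R).
Local Notation I := (`[- pi, pi[%classic : set R).
Local Notation shz := (shiftz theta).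
Local Notation dlz := (@dilationz R N n sigma).
Local Notation V := (core_space N sigma theta psi).

Let N0 : (0 < N)%N. Proof. exact: ltn_trans hN. Qed.
Let NR0 : 0 < N%:R :> R. Proof. by rewrite ltr0n. Qed.
Let NX0 l : 0 < N%:R ^+ l :> R. Proof. by rewrite exprn_gt0. Qed.
Let P2 : 0 < 2 * pi :> R. Proof. by rewrite mulr_gt0// pi_gt0. Qed.
Let n0 (z : R[i]) : (0 <= (normsq z)%:E)%E. Proof. by rewrite lee_fin normsq_ge0. Qed.

Let Lpsi a : L2n (psi a). Proof. by case: hpsi. Qed.

Lemma L2n_wavelet j k a : L2n (dlz j (shz k (psi a))).
Proof. by apply: L2n_dilationz => //; exact: L2n_shiftz. Qed.

Lemma core_wavelet (j k : int) a : 0 < j -> V (dlz j (shz k (psi a))).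
Proof. by move=> j0; apply: sub_clspan (L2n_wavelet j k a) _; exists j, k, a; rewrite oppr0. Qed.

(** The generators of the core space have dilation index m > 0, hence lie in a space W other than
    the one of index - j. *)
Lemma core_orth (j k : int) a h : j <= 0 -> V h -> dotn h (dlz j (shz k (psi a))) = 0.
Proof.
move=> j0; have Lg := L2n_wavelet j k a; apply: clspan_orth => //.
  by move=> _ [m [k' [b [_ ->]]]]; exact: L2n_wavelet.
move=> _ [m [k' [b [m0 ->]]]]; case: hpsi => _ _ _ orth.
have mj : - m != - j by rewrite eqr_opp gt_eqF//; apply: le_lt_trans j0 _; rewrite -oppr0.
apply: (orth _ _ mj).
  by apply: sub_clspan (L2n_wavelet m k' b) _; exists k', b; rewrite opprK.
by apply: sub_clspan Lg _; exists k, a; rewrite opprK.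
Qed.

Lemma esum_support (K K' : choiceType) (e : K -> K') (H : K' -> \bar R) : injective e ->
  (forall j, (0 <= H j)%E) -> (forall j, (forall i, e i <> j) -> H j = 0%E) ->
  (\esum_(j in [set: K']) H j = \esum_(i in [set: K]) H (e i))%E.
Proof.
move=> ie H0 Hz; rewrite (esumID (range e))// [X in (_ + X)%E]esum1 ?adde0; last first.
  by move=> j [_ /= hj]; apply: Hz => i ij; apply: hj; exists i.
by rewrite setTI esum_image// => x y _ _; exact: ie.
Qed.

(** Index l stands for the level l + 1. The sum over levels is placed outermost because the levels
    will be estimated one at a time. *)
Lemma core_frame h F : V h -> (forall g, V g -> dotn h g = dotn F g) ->
  (sqnormn h = \esum_(l in [set: nat]) \sum_(a < p)
     \esum_(k in [set: int]) (normsq (dotn F (dlz (Posz l.+1) (shz k (psi a)))))%:E)%E.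
Proof.
move=> Vh hF; have Lh : L2n h by case: Vh.
case: hpsi => _ _ tf _; rewrite -(tf h Lh) esum_sum; last first.
  by move=> l a _ _; apply: esum_ge0.
apply: eq_bigr => a _.
transitivity (\esum_(j in [set: int]) \esum_(k in [set: int])
    (normsq (dotn h (dlz j (shz k (psi a)))))%:E)%E.
  rewrite esum_esum//; congr esum; by apply/seteqP; split => // -[].
rewrite (@esum_support nat int (fun l => Posz l.+1)).
- by apply: eq_esum => l _; apply: eq_esum => k _; rewrite hF//; exact: core_wavelet.
- by move=> i j [].
- by move=> j; apply: esum_ge0.
move=> j hj; apply: esum1 => k _; rewrite core_orth ?normsq0//.
by case: j hj => [[|l] hl|l hl] //; have := hl l.
Qed.

(** Both integrals are additive over the cells of a grid of step delta, so estimates on short sets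
    extend to E. *)
Lemma integral_le_grid (E : set R) (G1 G2 : R -> \bar R) (delta : R) : 0 < delta ->
  measurable E -> measurable_fun E G1 -> measurable_fun E G2 ->
  (forall x, 0 <= G1 x)%E -> (forall x, 0 <= G2 x)%E ->
  (forall E' c, measurable E' -> E' `<=` E -> (forall x, E' x -> c <= x < c + delta) ->
    (\int[mu]_(x in E') G1 x <= \int[mu]_(x in E') G2 x)%E) ->
  (\int[mu]_(x in E) G1 x <= \int[mu]_(x in E) G2 x)%E.
Proof.
move=> d0 mE mG1 mG2 G10 G20 h.
pose D (k : int) : set R := `[delta * k%:~R, delta * k%:~R + delta[%classic.
have mD k : measurable (D k) by exact: measurable_itv.
have hD x : E x -> forall k, D k x <-> k = Num.floor (x / delta).
  move=> _ k; rewrite /D /= in_itv/=; split.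
    move=> /andP[h1 h2]; apply/esym/floor_def; rewrite intrD rmorph1.
    by rewrite ler_pdivlMr// ltr_pdivrMr//; move: h1 h2; move: k%:~R => q ? ?; apply/andP; split; lra.
  move=> ->; have /andP[] := floor_itv (x / delta).
  rewrite intrD rmorph1 ler_pdivlMr// ltr_pdivrMr//; move: (_%:~R) => q h1 h2.
  by apply/andP; split; lra.
rewrite (integral_partition mE mD hD mG1 G10) (integral_partition mE mD hD mG2 G20).
apply: le_esum => k _; apply: (h _ (delta * k%:~R)).
- exact: measurableI.
- by move=> x [].
- by move=> x [_]; rewrite /D /= in_itv.
Qed.

Context (J : R -> set (zseq R n)) (P : R -> zseq R n -> zseq R n).
Context (cJ : forall xi, closed_subspace (J xi)) (pP : forall xi, orth_proj (J xi) (P xi)).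
Context (mP : forall a b, l2 a -> l2 b -> cmeasurable setT (fun xi => l2dot (P xi a) b)).
Context (perJ : forall xi (k : int), J (xi + 2 * k%:~R * pi) = lambda (- k) @` J xi).
Context (VE : V = [set f | L2n f /\ {ae mu, forall xi, J xi (Tper theta f xi)}]).
Context (q : int * 'I_n).

Local Notation A := (fiber_diag P q).

(** Index l is the level m = l + 1 of the formula. *)
Definition frame_density (l : nat) (xi : R) : \bar R :=
  (\sum_(a < p) (dilate_density N sigma theta q l.+1 (psi a) xi)%:E)%E.

Local Notation beta := frame_density.

Let dd0 l a xi : (0 <= (dilate_density N sigma theta q l (psi a) xi)%:E)%E.
Proof. by rewrite lee_fin normsq_ge0. Qed.

Lemma frame_density_ge0 l xi : (0 <= beta l xi)%E.
Proof. by apply: sume_ge0. Qed.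

Lemma measurable_dilate_density l (f : vec R n) (D : set R) : L2n f ->
  measurable_fun D (fun xi => (dilate_density N sigma theta q l f xi)%:E).
Proof.
move=> Lf; apply: measurable_funTS; apply: emeasurable_normsq.
have mf := L2n_fourier_measurable ((sigma ^+ l)%g q.2) Lf.
have := cmeasurable_affine (N%:R ^+ l) (N%:R ^+ l * (- theta q.2 + 2 * q.1%:~R * pi)) mf.
by congr cmeasurable; apply/funext => x; congr fourier; ring.
Qed.

Lemma measurable_frame_density l D : measurable_fun D (beta l).
Proof.
apply: measurable_funTS; apply: emeasurable_sum => a.
exact: measurable_dilate_density.
Qed.

Let mA D : measurable_fun D A. Proof. exact: (measurable_fiber_diag cJ pP mP). Qed.

Let A0 xi : (0 <= A xi)%E. Proof. exact: fiber_diag_ge0. Qed.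

Let bnd0 l (E : set R) : (0 <= \int[mu]_(xi in E) beta l xi)%E.
Proof. by apply: integral_ge0 => xi _; exact: frame_density_ge0. Qed.

(** tau l is 2 pi times the frame sum at level l + 1. In the exponent l + 1 - M the subtraction is
    truncated: the factor is 1 as long as the dilate of E fits in one period, and afterwards bounds
    the number of periods. *)
Lemma frame_piece E c M : measurable E -> E `<=` I ->
  (forall x, E x -> c <= x < c + 2 * pi / N%:R ^+ M) ->
  exists tau : nat -> \bar R,
    [/\ (\int[mu]_(xi in E) A xi = \esum_(l in [set: nat]) tau l)%E,
        forall l, (0 <= tau l)%E,
        forall l, (l < M)%N -> tau l = (\int[mu]_(xi in E) beta l xi)%E &
        forall l, (tau l <= (N ^ (l.+1 - M))%N%:R%:E * \int[mu]_(xi in E) beta l xi)%E].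
Proof.
move=> mE EI hc; have [F tF] := test_vector_exists theta q mE EI.
have [h [Vh hF hA]] := range_projection cJ pP mP perJ VE mE EI tF.
pose T l a := (\esum_(k in [set: int]) (normsq (dotn F (dlz (Posz l.+1) (shz k (psi a)))))%:E)%E.
have T0 l a : (0 <= T l a)%E by apply: esum_ge0.
have iE l : (\int[mu]_(xi in E) beta l xi =
    \sum_(a < p) \int[mu]_(xi in E) (dilate_density N sigma theta q l.+1 (psi a) xi)%:E)%E.
  by rewrite ge0_integral_sum// => a; exact: measurable_dilate_density.
have cx x : E x -> c <= x by move=> /hc/andP[].
exists (fun l => (2 * pi)%:E * \sum_(a < p) T l a)%E; split.
- by rewrite -hA (core_frame Vh hF) esumZl ?ltW// => l; exact: sume_ge0.
- by move=> l; rewrite mule_ge0 ?sume_ge0// lee_fin ltW.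
- move=> l lM; rewrite iE ge0_sume_distrr//; apply: eq_bigr => a _.
  apply: (frame_sum_eq sigma N0 mE EI tF (Lpsi a) cx) => x /hc/andP[x1 x2].
  have x3 : (x - c) * N%:R ^+ M < 2 * pi by rewrite -ltr_pdivlMr// ltrBlDl.
  apply: le_lt_trans x3; rewrite mulrC ler_wpM2l ?subr_ge0//.
  by rewrite ler_weXn2l// ler1n.
- move=> l; rewrite iE ge0_sume_distrr// ge0_sume_distrr; last first.
    by move=> a _; apply: integral_ge0 => xi _.
  apply: lee_sum => a _; apply: (frame_sum_le sigma N0 mE EI tF (Lpsi a) cx) => x /[dup] Ex /hc/andP[x1 x2].
  have x3 : (x - c) * N%:R ^+ M < 2 * pi by rewrite -ltr_pdivlMr// ltrBlDl.
  have x0 : 0 <= x - c by rewrite subr_ge0.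
  have [lM|lM] := leqP l.+1 M.
    rewrite (_ : (l.+1 - M = 0)%N) ?expn0 ?mul1r; last by apply/eqP; rewrite subn_eq0.
    apply: le_lt_trans x3; rewrite mulrC ler_wpM2l//.
    by rewrite ler_weXn2l// ler1n.
  rewrite natrX -{1}(subnK (ltnW lM)) exprD -mulrA ltr_pM2l ?exprn_gt0//.
  by rewrite mulrC.
Qed.

(** For each M the first M levels are exact on cells of length 2 pi / N^M, and the others are
    nonnegative; then M tends to infinity. *)
Lemma integral_frame_lower E : measurable E -> E `<=` I ->
  (\esum_(l in [set: nat]) \int[mu]_(xi in E) beta l xi <= \int[mu]_(xi in E) A xi)%E.
Proof.
move=> mE EI; rewrite -nneseries_esumT//.
apply: lime_le; first by apply: is_cvg_nneseries => *.
apply: nearW => M; rewrite -ge0_integral_sum//; last 2 first.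
- by move=> l; exact: measurable_frame_density.
- by move=> l x _; exact: frame_density_ge0.
have d0 : 0 < 2 * pi / N%:R ^+ M :> R by rewrite divr_gt0.
apply: (integral_le_grid d0 mE) => //.
- by apply: emeasurable_sum => l; exact: measurable_frame_density.
- by move=> x; apply: sume_ge0 => l _; exact: frame_density_ge0.
move=> E' c mE' E'E hc.
have [tau [-> tau0 tauE _]] := frame_piece mE' (subset_trans E'E EI) hc.
rewrite ge0_integral_sum//; last 2 first.
- by move=> l; exact: measurable_frame_density.
- by move=> l x _; exact: frame_density_ge0.
rewrite -nneseries_esumT//; apply: le_trans (nneseries_lim_ge M (fun l _ _ => tau0 l)).
rewrite big_nat [leRHS]big_nat; apply: lee_sum => l /andP[_ lM].
by rewrite tauE.
Qed.

(** The weights of [frame_piece] do not depend on the cell, so its bound adds up over a grid. *)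
Lemma integral_frame_upper E M : measurable E -> E `<=` I ->
  (\int[mu]_(xi in E) A xi <=
   \esum_(l in [set: nat]) ((N ^ (l.+1 - M))%N%:R%:E * \int[mu]_(xi in E) beta l xi))%E.
Proof.
move=> mE EI; have w0 l : (0 <= (N ^ (l.+1 - M))%N%:R :> R) by [].
pose G xi := (\esum_(l in [set: nat]) ((N ^ (l.+1 - M))%N%:R%:E * beta l xi))%E.
have g0 l xi : (0 <= (N ^ (l.+1 - M))%N%:R%:E * beta l xi)%E.
  by rewrite mule_ge0 ?frame_density_ge0.
have mg l D : measurable_fun D (fun xi => (N ^ (l.+1 - M))%N%:R%:E * beta l xi)%E.
  by apply: measurable_funeM; exact: measurable_frame_density.
have iG (D : set R) : measurable D -> (\int[mu]_(xi in D) G xi =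
    \esum_(l in [set: nat]) ((N ^ (l.+1 - M))%N%:R%:E * \int[mu]_(xi in D) beta l xi))%E.
  move=> mD; transitivity (\esum_(l in [set: nat])
      \int[mu]_(xi in D) ((N ^ (l.+1 - M))%N%:R%:E * beta l xi))%E.
    by apply: integral_esum => // l; exact: mg.
  apply: eq_esum => l _.
  rewrite ge0_integralZl_EFin//; first by move=> xi _; exact: frame_density_ge0.
  exact: measurable_frame_density.
rewrite -iG//.
have d0 : 0 < 2 * pi / N%:R ^+ M :> R by rewrite divr_gt0.
apply: (integral_le_grid d0 mE) => //.
- by apply: emeasurable_esum.
- by move=> x; apply: esum_ge0 => l _.
move=> E' c mE' E'E hc.
have [tau [-> tau0 _ taule]] := frame_piece mE' (subset_trans E'E EI) hc.
by rewrite iG//; apply: le_esum => l _; exact: taule.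
Qed.

Let y (xi : R) := xi - theta q.2 + 2 * q.1%:~R * pi.

(** All components are included because the level m sees the component sigma^m (i), which varies
    with m; one integrable function then dominates every level. *)
Let Phi (z : R) : \bar R := (\sum_(a < p) \sum_(i < n) (normsq (fourier (psi a i) z))%:E)%E.

Let Phi0 z : (0 <= Phi z)%E.
Proof. by apply: sume_ge0 => a _; apply: sume_ge0. Qed.

Let mPhi D : measurable_fun D Phi.
Proof.
apply: measurable_funTS; apply: emeasurable_sum => a; apply: emeasurable_sum => i.
by apply: emeasurable_normsq; exact: L2n_fourier_measurable.
Qed.

Let Phi_fin : (\int[mu]_z Phi z < +oo)%E.
Proof.
rewrite ge0_integral_sum//; last 2 first.
- move=> a; apply: emeasurable_sum => i.
  by apply: emeasurable_normsq; exact: L2n_fourier_measurable.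
- by move=> a x _; apply: sume_ge0.
apply: lte_sum_pinfty => a _; rewrite ge0_integral_sum//; last first.
  by move=> i; apply: emeasurable_normsq; exact: L2n_fourier_measurable.
by apply: lte_sum_pinfty => i _; case: (fourier_L2 (Lpsi a i)).
Qed.

(* The dilates of a set inside the annulus c <= |y| < c N are disjoint, so the
   integrals add up to at most one integral of Phi. *)
Lemma frame_density_annulus E c : measurable E -> 0 < c ->
  (forall xi, E xi -> c <= `|y xi| < c * N%:R) ->
  (\esum_(l in [set: nat]) ((N%:R ^+ l.+1)%:E * \int[mu]_(xi in E) beta l xi) <= \int[mu]_z Phi z)%E.
Proof.
move=> mE c0 hE.
pose S l : set R := [set z | E (z / N%:R ^+ l.+1 + theta q.2 - 2 * q.1%:~R * pi)].
pose G l z := ((\1_(S l) z)%:E * \sum_(a < p) (normsq (fourier (psi a ((sigma ^+ l.+1)%g q.2)) z))%:E)%E.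
have mS l : measurable (S l).
  have := measurable_affine (N%:R ^+ l.+1)^-1 (theta q.2 - 2 * q.1%:~R * pi) measurableT mE.
  rewrite setTI; congr measurable; apply/seteqP; split => z; rewrite /S /=;
    by rewrite [_^-1 * z]mulrC addrA.
have ms l D : measurable_fun D (fun z => \sum_(a < p) (normsq (fourier (psi a ((sigma ^+ l.+1)%g q.2)) z))%:E)%E.
  apply: measurable_funTS; apply: emeasurable_sum => a.
  by apply: emeasurable_normsq; exact: L2n_fourier_measurable.
have G0 l z : (0 <= G l z)%E by rewrite mule_ge0 ?lee_fin// sume_ge0.
have mG l : measurable_fun setT (G l).
  by apply: emeasurable_funM => //; apply/measurable_EFinP; exact: measurable_indic.
have eq1 l : ((N%:R ^+ l.+1)%:E * \int[mu]_(xi in E) beta l xi = \int[mu]_z G l z)%E.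
  have := ge0_integral_affine (N%:R ^+ l.+1 * (- theta q.2 + 2 * q.1%:~R * pi)) (NX0 l.+1) (mG l) (G0 l).
  have -> : (\int[mu]_x G l (N%:R ^+ l.+1 * x + N%:R ^+ l.+1 * (- theta q.2 + 2 * q.1%:~R * pi))%R =
      \int[mu]_(xi in E) beta l xi)%E.
    rewrite [RHS]integral_mkcond; apply: eq_integral => x _; rewrite patchE /G -mulrDr indicE.
    have -> : (N%:R ^+ l.+1 * (x + (- theta q.2 + 2 * q.1%:~R * pi)) \in S l) = (x \in E).
      have e : N%:R ^+ l.+1 * (x + (- theta q.2 + 2 * q.1%:~R * pi)) / N%:R ^+ l.+1 + theta q.2 - 2 * q.1%:~R * pi = x.
        by rewrite mulrAC mulfV ?mul1r ?gt_eqF//; ring.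
      by apply/idP/idP; rewrite !inE /S /= e.
    case: (x \in E); last by rewrite mul0e.
    by rewrite mul1e /beta /frame_density /dilate_density addrA.
  by move=> ->; rewrite muleA -EFinM mulfV ?mul1e// gt_eqF.
under eq_esum do rewrite eq1.
rewrite -integral_esum//; apply: ge0_le_integral => //.
- by move=> z _; apply: esum_ge0.
- exact: emeasurable_esum.
- exact: mPhi.
move=> z _.
have GPhi l : (G l z <= Phi z)%E.
  rewrite /G indicE; case: (_ \in _); last by rewrite mul0e.
  rewrite mul1e; apply: lee_sum => a _; rewrite (bigD1 ((sigma ^+ l.+1)%g q.2))//= leeDl//.
  exact: sume_ge0.
have Sy l : S l z -> c * N%:R ^+ l.+1 <= `|z| < c * N%:R ^+ l.+2.
  move=> /hE; rewrite /y (_ : _ + 2 * q.1%:~R * pi = z / N%:R ^+ l.+1); last by ring.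
  rewrite normrM [`|_^-1|]gtr0_norm ?invr_gt0// ler_pdivlMr// ltr_pdivrMr// => /andP[-> h2].
  by apply: lt_le_trans h2 _; rewrite -mulrA -exprS.
have Sinj l l' : (l < l')%N -> S l z -> S l' z -> False.
  move=> ll /Sy/andP[_ h1] /Sy/andP[h2 _]; have := le_lt_trans h2 h1.
  by rewrite ltr_pM2l// ltNge ler_weXn2l// ler1n.
have [[l Sl]|none] := pselect (exists l, S l z).
  rewrite -[leRHS](@esum_single R _ l)//; apply: le_esum => l' _.
  have [->//|ll'] := eqVneq l' l; rewrite /G indicE memNset ?mul0e// => Sl'.
  have : (l' < l)%N || (l < l')%N by rewrite -neq_ltn.
  by case/orP => h; [exact: (Sinj _ _ h Sl' Sl)|exact: (Sinj _ _ h Sl Sl')].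
rewrite esum1// => l _; rewrite /G indicE memNset ?mul0e// => Sl.
by apply: none; exists l.
Qed.

Lemma integral_frame_annulus E c : measurable E -> E `<=` I -> 0 < c ->
  (forall xi, E xi -> c <= `|y xi| < c * N%:R) ->
  (\int[mu]_(xi in E) A xi = \esum_(l in [set: nat]) \int[mu]_(xi in E) beta l xi)%E.
Proof.
move=> mE EI c0 hE; apply/eqP; rewrite eq_le integral_frame_lower// andbT.
apply/lee_addgt0Pr => e e0.
have K0 := frame_density_annulus mE c0 hE.
set K := (\int[mu]_z Phi z)%E in K0.
have Kpos : (0 <= K)%E by apply: integral_ge0.
have Kfin : K \is a fin_num by rewrite ge0_fin_numE// Phi_fin.
(* N^M > M > K / e, so that N^-M K < e. *)
pose M := (Num.truncn (fine K / e)).+1.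
have NM : fine K / e < N%:R ^+ M.
  apply: lt_trans (truncnS_gt _) _; rewrite -/M -natrX ltr_nat; exact: ltn_expl.
apply: le_trans (integral_frame_upper M mE EI) _.
(* N^(l + 1 - M), truncated, is at most 1 + N^-M N^(l + 1). The 1 gives the sum wanted, the rest is
   bounded by N^-M K through [frame_density_annulus]. *)
apply: (@le_trans _ _ (\esum_(l in [set: nat]) (\int[mu]_(xi in E) beta l xi +
    (N%:R ^- M)%:E * ((N%:R ^+ l.+1)%:E * \int[mu]_(xi in E) beta l xi)))%E).
  apply: le_esum => l _; rewrite muleA -EFinM.
  rewrite -[X in (_ <= X + _)%E]mul1e -ge0_muleDl ?lee_fin ?mulr_ge0 ?invr_ge0 ?(ltW (NX0 _))//.
  apply: lee_wpmul2r => //; rewrite lee_fin.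
  have [lM|lM] := leqP l.+1 M.
    rewrite (_ : (l.+1 - M = 0)%N) ?expn0 ?lerDl ?mulr_ge0 ?invr_ge0 ?(ltW (NX0 _))//.
    by apply/eqP; rewrite subn_eq0.
  rewrite natrX -{2}(subnK (ltnW lM)) exprD mulrCA mulVf ?mulr1 ?lerDr//.
  by rewrite gt_eqF.
have i0 : (0 <= N%:R ^- M :> R) by rewrite invr_ge0 ltW.
rewrite esumD; last 2 first.
- by move=> l _.
- by move=> l _; rewrite !mule_ge0 ?lee_fin ?(ltW (NX0 _)).
rewrite leeD2l// esumZl//; last by move=> l; rewrite mule_ge0 ?lee_fin ?(ltW (NX0 _)).
apply: le_trans (lee_wpmul2l _ K0) _; first by rewrite lee_fin.
rewrite -(fineK Kfin) -EFinM lee_fin mulrC ler_pdivrMr//.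
by move: NM; rewrite ltr_pdivrMr// mulrC => /ltW.
Qed.

(** Equality of the integrals over all measurable subsets of an annulus gives equality almost
    everywhere in it. Annuli with rational c > 0 are countably many and cover all xi except the zero
    of y. *)
Lemma fiber_diag_frame :
  {ae mu, forall xi, I xi -> A xi = (\esum_(l in [set: nat]) beta l xi)%E}.
Proof.
pose D (c : rat) : set R := I `&` [set xi | ratr c <= `|y xi| < ratr c * N%:R].
have my : measurable_fun setT (fun xi : R => `|y xi|).
  apply: measurableT_comp => //; apply: measurable_funD => //; exact: measurable_funD.
have mD c : measurable (D c : set (measurableTypeR R)).
  apply: measurableI; first exact: measurable_itv.
  have := my measurableT `[ratr c, ratr c * N%:R[%classic (measurable_itv _).
  rewrite setTI; congr measurable; apply/seteqP; split => xi; by rewrite /= in_itv.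
have mB : measurable_fun setT (fun xi => \esum_(l in [set: nat]) beta l xi)%E.
  by apply: emeasurable_esum => // [l|l xi]; [exact: measurable_frame_density|exact: frame_density_ge0].
have hD (c : rat) : {ae mu, forall xi, 0 < (ratr c : R) -> D c xi -> A xi = (\esum_(l in [set: nat]) beta l xi)%E}.
  have [c0|c0] := boolP (0 < (ratr c : R)); last by apply: aeT => xi.
  have iA : mu.-integrable (D c) A.
    apply/integrableP; split; first exact: mA.
    under eq_integral do rewrite gee0_abs//.
    apply: (@le_lt_trans _ _ (\int[mu]_(xi in D c) 1)%E).
      apply: ge0_le_integral => //; first exact: mA.
      by move=> xi _; exact: (fiber_diag_le1 cJ pP).
    have -> : (\int[mu]_(x in D c) 1 = 1 * mu (D c))%E by apply: integral_cst; exact: mD.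
    rewrite mul1e; apply: (@le_lt_trans _ _ (mu I)).
      apply: le_measure; rewrite ?inE; [exact: mD|exact: measurable_itv|by move=> x []].
    by rewrite lebesgue_measure_itv/=; case: ifP => _; rewrite ?ltry.
  have := integral_ae_eq (mD c) iA (measurable_funTS mB).
  move=> /(_ _)/aeS; apply; first by move=> xi /= h _; exact: h.
  move=> E ED mE; have EI : E `<=` I by move=> xi /ED[].
  transitivity (\esum_(l in [set: nat]) \int[mu]_(xi in E) beta l xi)%E.
    by apply: (integral_frame_annulus mE EI c0) => xi /ED[].
  apply/esym; apply: integral_esum => // [l|l xi]; first exact: measurable_frame_density.
  exact: frame_density_ge0.
have y0 : {ae mu, forall xi, y xi != 0}.
  exists [set theta q.2 - 2 * q.1%:~R * pi]; split => //; first exact: lebesgue_measure_set1.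
  move=> xi /= /negP; rewrite negbK => /eqP; rewrite /y => e.
  by apply/eqP; rewrite -subr_eq0 -e; apply/eqP; ring.
have := ae_forall_count hD; apply: aeS2 y0 => xi yn h xiI.
have ypos : 0 < `|y xi| by rewrite normr_gt0.
(* Any rational c strictly between |y| / N and |y| gives c < |y| < c N. *)
have lt : `|y xi| / N%:R < `|y xi| by rewrite ltr_pdivrMr// ltr_pMr// ltr1n.
have [c] := rat_in_itvoo lt; rewrite in_itv/= ltr_pdivrMr// => /andP[c1 c2].
apply: (h c); last by split => //=; rewrite ltW.
by rewrite -(pmulr_lgt0 _ NR0); exact: lt_trans c1.
Qed.

End Frame.

(** * The trace from the multiplicity function *)

Section Multiplicity.
Context (R : realType) (n : nat) (theta : 'I_n -> R).
Local Notation mu := (@lebesgue_measure R).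
Local Notation I := (`[- pi, pi[%classic : set R).
Local Notation shz := (shiftz theta).
Implicit Types (f : vec R n).

Let ip := inner_product_L2 R.
Let P2 : 0 < 2 * pi :> R. Proof. by rewrite mulr_gt0// pi_gt0. Qed.
Let n0 (z : R[i]) : (0 <= (normsq z)%:E)%E. Proof. by rewrite lee_fin normsq_ge0. Qed.
Let mI : measurable (I : set (measurableTypeR R)). Proof. exact: measurable_itv. Qed.
Let muI : (mu I < +oo)%E.
Proof. by rewrite lebesgue_measure_itv/=; case: ifP => _; rewrite ?ltry. Qed.
Let eI : `[- pi, - pi + 2 * pi[%classic = I :> set R.
Proof. by rewrite (_ : - pi + 2 * pi = pi)//; ring. Qed.

Lemma exchange_esum (K K' : choiceType) (a : K -> K' -> \bar R) : (forall i j, (0 <= a i j)%E) ->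
  (\esum_(i in [set: K]) \esum_(j in [set: K']) a i j =
   \esum_(j in [set: K']) \esum_(i in [set: K]) a i j)%E.
Proof.
move=> a0; rewrite !esum_esum//.
have -> : [set: K] `*`` (fun=> [set: K']) = [set: K * K'] by apply/seteqP; split => // -[].
have -> : [set: K'] `*`` (fun=> [set: K]) = [set: K' * K] by apply/seteqP; split => // -[].
rewrite (@esum_support R _ _ (fun x : K' * K => (x.2, x.1)))//.
  by move=> [x y] [x' y'] [-> ->].
by move=> -[x y] /(_ (y, x)).
Qed.

Lemma esum_lt_nat (d : nat) :
  (\esum_(l in [set: nat]) (if (l < d)%N then 1 else 0) = d%:R%:E :> \bar R)%E.
Proof.
elim: d => [|d IH]; first by rewrite esum1.
transitivity (\esum_(l in [set: nat]) ((if (l < d)%N then 1 else 0) + (if l == d then 1 else 0)) : \bar R)%E.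
  apply: eq_esum => l _; rewrite ltnS leq_eqVlt orbC.
  by have [->|_] := eqVneq l d; rewrite ?ltnn ?add0e// orbF adde0.
rewrite esumD; [|by move=> l _; case: ifP|by move=> l _; case: ifP].
by rewrite IH esum_single// -EFinD natr1.
Qed.

Context (V : set (vec R n)) (J : R -> set (zseq R n)) (P : R -> zseq R n -> zseq R n).
Context (cJ : forall xi, closed_subspace (J xi)) (pP : forall xi, orth_proj (J xi) (P xi)).
Context (mP : forall a b, l2 a -> l2 b -> cmeasurable setT (fun xi => l2dot (P xi a) b)).
Context (perJ : forall xi (k : int), J (xi + 2 * k%:~R * pi) = lambda (- k) @` J xi).
Context (VE : V = [set f | L2n f /\ {ae mu, forall xi, J xi (Tper theta f xi)}]).

Let LV f : V f -> L2n f. Proof. by rewrite VE => -[]. Qed.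

(** [Tper_shiftz] carries the dilation parameters of its section; N = 1 and the identity permutation
    are put in. *)
Let Tsh k f := @Tper_shiftz R 1 n 1%g theta isT k f.

Lemma range_lin (c : R[i]) f g : V f -> V g -> V (fun i x => c * f i x + g i x).
Proof.
rewrite VE => -[Lf Jf] [Lg Jg]; split; first exact: L2n_lin.
have := aeS2 (fun _ x y => conj x y) Jf Jg; have := Tper_lin theta c Lf Lg.
apply: aeS2 => xi -> [jf jg]; have [_ _ Jlin _] := cJ xi; exact: Jlin.
Qed.

Lemma range_shiftz k f : V f -> V (shz k f).
Proof.
rewrite VE => -[Lf Jf]; split; first exact: L2n_shiftz.
have := Tsh k Lf; apply: aeS2 Jf => xi jf ->.
have [_ J0 Jlin _] := cJ xi; have := Jlin (expi (- (k%:~R * xi))) _ _ jf J0.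
by congr J; apply/funext => q; rewrite addr0.
Qed.

Context (m : R -> \bar R) (JJ : vec R n -> nat -> R -> R[i]).
Context (mm : measurable_fun I m).
Context (m_nat : forall xi, xi \in `[- pi, pi[ -> m xi = +oo%E \/ exists d : nat, m xi = d%:R%:E).
Context (JJ_dsum : forall f, V f -> dsum m (JJ f)).
Context (JJ_lin : forall (c : R[i]) f g, V f -> V g ->
  dsum_eq m (JJ (fun i x => c * f i x + g i x)) (fun j xi => c * JJ f j xi + JJ g j xi)).
Context (JJ_iso : forall f, V f -> dsum_sqnorm m (JJ f) = sqnormn f).
Context (JJ_onto : forall h, dsum m h -> exists2 f, V f & dsum_eq m (JJ f) h).
Context (JJ_shift : forall (k : int) f, V f ->
  dsum_eq m (JJ (shz k f)) (fun j xi => expi (- (k%:~R * xi)) * JJ f j xi)).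

Local Notation S j := (level m j).

Lemma measurable_level j : measurable (S j : set (measurableTypeR R)).
Proof.
have := emeasurable_fun_c_infty mI mm j%:R%:E; congr measurable.
Qed.

Let mS := measurable_level.

Let SI j : S j `<=` I. Proof. by move=> xi []. Qed.

(** Summands are numbered from 1, so l stands for the summand l + 1 throughout. *)
Lemma dsum_sqnormE (g : nat -> R -> R[i]) :
  dsum_sqnorm m g = (\esum_(l in [set: nat]) sqnorm (S l.+1) (g l.+1))%E.
Proof.
have s0 l : (0 <= sqnorm (S l.+1) (g l.+1))%E by exact: sqnorm_ge0.
rewrite /dsum_sqnorm -nneseries_esumT// -(@nneseries_addn R _ 1); last first.
  by move=> l; exact: sqnorm_ge0.
by apply: eq_eseriesr => l _; rewrite addn1.
Qed.

Definition level_part j (phi : R -> R[i]) (xi : R) : R[i] := (\1_(S j) xi)%:C * phi xi.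

Lemma level_part_supported j phi : supported I (level_part j phi).
Proof.
by move=> xi xiI; rewrite /level_part indicE memNset ?mul0r// => /SI.
Qed.

Lemma L2_level_part f l : V f -> L2 (level_part l.+1 (JJ f l.+1)).
Proof.
move=> Vf; have [mf ff] := JJ_dsum Vf; split.
  by apply/(cmeasurable_mkcond _ (mS l.+1)); exact: mf.
rewrite -sqnorm_mkcond; apply: le_lt_trans ff; rewrite dsum_sqnormE.
rewrite (esumID [set l])//; last by move=> j _; exact: sqnorm_ge0.
rewrite setTI esum_set1 ?sqnorm_ge0// leeDl// esum_ge0// => j _; exact: sqnorm_ge0.
Qed.

(** f is a preimage under the unitary of phi placed in the summand l + 1, with 0 in the others. *)
Definition concentrated f l (phi : R -> R[i]) : Prop :=
  V f /\ dsum_eq m (JJ f) (fun j => if j == l.+1 then phi else fun=> 0).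

Let sqnorm0 D : sqnorm D (fun _ : R => 0 : R[i]) = 0%E.
Proof. by rewrite /sqnorm; under eq_integral do rewrite normsq0; rewrite integral0. Qed.

Lemma concentrated_exists l phi : cmeasurable setT phi -> L2 (level_part l.+1 phi) ->
  exists f, concentrated f l phi.
Proof.
move=> mphi Lc; pose g j := if j == l.+1 then phi else fun=> 0.
have [|f Vf e] := @JJ_onto g; last by exists f.
split; first by move=> j _; rewrite /g; case: eqP => _; [exact: cmeasurableS mphi|exact: cmeasurable_cst].
rewrite dsum_sqnormE (_ : esum _ _ = sqnorm (S l.+1) phi); first by rewrite sqnorm_mkcond; case: Lc.
rewrite -[RHS](@esum_single R _ l); last exact: sqnorm_ge0.
by apply: eq_esum => j _; rewrite /g eqSS; case: eqP => [->|].
Qed.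

Let eq_level j (g h : R -> R[i]) : cmeasurable (S j) g -> cmeasurable (S j) h ->
  {ae mu, forall xi, S j xi -> g xi = h xi} -> sqnorm (S j) g = sqnorm (S j) h.
Proof. exact: (eq_sqnorm_ae (mS j)). Qed.

Lemma concentrated_sqnorm f l phi : cmeasurable setT phi -> concentrated f l phi ->
  sqnormn f = sqnorm (S l.+1) phi.
Proof.
move=> mphi [Vf e]; rewrite -JJ_iso// dsum_sqnormE; have [mf _] := JJ_dsum Vf.
rewrite -[RHS](@esum_single R _ l); last exact: sqnorm_ge0.
apply: eq_esum => j _; have := e j.+1 isT; rewrite eqSS; case: eqP => [->|_] {}e.
  by apply: eq_level => //; [exact: mf|exact: cmeasurableS mphi].
by rewrite -(sqnorm0 (S j.+1)); apply: eq_level; [exact: mf|exact: cmeasurable_cst|exact: e].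
Qed.

(** Polarization of [JJ_iso]. The number x collects the summands other than l + 1, where c f + g and
    g have the same image; it cancels in the difference of squared norms. *)
Lemma concentrated_dot f g l phi : cmeasurable setT phi -> L2 (level_part l.+1 phi) ->
  concentrated f l phi -> V g -> dotn f g = cdot (level_part l.+1 phi) (level_part l.+1 (JJ g l.+1)).
Proof.
move=> mphi Lphi cf Vg; have [Vf e] := cf; have [Lf Lg] := (LV Vf, LV Vg).
have Lj := L2_level_part l Vg.
apply: dotn_of_nn => // c; have Vc := range_lin c Vf Vg; have Lc := LV Vc.
have [mc _] := JJ_dsum Vc; have [mf _] := JJ_dsum Vf; have [mg _] := JJ_dsum Vg.
pose x := (\esum_(j in ~` [set l]) sqnorm (S j.+1) (JJ g j.+1))%E.
have x0 : (0 <= x)%E by apply: esum_ge0 => j _; exact: sqnorm_ge0.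
have sg : (Re (dotn g g))%:E = (sqnorm setT (level_part l.+1 (JJ g l.+1)) + x)%E.
  rewrite dotn_sqnormn// -JJ_iso// dsum_sqnormE (esumID [set l]); last by move=> j _; exact: sqnorm_ge0.
  by rewrite setTI setTI esum_set1 ?sqnorm_ge0// sqnorm_mkcond.
have sc : (Re (dotn (fun i x => c * f i x + g i x) (fun i x => c * f i x + g i x)))%:E =
    (sqnorm setT (fun xi => c * level_part l.+1 phi xi + level_part l.+1 (JJ g l.+1) xi)%R + x)%E.
  rewrite dotn_sqnormn// -JJ_iso// dsum_sqnormE (esumID [set l]); last by move=> j _; exact: sqnorm_ge0.
  rewrite setTI setTI esum_set1 ?sqnorm_ge0//; congr (_ + _)%E.
    rewrite (eq_level (h := fun xi => c * phi xi + JJ g l.+1 xi)).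
    - by rewrite sqnorm_mkcond; congr sqnorm; apply/funext => xi; rewrite /level_part; ring.
    - exact: mc.
    - apply: cmeasurableD; last exact: mg.
      by apply: cmeasurableZ; exact: cmeasurableS mphi.
    have := JJ_lin c Vf Vg (isT : (0 < l.+1)%N); have := e l.+1 isT; rewrite eqxx.
    by apply: aeS2 => xi h1 h2 Sx; rewrite h2// h1.
  apply: eq_esum => j jl; apply: eq_level; [exact: mc|exact: mg|].
  have := JJ_lin c Vf Vg (isT : (0 < j.+1)%N); have := e j.+1 isT.
  rewrite eqSS; case: eqP => [jl'|_]; first by case: (jl jl').
  by apply: aeS2 => xi h1 h2 Sx; rewrite h2// h1// mulr0 add0r.
have sf : (Re (dotn f f))%:E = sqnorm setT (level_part l.+1 phi).
  by rewrite dotn_sqnormn// (concentrated_sqnorm mphi cf) sqnorm_mkcond.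
have Lcj := L2_lin c Lphi Lj.
have xfin : x \is a fin_num.
  rewrite ge0_fin_numE//; have : ((Re (dotn g g))%:E < +oo)%E by rewrite ltry.
  by rewrite sg; apply: le_lt_trans; rewrite leeDr// sqnorm_ge0.
have {}sg : Re (dotn g g) = Re (cdot (level_part l.+1 (JJ g l.+1)) (level_part l.+1 (JJ g l.+1))) + fine x.
  by apply: EFin_inj; rewrite EFinD sg (fineK xfin) -(cdot_sqnorm Lj).
have {}sf : Re (dotn f f) = Re (cdot (level_part l.+1 phi) (level_part l.+1 phi)).
  by apply: EFin_inj; rewrite sf -(cdot_sqnorm Lphi).
set nc := Re _ in sc *.
have {}sc : nc = Re (cdot (fun xi => c * level_part l.+1 phi xi + level_part l.+1 (JJ g l.+1) xi)
    (fun xi => c * level_part l.+1 phi xi + level_part l.+1 (JJ g l.+1) xi)) + fine x.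
  by apply: EFin_inj; rewrite EFinD sc (fineK xfin) -(cdot_sqnorm Lcj).
rewrite sc (ip_nnD ip c Lphi Lj) sg sf.
move: (Re (cdot _ _)) (Re (cdot (level_part _ phi) (level_part _ phi))) (fine x) => s t u.
by move: (Re _) => v; ring.
Qed.

Lemma concentrated_shift f l phi k : concentrated f l phi ->
  concentrated (shz k f) l (fun xi => expi (- (k%:~R * xi)) * phi xi).
Proof.
move=> [Vf e]; split; first exact: range_shiftz.
move=> j j1; have := JJ_shift k Vf j1; have := e j j1.
apply: aeS2 => xi h1 h2 Sx; rewrite h2// h1//.
by case: eqP => _ //; rewrite mulr0.
Qed.

Let mph (k : int) : measurable_fun setT (fun x : R => - (k%:~R * x)).
Proof. by apply: measurable_funN; exact: measurable_funM. Qed.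

Let level_part_expi l phi k : level_part l (fun xi => expi (- (k%:~R * xi)) * phi xi) =
  fun xi => expi (- (k%:~R * xi)) * level_part l phi xi.
Proof. by apply/funext => xi; rewrite /level_part mulrCA. Qed.

(** Shifting f multiplies phi by exp (- i k xi), so the inner products with all shifts are the
    Fourier coefficients of one function on [-pi, pi). *)
Let conc_shift_dot f l phi k g : cmeasurable setT phi -> L2 (level_part l.+1 phi) ->
  concentrated f l phi -> V g ->
  dotn (shz k f) g = fourierL1 (fun xi => level_part l.+1 phi xi * conjc (level_part l.+1 (JJ g l.+1) xi)) k%:~R.
Proof.
move=> mphi Lphi cf Vg.
have mphi' : cmeasurable setT (fun xi => expi (- (k%:~R * xi)) * phi xi).
  by apply: cmeasurableM => //; exact: cmeasurable_expi.
have Lphi' : L2 (level_part l.+1 (fun xi => expi (- (k%:~R * xi)) * phi xi)).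
  by rewrite level_part_expi; exact: L2_expi.
rewrite (concentrated_dot mphi' Lphi' (concentrated_shift k cf) Vg) level_part_expi.
by congr cintegral; apply/funext => xi; ring.
Qed.

Let L2_level_part_bounded l phi : cmeasurable setT phi -> (forall xi, normsq (phi xi) <= 1) ->
  L2 (level_part l phi).
Proof.
move=> mphi p1; have Ll : L2 (fun x => (\1_(S l) x)%:C : R[i]).
  have Sfin : (mu (S l) < +oo)%E.
    apply: (@le_lt_trans _ _ (mu I)); last exact: muI.
    by apply: le_measure; rewrite ?inE; [exact: mS|exact: mI|exact: SI].
  by have := L2_cst_indic 1 (mS l) Sfin; congr L2; apply/funext => x; rewrite mulr1.
apply: (L2_le _ Ll); first by apply: cmeasurableM => //; apply: cmeasurable_indic; exact: mS.
by move=> xi; rewrite /level_part normsqM ler_piMr ?normsq_ge0.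
Qed.

(* The Fourier coefficients on [-pi, pi) of the q-th fiber component of f are
   inner products with the projections of shifted test vectors. *)
Lemma concentrated_Tper f l phi q F (G : vec R n) :
  cmeasurable setT phi -> (forall xi, normsq (phi xi) <= 1) -> concentrated f l phi ->
  V G -> test_vector theta I q F -> (forall g, V g -> dotn G g = dotn F g) ->
  {ae mu, forall xi, I xi -> Tper theta f xi q =
     (2 * pi)%:C * (level_part l.+1 phi xi * conjc (level_part l.+1 (JJ G l.+1) xi))}.
Proof.
move=> mphi p1 cf VG tF hG; have Lphi := L2_level_part_bounded l.+1 mphi p1; have [Vf _] := cf.
have Lf := LV Vf; have LG := LV VG.
pose w xi := level_part l.+1 phi xi * conjc (level_part l.+1 (JJ G l.+1) xi).
have Lw : L2 w.
  apply: (L2_le _ (L2J (L2_level_part l VG))).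
    apply: cmeasurableM; first exact: L2_measurable.
    by apply: cmeasurableJ; apply: L2_measurable; exact: L2_level_part.
  move=> xi; rewrite /w normsqM ler_piMl ?normsq_ge0// /level_part normsqM normsqR.
  rewrite indicE; case: (_ \in _); rewrite ?expr1n ?mul1r//.
  by rewrite expr0n mul0r.
have sw : supported I w by move=> xi xiI; rewrite /w level_part_supported// mul0r.
pose T xi := (\1_I xi)%:C * Tper theta f xi q.
have LT : L2 (fun xi => Tper theta f xi q).
  have := L2_affine (- theta q.2 + 2 * q.1%:~R * pi) ltr01 (fourier_L2 (Lf q.2)).
  by congr L2; apply/funext => x; rewrite mul1r /Tper addrA.
have LT' : L2 T by exact: L2_indic.
have sT : supported I T by move=> xi xiI; rewrite /T indicE memNset// mul0r.
have cint (g : R -> R[i]) : L2 g -> supported I g -> cintegrable g.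
  by move=> Lg; rewrite -eI; exact: L2_supported_cintegrable.
have coefs (k : int) : fourierL1 T k%:~R = (2 * pi)%:C * fourierL1 w k%:~R.
  have Vk := range_shiftz k Vf; have Lk := LV Vk.
  have h1 : dotn F (shz k f) = conjc (fourierL1 w k%:~R).
    by rewrite -(hG _ Vk) (dotnC Lk LG) (conc_shift_dot k mphi Lphi cf VG).
  have := test_vector_dot mI (@subset_refl _ I) tF Lk; rewrite h1.
  have -> : cintegral (fun xi => (\1_I xi)%:C * conjc (Tper theta (shz k f) xi q)) =
      conjc (fourierL1 T k%:~R).
    rewrite /fourierL1 -cintegralJ; apply: eq_cintegral_ae.
    - apply: cmeasurableM; first exact: cmeasurable_indic.
      by apply: cmeasurableJ; exact: cmeasurable_Tper.
    - apply: cmeasurableJ; apply: cmeasurableM; first exact: L2_measurable.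
      exact: cmeasurable_expi.
    have := Tsh k Lf; apply: aeS => xi ->; rewrite /T.
    move: (expi _) (Tper _ _ _ _) (\1_I xi) => z1 z2 r.
    by apply: eqcP; rewrite !cE /=; ring.
  move=> h2; apply: (can_inj (@conjcK R)); rewrite -h2.
  by apply: eqcP; rewrite !cE /=; ring.
have Lwc := L2Z (2 * pi)%:C Lw; have LD := L2B LT' Lwc.
have sD : supported I (fun xi => T xi - (2 * pi)%:C * w xi).
  by move=> xi xiI; rewrite sT// sw// mulr0 subr0.
have D0 : sqnorm setT (fun xi => T xi - (2 * pi)%:C * w xi) = 0%E.
  have sD' := sD; rewrite -eI in sD'; have := parseval LD sD'.
  rewrite esum1; last first.
    move=> k _; have := fourierL1_lin (- (2 * pi)%:C) (cint _ Lw sw) (cint _ LT' sT).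
    have -> : (fun x => - (2 * pi)%:C * w x + T x) = fun xi => T xi - (2 * pi)%:C * w xi.
      by apply/funext => x; rewrite mulNr addrC.
    by move=> ->; rewrite coefs mulNr addNr normsq0.
  move/esym/eqP; rewrite mule_eq0 eqe gt_eqF//= => /eqP; exact.
have := sqnorm_eq0 measurableT (L2_measurable LD) D0; apply: aeS => xi /(_ Logic.I).
move=> + xiI; rewrite /T indicE mem_set// mul1r => /eqP.
by rewrite subr_eq0 => /eqP ->.
Qed.

Let one (_ : R) : R[i] := 1.

Let mone : cmeasurable setT one. Proof. exact: cmeasurable_cst. Qed.

Let one1 xi : normsq (one xi) <= 1. Proof. by rewrite normsq1. Qed.

(** With phi = 1 the shifts of [f l] become the exponentials cut off to the level set of l + 1.
    Parseval's identity in each summand makes all of them a tight frame of V with bound 2 pi. *)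
Lemma concentrated_frame (f : nat -> vec R n) h : (forall l, concentrated (f l) l one) -> V h ->
  (\esum_(l in [set: nat]) \esum_(k in [set: int]) (normsq (dotn h (shz k (f l))))%:E =
   (2 * pi)%:E * sqnormn h)%E.
Proof.
move=> cf Vh; rewrite -(JJ_iso Vh) dsum_sqnormE -esumZl ?ltW//; last first.
  by move=> l; exact: sqnorm_ge0.
apply: eq_esum => l _; have Lh := LV Vh.
have Lc := L2_level_part l Vh; have sc := @level_part_supported l.+1 (JJ h l.+1).
rewrite sqnorm_mkcond -/(level_part _ _).
rewrite -eI in sc; rewrite -(sqnormJ setT (level_part _ _)) -(parseval (c := - pi) (L2J Lc)); last first.
  by move=> xi /sc ->; rewrite conjc0.
apply: eq_esum => k _; congr (_%:E).
have [Vf _] := cf l; have Vk := range_shiftz k Vf.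
rewrite (dotnC (LV Vk) Lh) normsqJ.
rewrite (conc_shift_dot k mone (L2_level_part_bounded l.+1 mone one1) (cf l) Vh).
have -> : (fun xi => level_part l.+1 one xi * conjc (level_part l.+1 (JJ h l.+1) xi)) =
    fun xi => conjc (level_part l.+1 (JJ h l.+1) xi).
  apply/funext => xi; rewrite /level_part /one mulr1 indicE; case: (_ \in _); first by rewrite !mul1r.
  by rewrite !mul0r conjc0.
by [].
Qed.

(** The bound C makes g1 integrable over the bounded interval, as the criterion for equality almost
    everywhere asks. *)
Lemma ae_eq_of_integrals (g1 g2 : R -> \bar R) : (forall D, measurable_fun D g1) ->
  (forall D, measurable_fun D g2) -> (forall x, 0 <= g1 x)%E -> (exists C : R, forall x, (g1 x <= C%:E)%E) ->
  (forall E : set (measurableTypeR R), measurable E -> E `<=` I ->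
     (\int[mu]_(x in E) g1 x = \int[mu]_(x in E) g2 x)%E) ->
  {ae mu, forall x, I x -> g1 x = g2 x}.
Proof.
move=> m1 m2 g10 [C hC] h.
have i1 : mu.-integrable I g1.
  apply/integrableP; split; first exact: m1.
  under eq_integral do rewrite gee0_abs//.
  apply: (@le_lt_trans _ _ (\int[mu]_(x in I) C%:E)%E).
    apply: ge0_le_integral => //; first exact: m1.
  rewrite integral_cst//; apply: lte_mul_pinfty; [|by []|exact: muI].
  exact: le_trans (g10 0) (hC 0).
have := integral_ae_eq mI i1 (m2 I); move=> /(_ _)/aeS; apply; first by move=> x /= hx; exact: hx.
by move=> E EI mE; exact: h.
Qed.

(** The projection of a test vector is measured as with the wavelet, but by the tight frame of
    shifts of the [f l]. There is no dilation, and a set inside [-pi, pi) already fits in one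
    period, so Parseval is exact on E itself. *)
Lemma fiber_diag_concentrated (f : nat -> vec R n) q : (forall l, concentrated (f l) l one) ->
  {ae mu, forall xi, I xi -> ((2 * pi)%:E * fiber_diag P q xi)%E =
     (\esum_(l in [set: nat]) (normsq (Tper theta (f l) xi q))%:E)%E}.
Proof.
move=> cf; have Lf l : L2n (f l) by apply: LV; case: (cf l).
have mA := measurable_fiber_diag cJ pP mP q.
have mT l D : measurable_fun D (fun xi => (normsq (Tper theta (f l) xi q))%:E).
  by apply: measurable_funTS; apply: emeasurable_normsq; exact: cmeasurable_Tper.
apply: ae_eq_of_integrals.
- by move=> D; apply: measurable_funeM; exact: mA.
- by move=> D; apply: measurable_funTS; apply: emeasurable_esum.
- by move=> xi; rewrite mule_ge0 ?fiber_diag_ge0// lee_fin ltW.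
- exists (2 * pi) => xi; rewrite -[leRHS]mule1; apply: lee_wpmul2l; first by rewrite lee_fin ltW.
  exact: (fiber_diag_le1 cJ pP).
move=> E mE EI; have [F tF] := test_vector_exists theta q mE EI.
have [h [Vh hF hA]] := range_projection cJ pP mP perJ VE mE EI tF.
rewrite ge0_integralZl_EFin//; [|by move=> xi _; exact: fiber_diag_ge0|exact: mA|exact: ltW].
rewrite -hA -(concentrated_frame cf Vh).
transitivity (\esum_(l in [set: nat]) \int[mu]_(xi in E) (normsq (Tper theta (f l) xi q))%:E)%E; last first.
  by apply/esym; apply: integral_esum => // l; exact: mT.
rewrite -esumZl ?ltW//; last by move=> l; apply: esum_ge0.
apply: eq_esum => l _.
have c1 x : E x -> - pi <= x by move=> /EI; rewrite /= in_itv/= => /andP[].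
have c2 x : E x -> 1%:R ^+ 0 * (x - - pi) < 2 * pi.
  by move=> /EI; rewrite /= in_itv/= expr0 mul1r => /andP[_ ?]; lra.
(* N = 1, the identity permutation and level 0: the frame sum over shifts alone. *)
have := @frame_sum_eq R 1 n 1%g theta isT E q mE EI F tF 0 (f l) (Lf l) (- pi) c1 c2.
have -> : (\int[mu]_(xi in E) (dilate_density 1 1%g theta q 0 (f l) xi)%:E =
    \int[mu]_(xi in E) (normsq (Tper theta (f l) xi q))%:E)%E.
  by apply: eq_integral => xi _; rewrite /dilate_density expr0 mul1r expg0 perm1.
move=> <-; congr (_ * _)%E; apply: eq_esum => k _; rewrite hF//.
by apply: range_shiftz; case: (cf l).
Qed.

(** Tested on sets E: the vector g with 1_E in place of 1 in the summand l + 1 has fibers 1_E times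
    those of f, and the unitary gives its norm. Both fibers come from [concentrated_Tper] with the
    same G, which does not depend on E. *)
Lemma l2sqnorm_concentrated f l : concentrated f l one ->
  {ae mu, forall xi, I xi -> (2 * pi * \1_(S l.+1) xi)%:E = l2sqnorm (Tper theta f xi)}.
Proof.
move=> cf; have [Vf _] := cf; have Lf := LV Vf.
have mi (A : set R) : measurable (A : set (measurableTypeR R)) -> cmeasurable setT (fun xi : R => (\1_A xi)%:C : R[i]).
  by move=> mA; apply: cmeasurable_indic; exact: mA.
have mS1 (D : set R) : measurable_fun D (fun xi : R => (2 * pi * \1_(S l.+1) xi : R)%:E).
  have m1 : measurable_fun setT (\1_(S l.+1) : R -> R) by apply: measurable_indic; exact: mS.
  by apply: measurable_funTS; apply/measurable_EFinP; apply: measurable_funM; [exact: measurable_cst|exact: m1].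
apply: ae_eq_of_integrals => //.
- move=> D; apply: measurable_funTS; apply: measurable_l2sqnorm => // q; exact: cmeasurable_Tper.
- by move=> xi; rewrite lee_fin mulr_ge0// ltW.
- exists (2 * pi) => xi; rewrite lee_fin ler_piMr ?(ltW P2)// indicE.
move=> E mE EI.
have i1 xi : normsq ((\1_E xi)%:C : R[i]) <= 1.
  by rewrite normsqR indicE; case: (_ \in _); rewrite ?expr1n ?expr0n.
have [g cg] := concentrated_exists (mi _ mE) (L2_level_part_bounded l.+1 (mi _ mE) i1).
have [Vg _] := cg; have Lg := LV Vg.
have gf : {ae mu, forall xi, I xi -> Tper theta g xi = fun q => (\1_E xi)%:C * Tper theta f xi q}.
  have h q : {ae mu, forall xi, I xi -> Tper theta g xi q = (\1_E xi)%:C * Tper theta f xi q}.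
    have [F tF] := test_vector_exists theta q mI (@subset_refl _ I).
    have [G [VG hG _]] := range_projection cJ pP mP perJ VE mI (@subset_refl _ I) tF.
    have := concentrated_Tper (mi _ mE) i1 cg VG tF hG.
    have := concentrated_Tper mone one1 cf VG tF hG.
    apply: aeS2 => xi h1 h2 xiI; rewrite h1// h2// /level_part /one.
    move: (\1_(S _) _) (\1_E _) (JJ _ _ _) => r s z; ring.
  by have := ae_forall_count h; apply: aeS => xi hx xiI; apply/funext => q; exact: hx.
have mu_ : measurable_fun I (fun xi => l2sqnorm (Tper theta f xi)).
  by apply: measurable_l2sqnorm => // q; exact: cmeasurable_Tper.
have e1 : (\int[mu]_(xi in I) l2sqnorm (Tper theta g xi) = \int[mu]_(xi in E) l2sqnorm (Tper theta f xi))%E.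
  transitivity (\int[mu]_(xi in I) ((\1_E xi)%:E * l2sqnorm (Tper theta f xi)))%E.
    apply: ae_eq_integral; [exact: mI| | |].
    - by apply: measurable_l2sqnorm; [exact: mI|move=> q; exact: cmeasurable_Tper].
    - apply: emeasurable_funM; last exact: mu_.
      apply/measurable_EFinP.
      by apply: measurable_funTS; case: (mi _ mE).
    apply: aeS gf => xi h xiI; rewrite h// l2sqnormZ normsqR; congr (_%:E * _)%E.
    by rewrite indicE; case: (_ \in _); rewrite ?expr1n ?expr0n.
  rewrite -[in RHS](setIidr EI) integral_mkcondr; apply: eq_integral => xi _.
  by rewrite patchE indicE; case: (_ \in _); rewrite ?mul1e ?mul0e.
rewrite -e1 (Tper_sqnorm theta Lg) (concentrated_sqnorm (mi _ mE) cg).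
have m2 : measurable_fun (S l.+1) (fun xi : R => (normsq ((\1_E xi)%:C : R[i]))%:E).
  by apply: measurable_funTS; apply: emeasurable_normsq; exact: mi.
etransitivity; last first.
  exact: (ge0_integralZl_EFin mu (mS l.+1) (fun x _ => n0 ((\1_E x)%:C)) m2 (ltW P2)).
rewrite [LHS]integral_mkcond [RHS]integral_mkcond; apply: eq_integral => xi _.
rewrite !patchE normsqR !indicE -EFinM.
by case: (xi \in E); case: (xi \in S l.+1); rewrite ?expr1n ?expr0n/= ?mulr1 ?mulr0.
Qed.

(** Counting the level sets that contain xi recovers m xi because it is a natural number or
    infinite. *)
Lemma esum_level xi : I xi ->
  (\esum_(l in [set: nat]) (\1_(S l.+1) xi)%:E = m xi)%E.
Proof.
move=> xiI; have xiI' : xi \in `[- pi, pi[ by [].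
have mem l : (\1_(S l.+1) xi = (l.+1%:R%:E <= m xi)%E%:R :> R).
  rewrite indicE; congr (nat_of_bool _)%:R; apply/idP/idP; first by rewrite inE => -[].
  by move=> h; rewrite inE; split.
case: (m_nat xiI') => [minf|[d md]]; last first.
  rewrite md -esum_lt_nat; apply: eq_esum => l _.
  by rewrite mem md lee_fin ler_nat; case: ifP.
set X := esum _ _; have hX (d : nat) : (d%:R%:E <= X)%E.
  rewrite -esum_lt_nat; apply: le_esum => l _; rewrite mem minf leey.
  by case: ifP; rewrite lee_fin ?lexx ?ler01.
rewrite minf; case: X hX => [r| |] // hX; last by have := hX 0%N.
by have := hX (Num.truncn r).+1; rewrite lee_fin leNgt truncnS_gt.
Qed.

(** The two computations meet in the double sum over q and l of the squared entries of the fibers of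
    the [f l]: summed over l it is 2 pi times the diagonal entry at q, summed over q it is 2 pi
    times the indicator of the level set of l + 1. *)
Lemma multiplicity_trace :
  {ae mu, forall xi, I xi -> m xi = (\esum_(q in [set: int * 'I_n]) fiber_diag P q xi)%E}.
Proof.
have ex l : exists f, concentrated f l one.
  exact: (concentrated_exists mone (L2_level_part_bounded l.+1 mone one1)).
have [f cf] := choice ex.
have h1 := ae_forall_count (fun q => fiber_diag_concentrated q cf).
have h2 := ae_forall_count (fun l => l2sqnorm_concentrated (cf l)).
apply: aeS2 h1 h2 => xi h1 h2 xiI.
have : ((2 * pi)%:E * m xi = (2 * pi)%:E * \esum_(q in [set: int * 'I_n]) fiber_diag P q xi)%E.
  rewrite -esumZl ?ltW//; last by move=> q; exact: fiber_diag_ge0.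
  under [RHS]eq_esum do rewrite h1//.
  rewrite exchange_esum// -esum_level// -esumZl ?ltW//.
  by apply: eq_esum => l _; rewrite -EFinM h2.
have p0 : (0 < (2 * pi)%:E :> \bar R)%E by rewrite lte_fin.
case: (m xi) (esum _ _) => [r| |] [s| |] //; rewrite ?gt0_muley ?gt0_muleNy// -?EFinM.
by move=> [] /(mulfI (lt0r_neq0 P2)) ->.
Qed.

End Multiplicity.

Lemma esum_frame_density (R : realType) (N n : nat) (sigma : {perm 'I_n}) (theta : 'I_n -> R)
    (p : nat) (psi : 'I_p -> vec R n) (xi : R) :
  (\esum_(q in [set: int * 'I_n]) \esum_(l in [set: nat]) frame_density N sigma theta psi q l xi =
   \sum_(a < p) \sum_(1 <= l <oo) \sum_(i < n) \esum_(k in [set: int])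
     (normsq (fourier (psi a ((sigma ^+ l)%g i))
       (N%:R ^+ l * (xi - theta i + 2 * k%:~R * pi))))%:E)%E.
Proof.
pose d a l q : \bar R := (dilate_density N sigma theta q l (psi a) xi)%:E.
have d0 a l q : (0 <= d a l q)%E by rewrite lee_fin normsq_ge0.
rewrite exchange_esum; last by move=> q l; exact: frame_density_ge0.
transitivity (\esum_(l in [set: nat]) \sum_(a < p) \esum_(q in [set: int * 'I_n]) d a l.+1 q)%E.
  by apply: eq_esum => l _; rewrite -esum_sum.
rewrite esum_sum; last by move=> l a _ _; exact: esum_ge0.
apply: eq_bigr => a _; rewrite -nneseries_addn; last first.
  by move=> l; apply: sume_ge0 => i _; apply: esum_ge0 => k _; rewrite lee_fin normsq_ge0.
rewrite -nneseries_esumT; last by move=> l; exact: esum_ge0.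
by apply: eq_eseriesr => l _; rewrite addn1 esum_finprod.
Qed.

Theorem theorem6p10 (R : realType) (N n : nat) (hN : (2 <= N)%N)
    (hn : (1 <= n)%N) (sigma : {perm 'I_n}) (theta : 'I_n -> R)
    (htheta : forall k, theta k \in `[- pi, pi[)
    (hz : forall k, zpt theta k ^+ N = zpt theta (sigma k))
    (p : nat) (psi : 'I_p -> vec R n)
    (hpsi : semiorthogonal_wavelet N sigma theta psi)
    (m : R -> \bar R)
    (hm : multiplicity_function theta (core_space N sigma theta psi) m)
    (J : R -> set (zseq R n))
    (hJ : range_function theta (core_space N sigma theta psi) J) :
  {ae lebesgue_measure, forall xi : R, xi \in `[- pi, pi[ ->
    m xi = subspace_dim (J xi) /\
    subspace_dim (J xi) =
      (\sum_(a < p) \sum_(1 <= l <oo) \sum_(i < n) \esum_(k in [set: int])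
        (normsq (fourier (psi a ((sigma ^+ l)%g i))
          (N%:R ^+ l * (xi - theta i + 2 * k%:~R * pi))))%:E)%E}.
Proof.
have [cJ [P [pP mP]] perJ VE] := hJ.
have [mm m_nat [JJ [h1 h2 h3 h4 h5]]] := hm.
have trace := multiplicity_trace cJ pP mP perJ VE mm m_nat h1 h2 h3 h4 h5.
have frame := ae_forall_count (fiber_diag_frame hN hpsi cJ pP mP perJ VE).
apply: aeS2 trace frame => xi mE fE xiI.
have dimE : subspace_dim (J xi) = (\esum_(q in [set: int * 'I_n]) fiber_diag P q xi)%E.
  exact: subspace_dim_trace (cJ xi) (pP xi).
split; first by rewrite dimE mE.
by rewrite dimE -esum_frame_density; apply: eq_esum => q _; rewrite fE.
Qed.
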